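(* Let $D$ be either a totally real number field or a totally indefinite quaternion algebra over a totally real number field, and let $\dag$ be a positive involution of $D$. Let $V$ be a left $D$-vector space of dimension $m$, equipped with a non-degenerate $(D,\dag)$-skew-Hermitian form $\psi \colon V \times V \to D$. Let $L$ be a $\mathbb{Z}$-lattice of full rank in $V$ such that $\operatorname{Trd}_{D/\mathbb{Q}} \psi(L \times L) \subset \mathbb{Z}$, and let $R=\operatorname{Stab}_D(L)=\{a\in D: aL\subset L\}$. Then there exists a $D$-basis $v_1, \dotsc, v_m$ of $V$ such that: (i) $v_1, \dotsc, v_m \in L$; (ii) the basis is weakly symplectic (when $D$ is a field) or weakly unitary (when $D$ is a quaternion algebra) with respect to $\psi$; (iii) $[L:Rv_1 + \dotsb + Rv_m] \leq c_1 \lvert\operatorname{disc}(R)\rvert^{c_2} \lvert\operatorname{disc}(L)\rvert^{c_3}$; (iv) $\lvert\psi(v_i, v_j)\rvert_D \leq c_4 \lvert\operatorname{disc}(R)\rvert^{c_5} \lvert\operatorname{disc}(L)\rvert^{c_6}$ for all $1 \leq i, j \leq m$, where the positive constants $c_1,\dots,c_6$ depend only on $m$ and $\dim_\mathbb{Q}(D)$.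
   Context: An involution $\dag$ of a $\mathbb{Q}$-algebra $D$ is a $\mathbb{Q}$-linear map with $\dag\circ\dag=\mathrm{id}$ and $(ab)^\dag=b^\dag a^\dag$; it is positive if $(a,b)\mapsto \operatorname{Trd}_{D/\mathbb{Q}}(ab^\dag)$ is positive definite, where $\operatorname{Trd}_{D/\mathbb{Q}}=\operatorname{Tr}_{F/\mathbb{Q}}\circ\operatorname{Trd}_{D/F}$ ($F$ the centre of $D$, $\operatorname{Trd}_{D/F}$ the reduced trace). A $(D,\dag)$-skew-Hermitian form is a $\mathbb{Q}$-bilinear map $\psi\colon V\times V\to D$ with $\psi(y,x)=-\psi(x,y)^\dag$ and $\psi(ax,by)=a\psi(x,y)b^\dag$ for all $a,b\in D$, $x,y\in V$; it is non-degenerate if for every $x\neq 0$ there is $y$ with $\psi(x,y)\neq 0$. A $D$-basis $v_1,\dots,v_m$ is weakly symplectic if $\psi(v_i,v_j)=0$ for all $i,j$ except when $\{i,j\}=\{2k-1,2k\}$ for some integer $k$, and weakly unitary if $\psi(v_i,v_j)=0$ whenever $i\neq j$. For $a\in D_\mathbb{R}=D\otimes_\mathbb{Q}\mathbb{R}$, $\lvert a\rvert_D=\sqrt{\operatorname{Trd}_{D_\mathbb{R}/\mathbb{R}}(aa^\dag)}$. For an order $R$ of $D$, $\operatorname{disc}(R)$ is the determinant of the matrix $(\operatorname{Tr}_{D/\mathbb{Q}}(r_ir_j))_{i,j}$ for a $\mathbb{Z}$-basis $(r_i)$ of $R$, with $\operatorname{Tr}_{D/\mathbb{Q}}$ the non-reduced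 trace. $\operatorname{disc}(L)$ is the determinant of the Gram matrix of the bilinear form $\operatorname{Trd}_{D/\mathbb{Q}}\circ\psi$ on a $\mathbb{Z}$-basis of $L$. *)

(* Defs.v *)
From HB Require Import structures.
From mathcomp Require Import all_boot all_order all_algebra all_field.
From mathcomp Require Import complex.
From mathcomp Require Import all_classical reals exp.

Set Implicit Arguments.
Unset Strict Implicit.
Unset Printing Implicit Defensive.

Import Order.TTheory GRing.Theory Num.Theory.
Local Open Scope classical_set_scope.
Local Open Scope ring_scope.

(** * Traces

    A number field is a [F : fieldExtType rat]; the algebra [D] is a
    finite-dimensional [F]-algebra with centre [F].  Its [rat]-structure is the
    one induced by [F], so that the scalar [q : rat] acts as [q%:A : F]. *)

Definition regular_mx (K : fieldType) (A : falgType K) (x : A) :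
    'M[K]_(\dim {:A}) :=
  \matrix_(i, j) coord (vbasis {:A}) j (x * (vbasis {:A})`_i).

Definition alg_trace (K : fieldType) (A : falgType K) (x : A) : K :=
  \tr (regular_mx x).

(* The degree of a central simple algebra is the square root of its
   dimension. *)
Definition alg_degree (F : fieldType) (D : falgType F) : nat :=
  Nat.sqrt (\dim {:D}).

(* For a central simple algebra, [Tr_{D/F} = deg(D) Trd_{D/F}]; as [F] has
   characteristic zero this determines [Trd_{D/F}].  Lemmas [trd_center] and
   [trd_split] below check that this is the usual reduced trace. *)
Definition trd (F : fieldExtType rat) (D : falgType F) (x : D) : F :=
  (alg_degree D)%:R^-1 * alg_trace x.

Definition trdQ (F : fieldExtType rat) (D : falgType F) (x : D) : rat :=
  alg_trace (trd x).

Definition trQ (F : fieldExtType rat) (D : falgType F) (x : D) : rat :=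
  alg_trace (alg_trace x).

Definition dimQ (F : fieldExtType rat) (D : falgType F) : nat :=
  (\dim {:F} * \dim {:D})%N.

(** * The algebra D *)

Definition totally_real (R : realType) (F : fieldExtType rat) : Prop :=
  forall (s : {rmorphism F -> R[i]}) (x : F), complex.Im (s x) = 0.

(* [D] is the field [F] itself. *)
Definition is_center (F : fieldType) (D : falgType F) : Prop :=
  forall x : D, exists a : F, x = a%:A.

Definition quaternion_algebra (F : fieldType) (D : falgType F) : Prop :=
  exists (i j : D) (a b : F),
    [/\ a != 0 /\ b != 0, i * i = a%:A, j * j = b%:A, i * j = - (j * i)
      & basis_of {:D} [:: 1; i; j; i * j]].

Definition semilinear_along (F K : fieldType) (D : falgType F) (s : F -> K) (d : nat)
    (phi : D -> 'M[K]_d) : Prop :=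
  forall (a : F) (x : D), phi (a *: x) = s a *: phi x.

(* For every [s : F -> R], the algebra [D (x)_{F,s} R] is isomorphic to
   [M_2(R)]: giving such an isomorphism amounts to giving an [s]-semilinear
   ring morphism [D -> M_2(R)] mapping an [F]-basis to an [R]-basis. *)
Definition totally_indefinite (R : realType) (F : fieldExtType rat)
    (D : falgType F) : Prop :=
  forall s : {rmorphism F -> R}, exists phi : {rmorphism D -> 'M[R]_2},
    semilinear_along s phi /\
    basis_of {:'M[R]_2} [seq phi x | x <- vbasis {:D}].

(** * Involutions and skew-Hermitian forms *)

Definition involution (F : fieldExtType rat) (D : falgType F) (dag : D -> D) :
    Prop :=
  [/\ forall (q : rat) (x y : D),
        dag ((q%:A : F) *: x + y) = (q%:A : F) *: dag x + dag y,
      forall x, dag (dag x) = x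
    & forall x y, dag (x * y) = dag y * dag x].

Definition positive_involution (F : fieldExtType rat) (D : falgType F)
    (dag : D -> D) : Prop :=
  involution dag /\ forall x : D, x != 0 -> 0 < trdQ (x * dag x).

(* Homogeneity for the scalars in [rat] is the case [a, b : rat] of the third
   clause. *)
Definition skew_hermitian_form (F : fieldExtType rat) (D : falgType F)
    (dag : D -> D) (V : lmodType D) (psi : V -> V -> D) : Prop :=
  [/\ forall x x' y, psi (x + x') y = psi x y + psi x' y,
      forall x y y', psi x (y + y') = psi x y + psi x y',
      forall (a b : D) x y, psi (a *: x) (b *: y) = a * psi x y * dag b
    & forall x y, psi y x = - dag (psi x y)].

Definition nondegenerate_form (D : nzRingType) (V : lmodType D)
    (psi : V -> V -> D) : Prop :=
  forall x, x != 0 -> exists y, psi x y != 0.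

Definition dnorm (R : realType) (F : fieldExtType rat) (D : falgType F)
    (dag : D -> D) (x : D) : R :=
  Num.sqrt (ratr (trdQ (x * dag x))).

(** * Bases *)

Definition dbasis (D : nzRingType) (V : lmodType D) (m : nat)
    (v : 'I_m -> V) : Prop :=
  (forall x, exists a : 'I_m -> D, x = \sum_i a i *: v i) /\
  (forall a : 'I_m -> D, \sum_i a i *: v i = 0 -> forall i, a i = 0).

Definition has_dim (D : nzRingType) (V : lmodType D) (m : nat) : Prop :=
  exists v : 'I_m -> V, dbasis v.

(* Indices start at 0, so the pairs {2k-1, 2k} become {2k, 2k+1}. *)
Definition weakly_symplectic (D : nzRingType) (V : lmodType D)
    (psi : V -> V -> D) (m : nat) (v : 'I_m -> V) : Prop :=
  forall i j : 'I_m,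
    ~ (exists k : nat, (i = k.*2 :> nat /\ j = k.*2.+1 :> nat) \/
                       (i = k.*2.+1 :> nat /\ j = k.*2 :> nat)) ->
    psi (v i) (v j) = 0.

Definition weakly_unitary (D : nzRingType) (V : lmodType D)
    (psi : V -> V -> D) (m : nat) (v : 'I_m -> V) : Prop :=
  forall i j : 'I_m, i != j -> psi (v i) (v j) = 0.

(** * Lattices *)

Definition zbasis (M : zmodType) (S : set M) (n : nat) (b : 'I_n -> M) : Prop :=
  (forall x, S x <-> exists z : 'I_n -> int, x = \sum_i b i *~ z i) /\
  (forall z : 'I_n -> int, \sum_i b i *~ z i = 0 -> forall i, z i = 0).

(* [m * dimQ D] is the dimension over [rat] of a space of [D]-dimension [m]. *)
Definition full_lattice (F : fieldExtType rat) (D : falgType F)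
    (V : lmodType D) (m : nat) (L : set V) : Prop :=
  exists b : 'I_(m * dimQ D) -> V, zbasis L b.

(* The Gram determinant on a Z-basis does not depend on the basis when, as in
   the two uses below, the form is biadditive.  The value is 0 if there is no
   finite Z-basis. *)
Definition gram_disc (M : zmodType) (B : M -> M -> rat) (S : set M) : rat :=
  xget 0 [set d | exists n (b : 'I_n -> M),
                    zbasis S b /\ d = \det (\matrix_(i, j) B (b i) (b j))].

Definition disc_order (F : fieldExtType rat) (D : falgType F) (S : set D) :
    rat :=
  gram_disc (fun x y => trQ (x * y)) S.

Definition disc_lattice (F : fieldExtType rat) (D : falgType F)
    (V : lmodType D) (psi : V -> V -> D) (L : set V) : rat :=
  gram_disc (fun x y => trdQ (psi x y)) L.

Definition stab (D : nzRingType) (V : lmodType D) (L : set V) : set D :=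
  [set a | forall x, L x -> L (a *: x)].

Definition span_over (D : nzRingType) (V : lmodType D) (S : set D) (m : nat)
    (v : 'I_m -> V) : set V :=
  [set x | exists a : 'I_m -> D, (forall i, S (a i)) /\ x = \sum_i a i *: v i].

(* [f] is a system of representatives of the cosets of [N] in [L]. *)
Definition has_index (M : zmodType) (L N : set M) (k : nat) : Prop :=
  N `<=` L /\
  exists f : 'I_k -> M, (forall i, L (f i)) /\
    forall x, L x -> exists! i : 'I_k, N (x - f i).

(** * Consistency of [trd] with the usual reduced trace *)

Lemma regular_mxE (K : fieldType) (A : falgType K) (x : A)
    (i : 'I_(\dim {:A})) :
  x * (vbasis {:A})`_i = \sum_j regular_mx x i j *: (vbasis {:A})`_j.
Proof.
by rewrite {1}(coord_vbasis (memvf (x * _))); apply: eq_bigr => j _; rewrite mxE.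
Qed.

Lemma regular_mxM (K : fieldType) (A : falgType K) (x y : A) :
  regular_mx (x * y) = regular_mx y *m regular_mx x.
Proof.
apply/matrixP => i j; rewrite mxE -mulrA regular_mxE mulr_sumr linear_sum mxE.
by apply: eq_bigr => k _; rewrite -scalerAr linearZ /= [regular_mx x k j]mxE.
Qed.

Lemma alg_traceC (K : fieldType) (A : falgType K) (x y : A) :
  alg_trace (x * y) = alg_trace (y * x).
Proof. by rewrite /alg_trace !regular_mxM mxtrace_mulC. Qed.

Lemma alg_traceP (K : fieldType) (A : falgType K) (a : K) (x y : A) :
  alg_trace (a *: x + y) = a * alg_trace x + alg_trace y.
Proof.
rewrite /alg_trace /mxtrace mulr_sumr -big_split /=; apply: eq_bigr => i _.
by rewrite !mxE mulrDl linearD -scalerAl linearZ.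
Qed.

Lemma alg_trace1 (K : fieldType) (A : falgType K) :
  alg_trace (1 : A) = (\dim {:A})%:R.
Proof.
rewrite /alg_trace -[RHS]mxtrace1; congr (\tr _); apply/matrixP => i j.
by rewrite !mxE mul1r coord_free ?(basis_free (vbasisP _)) // eq_sym.
Qed.

Lemma trd_center (F : fieldExtType rat) (D : falgType F) (a : F) :
  is_center D -> trd (a%:A : D) = a.
Proof.
move=> hD; have d1 : \dim {:D} = 1%N.
  suff -> : fullv = <[1 : D]>%VS by rewrite dim_vline oner_eq0.
  apply/eqP; rewrite eqEsubv subvf andbT; apply/subvP => x _.
  by have [b ->] := hD x; rewrite memvZ ?memv_line.
rewrite /trd /alg_degree d1 invr1 mul1r -[a%:A]addr0 alg_traceP alg_trace1 d1.
have := alg_traceP 0 (0 : D) 0; rewrite scale0r add0r mul0r add0r => _.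
have := alg_traceP (-1) (0 : D) 0; rewrite scaler0 add0r mulN1r addNr => ->.
by rewrite mulr1 addr0.
Qed.

Lemma quaternion_trace (F : fieldExtType rat) (K : fieldType) (D : falgType F)
    (s : {rmorphism F -> K}) (t t' : D -> K) :
  quaternion_algebra D ->
  (forall a x y, t (a *: x + y) = s a * t x + t y) ->
  (forall x y, t (x * y) = t (y * x)) ->
  (forall a x y, t' (a *: x + y) = s a * t' x + t' y) ->
  (forall x y, t' (x * y) = t' (y * x)) ->
  t 1 = t' 1 -> t =1 t'.
Proof.
case=> i [j] [a] [b] [[a0 b0] ii jj ij bD] tP tC t'P t'C t1 x.
have tw : (2%:R : K) != 0.
  by rewrite -(rmorph_nat s) fmorph_eq0 -(rmorph_nat (in_alg F)) fmorph_eq0.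
have main u : (forall a x y, u (a *: x + y) = s a * u x + u y) ->
    (forall x y, u (x * y) = u (y * x)) ->
    [/\ u 0 = 0, u i = 0, u j = 0 & u (i * j) = 0].
  move=> uP uC.
  have u0 : u 0 = 0.
    by have := uP (-1) 0 0; rewrite scaler0 add0r rmorphN1 mulN1r addNr.
  have uZ c y : u (c *: y) = s c * u y by rewrite -[c *: y]addr0 uP u0 addr0.
  have uN y : u (- y) = - u y by rewrite -scaleN1r uZ rmorphN1 mulN1r.
  have z y : u y = - u y -> u y = 0.
    move=> h; apply/eqP; have /eqP : u y *+ 2 = 0 by rewrite mulr2n {1}h addNr.
    by rewrite -mulr_natl mulf_eq0 (negPf tw).
  have sc c y : c != 0 -> u (c *: y) = 0 -> u y = 0.
    by move=> c0 /eqP; rewrite uZ mulf_eq0 fmorph_eq0 (negPf c0) => /eqP.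
  split=> //.
  - apply: (sc b) => //; rewrite -{1}[ i ]mul1r scalerAl -jj -mulrA.
    by apply: z; rewrite {1}uC -mulrA -uN; congr u; rewrite ij ?mulrN.
  - apply: (sc a) => //; rewrite -{1}[j]mul1r scalerAl -ii -mulrA.
    apply: z; rewrite {1}uC -mulrA -uN; congr u.
    by rewrite -mulrN ij opprK.
  - by apply: z; rewrite {1}uC -uN ij opprK.
have [t0 ti tj tk] := main t tP tC; have [t0' ti' tj' tk'] := main t' t'P t'C.
have : x \in span [:: 1; i; j; i * j] by rewrite (span_basis bD) memvf.
rewrite !span_cons span_nil addv0.
case/memv_addP=> y0 /vlineP[x0 ->] [y1 hy1 ->].
case/memv_addP: hy1 => y2 /vlineP[x1 ->] [y3 hy3 ->].
case/memv_addP: hy3 => y4 /vlineP[x2 ->] [y5 /vlineP[x3 ->] ->].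
rewrite -[x3 *: _]addr0 !tP !t'P.
by rewrite t1 ti tj tk t0 ti' tj' tk' t0'.
Qed.

Lemma trd_split (F : fieldExtType rat) (K : fieldType) (D : falgType F)
    (s : {rmorphism F -> K}) (phi : {rmorphism D -> 'M[K]_2}) (x : D) :
  quaternion_algebra D -> semilinear_along s phi -> \tr (phi x) = s (trd x).
Proof.
move=> hD sl; apply: (@quaternion_trace _ _ _ s (fun x => \tr (phi x))
  (fun x => s (trd x))) => // {x}.
- by move=> a x y; rewrite rmorphD sl linearD linearZ.
- by move=> x y; rewrite !rmorphM mxtrace_mulC.
- move=> a x y; rewrite /trd alg_traceP mulrDr rmorphD; congr (_ + _).
  by rewrite -rmorphM; congr (s _); rewrite mulrCA.
- by move=> x y; rewrite /trd alg_traceC.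
have [i [j [a [b [_ _ _ _ bD]]]]] := hD.
have d4 : \dim {:D} = 4%N by case/andP: bD => /eqP <- /eqP ->.
rewrite rmorph1 mxtrace1 /trd /alg_degree alg_trace1 d4 /=.
rewrite -(rmorph_nat s); congr (s _).
have tw : (2%:R : F) != 0 by rewrite -(rmorph_nat (in_alg F)) fmorph_eq0.
have -> : 4%:R = 2%:R * 2%:R :> F by rewrite -natrM.
by rewrite mulKf.
Qed.

(* Main.v *)
Require Import Defs.
From HB Require Import structures.
From mathcomp Require Import all_boot all_order all_algebra all_field.
From mathcomp Require Import all_classical reals exp.
From mathcomp Require Import complex perm.
From mathcomp Require Import ring lra zify.

Set Implicit Arguments.
Unset Strict Implicit.
Unset Printing Implicit Defensive.

Import Order.TTheory GRing.Theory Num.Theory.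
Local Open Scope classical_set_scope.
Local Open Scope ring_scope.

(** Write E = trdQ o psi, R for the stabilizer of L, k and q for the absolute
    values of disc R and disc L.  The elements of L are measured by a positive
    definite form h built from a D-basis of V that is orthogonal (or hyperbolic)
    for psi and whose Gram entries are normalized by weak approximation at the
    real places of F: then [|psi(x, y)|^2 <= c h(x) h(y)], and E is close to
    unimodular with respect to h.  A Hermite-reduced Z-basis x_1, ..., x_r of L
    for h has a dual basis for E with denominator q; pairing the longest x_i with
    its dual vector gives some x_j with [h(x_j) h(x_l) <= c q^2] for all l.
    From x_j one gets a hyperbolic pair when D is a field, and, after adding to a
    second vector a suitable bounded multiple of x_j, a short anisotropic vector
    when D is a quaternion algebra.  A norm estimate in R bounds an integer M such
    that M L lies in the R-span of this block plus its orthogonal complement in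
    L; the complement is again R-stable with dual denominator M^2 q, so the
    theorem follows by induction on the rank. *)

(** The constants may depend only on [m] and the dimension of [D], so h must be comparable with
    [psi] uniformly in [L]. For this reason the frame defining h is taken in the Q-span of the
    lattice: there it can be rescaled by elements of [F] until its Gram entries and their inverses
    are bounded in terms of the dimension alone. The denominator that this costs cancels between the
    two estimates for the dual vector. Discriminants of complements are never computed. That [q]
    times every integral functional is represented through E follows from Cramer's rule for [L], and
    it passes to complements. Total indefiniteness enters because it makes the skew elements of [D]
    a line over [F]. When the short vector [x] is isotropic, the value of the form at [z + s x] with
    [s] in [F] is then [f + s] times a fixed skew element, and an integral [s] makes [f + s] small;
    if [f + s] vanishes, [s + 1] is used instead. *)

Inductive zmod_term :=
  ZVar of nat | ZZero | ZAdd of zmod_term & zmod_term | ZOpp of zmod_term.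

Fixpoint zmod_eval (M : zmodType) (e : seq M) (t : zmod_term) : M :=
  match t with
  | ZVar n => nth 0 e n
  | ZZero => 0
  | ZAdd a b => zmod_eval e a + zmod_eval e b
  | ZOpp a => - zmod_eval e a
  end.

Fixpoint zmod_coef (t : zmod_term) (i : nat) : int :=
  match t with
  | ZVar n => (n == i)%:R
  | ZZero => 0
  | ZAdd a b => zmod_coef a i + zmod_coef b i
  | ZOpp a => - zmod_coef a i
  end.

Lemma zmod_evalE (M : zmodType) (e : seq M) t :
  zmod_eval e t = \sum_(i < size e) nth 0 e i *~ zmod_coef t i.
Proof.
elim: t => [n||a IHa b IHb|a IHa] /=.
- have [n_lt|n_ge] := ltnP n (size e).
    rewrite (bigD1 (Ordinal n_lt)) //= eqxx big1 ?addr0 // => i.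
    by rewrite -val_eqE /= eq_sym => /negPf ->.
  rewrite nth_default // big1 // => i _; case: eqP => // ni.
  by have := ltn_ord i; rewrite -ni ltnNge n_ge.
- by rewrite big1 // => i _; rewrite mulr0z.
- by rewrite IHa IHb -big_split /=; apply: eq_bigr => i _; rewrite mulrzDr.
- by rewrite IHa -sumrN; apply: eq_bigr => i _; rewrite mulrNz.
Qed.

Lemma zmod_eval_eq (M : zmodType) (e : seq M) t t' :
  all (fun i => zmod_coef t i == zmod_coef t' i) (iota 0 (size e)) ->
  zmod_eval e t = zmod_eval e t'.
Proof.
move=> /allP h; rewrite !zmod_evalE; apply: eq_bigr => i _; congr (_ *~ _).
by apply/eqP/h; rewrite mem_iota /=.
Qed.

Ltac zmod_index x l :=
  lazymatch l with
  | nil => fail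
  | cons ?y ?l' =>
      match constr:(tt) with
      | _ => let _ := match constr:(tt) with _ => unify x y end in constr:(O)
      | _ => let n := zmod_index x l' in constr:(S n)
      end
  end.

Ltac zmod_insert x l :=
  match constr:(tt) with
  | _ => let _ := zmod_index x l in l
  | _ => constr:(cons x l)
  end.

Ltac zmod_vars t l :=
  lazymatch t with
  | (?a + ?b)%R => let l1 := zmod_vars a l in zmod_vars b l1
  | (- ?a)%R => zmod_vars a l
  | 0%R => l
  | _ => zmod_insert t l
  end.

Ltac zmod_reify t l :=
  lazymatch t with
  | (?a + ?b)%R =>
      let a' := zmod_reify a l in let b' := zmod_reify b l in constr:(ZAdd a' b')
  | (- ?a)%R => let a' := zmod_reify a l in constr:(ZOpp a')
  | 0%R => constr:(ZZero)
  | _ => let n := zmod_index t l in constr:(ZVar n)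
  end.

(* Decides linear identities in an abelian group, where [ring] does not apply. *)
Ltac zmod :=
  lazymatch goal with
  | |- @eq ?M ?x ?y =>
      let l0 := constr:(@nil M) in
      let l1 := zmod_vars x l0 in
      let l := zmod_vars y l1 in
      let t := zmod_reify x l in
      let t' := zmod_reify y l in
      exact: (@zmod_eval_eq _ l t t' (erefl true))
  end.

(** * Subgroups, additive and biadditive maps *)

Definition subgroup (U : zmodType) (S : set U) : Prop :=
  S 0 /\ forall x y, S x -> S y -> S (x - y).

Section Subgroup.
Variables (U : zmodType) (S : set U).
Hypothesis sS : subgroup S.

Lemma subgroup0 : S 0. Proof. exact: sS.1. Qed.

Lemma subgroupB x y : S x -> S y -> S (x - y). Proof. exact: sS.2. Qed.

Lemma subgroupN x : S x -> S (- x).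
Proof. by move=> Sx; rewrite -sub0r; apply: subgroupB => //; exact: subgroup0. Qed.

Lemma subgroupD x y : S x -> S y -> S (x + y).
Proof. by move=> Sx Sy; rewrite -[y]opprK; apply/subgroupB/subgroupN. Qed.

Lemma subgroupMn x n : S x -> S (x *+ n).
Proof.
move=> Sx; elim: n => [|n IH]; first by rewrite mulr0n; exact: subgroup0.
by rewrite mulrS; apply: subgroupD.
Qed.

Lemma subgroupMz x (z : int) : S x -> S (x *~ z).
Proof.
by move=> Sx; case: z => n; [|apply: subgroupN]; apply: subgroupMn.
Qed.

Lemma subgroup_sum (I : finType) (P : pred I) (f : I -> U) :
  (forall i, P i -> S (f i)) -> S (\sum_(i | P i) f i).
Proof. by move=> Sf; elim/big_ind: _ => //; [exact: subgroup0|exact: subgroupD]. Qed.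

End Subgroup.

Section AdditiveOn.
Variables (U : zmodType) (S : set U) (lam : U -> int).
Hypothesis sS : subgroup S.
Hypothesis lamD : forall x y, S x -> S y -> lam (x + y) = lam x + lam y.

(** Additivity is asked only on [S], because the functionals used later, such as coordinate
    functions obtained by choice, have arbitrary values elsewhere. *)
Lemma additive_on_mulz x (z : int) : S x -> lam (x *~ z) = z * lam x.
Proof.
move=> Sx; have lam0 : lam 0 = 0.
  by apply: (addrI (lam 0)); rewrite -lamD ?addr0 //; exact: subgroup0 sS.
have lamN y : S y -> lam (- y) = - lam y.
  move=> Sy; apply: (addrI (lam y)); rewrite -lamD //; last exact: subgroupN.
  by rewrite !subrr.
have lamMn l : lam (x *+ l) = l%:Z * lam x.
  elim: l => [|l IH]; first by rewrite mul0r mulr0n lam0.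
  rewrite mulrS lamD ?IH //; last exact: (subgroupMn sS).
  by rewrite intS mulrDl mul1r.
case: z => l; first by rewrite -pmulrn lamMn.
rewrite NegzE mulrNz -pmulrn lamN ?lamMn ?mulNr //.
exact: subgroupMn.
Qed.

Lemma additive_on_sum (I : finType) (f : I -> U) (z : I -> int) :
  (forall i, S (f i)) -> lam (\sum_i f i *~ z i) = \sum_i z i * lam (f i).
Proof.
move=> Sf; suff : S (\sum_i f i *~ z i) /\ lam (\sum_i f i *~ z i) = \sum_i z i * lam (f i).
  by case.
elim/big_rec2: _ => [|i a x _ [Sx <-]].
  split; first exact: subgroup0.
  by rewrite -(mulr0z 0) additive_on_mulz ?mul0r //; exact: subgroup0.
have Sz : S (f i *~ z i) by exact: subgroupMz.
by rewrite lamD // additive_on_mulz //; split=> //; exact: subgroupD.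
Qed.

End AdditiveOn.

Section Biadditive.
Variables (U V A : zmodType) (h : U -> V -> A).
Hypothesis hDl : forall x x' y, h (x + x') y = h x y + h x' y.
Hypothesis hDr : forall x y y', h x (y + y') = h x y + h x y'.

Lemma biadd0l y : h 0 y = 0.
Proof. by apply: (addrI (h 0 y)); rewrite -hDl !addr0. Qed.

Lemma biadd0r x : h x 0 = 0.
Proof. by apply: (addrI (h x 0)); rewrite -hDr !addr0. Qed.

Lemma biaddNl x y : h (- x) y = - h x y.
Proof. by apply: (addrI (h x y)); rewrite -hDl !subrr biadd0l. Qed.

Lemma biaddNr x y : h x (- y) = - h x y.
Proof. by apply: (addrI (h x y)); rewrite -hDr !subrr biadd0r. Qed.

Lemma biaddBl x x' y : h (x - x') y = h x y - h x' y.
Proof. by rewrite hDl biaddNl. Qed.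

Lemma biaddBr x y y' : h x (y - y') = h x y - h x y'.
Proof. by rewrite hDr biaddNr. Qed.

Lemma biaddMnl x y n : h (x *+ n) y = h x y *+ n.
Proof.
by elim: n => [|n IH]; rewrite ?mulr0n ?biadd0l // !mulrS hDl IH.
Qed.

Lemma biaddMnr x y n : h x (y *+ n) = h x y *+ n.
Proof.
by elim: n => [|n IH]; rewrite ?mulr0n ?biadd0r // !mulrS hDr IH.
Qed.

Lemma biaddMzl x y (z : int) : h (x *~ z) y = h x y *~ z.
Proof. by case: z => n; rewrite ?NegzE ?mulrNz ?biaddNl -?pmulrn biaddMnl. Qed.

Lemma biaddMzr x y (z : int) : h x (y *~ z) = h x y *~ z.
Proof. by case: z => n; rewrite ?NegzE ?mulrNz ?biaddNr -?pmulrn biaddMnr. Qed.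

Lemma biadd_suml (I : finType) (P : pred I) (f : I -> U) y :
  h (\sum_(i | P i) f i) y = \sum_(i | P i) h (f i) y.
Proof.
by elim/big_rec2: _ => [|i a b _ <-]; rewrite ?biadd0l ?hDl.
Qed.

Lemma biadd_sumr (I : finType) (P : pred I) x (f : I -> V) :
  h x (\sum_(i | P i) f i) = \sum_(i | P i) h x (f i).
Proof.
by elim/big_rec2: _ => [|i a b _ <-]; rewrite ?biadd0r ?hDr.
Qed.

End Biadditive.

Section QuadraticForm.
Variables (U : zmodType) (h : U -> U -> rat).
Hypothesis hDl : forall x x' y, h (x + x') y = h x y + h x' y.
Hypothesis hDr : forall x y y', h x (y + y') = h x y + h x y'.

Lemma qform_mulz x (z : int) : h (x *~ z) (x *~ z) = z%:~R ^+ 2 * h x x.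
Proof.
rewrite (biaddMzl hDl) (biaddMzr hDr) -[LHS]mulrzr -[h x x *~ z]mulrzr.
by rewrite mulrC [h x x * _]mulrC mulrA expr2.
Qed.

End QuadraticForm.

(** * Hermite reduction *)

(** In the recursion the first summand bounds the coordinate along the vector split off and the
    second bounds the other coordinates, so the sum serves for all of them. *)
Fixpoint hermite_const (s : nat) : rat :=
  if s is s'.+1 then
    s'.+1%:R * (1 + s'%:R * hermite_const s') + 2%:R * hermite_const s'
  else 1.

Lemma hermite_const_ge1 s : 1 <= hermite_const s.
Proof.
elim: s => //= s IH; set C := hermite_const s in IH *.
have : 0 <= s.+1%:R * (1 + s%:R * C).
  by rewrite mulr_ge0 ?ler0n // addr_ge0 // mulr_ge0 ?ler0n //; lra.
lra.
Qed.

Lemma sum_sqr_le (A : realFieldType) n (a : 'I_n -> A) :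
  (\sum_i a i) ^+ 2 <= n%:R * \sum_i a i ^+ 2.
Proof.
elim: n a => [|n IH] a; first by rewrite !big_ord0 mulr0 expr2 mulr0.
rewrite !big_ord_recl; move: (IH (fun i => a (lift ord0 i))) => {IH}.
case: n a => [|n] a; first by rewrite !big_ord0 !addr0 mul1r.
move: (\sum_(i < _) _) (\sum_(i < _) _) (a ord0) => t s b st.
have np : 0 < n.+1%:R :> A by rewrite ltr0n.
rewrite -[n.+2%:R]natr1; move: np st; move: (n.+1%:R) => N np st.
(* This comes from [(N b - s) ^ 2 >= 0] and the induction hypothesis [s ^ 2 <= N t]. *)
have main : 2%:R * (b * s) <= N * b ^+ 2 + t.
  rewrite -(ler_pM2l np) -subr_ge0.
  have -> : N * (N * b ^+ 2 + t) - N * (2%:R * (b * s))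
     = (N * b - s) ^+ 2 + (N * t - s ^+ 2) by ring.
  by rewrite addr_ge0 ?sqr_ge0 ?subr_ge0.
rewrite -subr_ge0.
have -> : (N + 1) * (b ^+ 2 + t) - (b + s) ^+ 2
   = (N * b ^+ 2 + t - 2%:R * (b * s)) + (N * t - s ^+ 2) by ring.
by rewrite addr_ge0 ?subr_ge0.
Qed.

Lemma nearest_int (A : archiRealFieldType) (x : A) :
  exists z : int, `|x - z%:~R| <= 2%:R^-1.
Proof.
exists (Num.floor (x + 2%:R^-1)).
have := floor_le_tmp (x + 2%:R^-1).
have := floorD1_gt (x + 2%:R^-1).
rewrite ler_norml; rewrite intrD; set z := (_%:~R); move=> h1 h2.
apply/andP; split; lra.
Qed.

Section AlmostMinimum.
Variables (U : Type) (S : set U) (f : U -> rat) (c : rat).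
Hypothesis c_gt0 : 0 < c.
Hypothesis fS : forall x, S x -> f x = 0 \/ c <= f x.

(** If [x] fails, some [y] has a positive value below half of [f x]; as positive values are at least
    [c], this descent takes at most [N] steps once [f x <= 2 ^ N * c]. A minimum up to a factor 2 is
    enough for the reduction. *)
Lemma almost_minimum x : S x -> 0 < f x ->
  exists y, [/\ S y, 0 < f y & forall z, S z -> 0 < f z -> f y <= 2%:R * f z].
Proof.
move=> Sx fx.
have [N hN] : exists N : nat, f x <= 2%:R ^+ N * c.
  exists (Num.bound (f x / c)); rewrite -ler_pdivrMr //.
  apply: (le_trans (ltW (archi_boundP _))); first by rewrite divr_ge0 ?ltW.
  by rewrite -natrX ler_nat ltnW // ltn_expl.
elim: N x Sx fx hN => [|N IH] x Sx fx hN.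
  exists x; split=> // z Sz fz; case: (fS Sz) => hz; first by rewrite hz ltxx in fz.
  by move: hN; rewrite expr0; lra.
have [H|/existsNP[y]] := pselect (forall z, S z -> 0 < f z -> f x <= 2%:R * f z).
  by exists x.
move=> /not_implyP[Sy] /not_implyP[fy] /negP; rewrite -ltNge => lt.
apply: (IH y) => //; move: hN; rewrite exprS; set a := _ ^+ N; nra.
Qed.
End AlmostMinimum.

Lemma sum_liftl (U : zmodType) n (x1 : U) (x : 'I_n -> U) (z0 : int) (z : 'I_n -> int) :
  \sum_i (oapp x x1 (unlift ord0 i)) *~ (oapp z z0 (unlift ord0 i))
    = x1 *~ z0 + \sum_i x i *~ z i.
Proof.
rewrite big_ord_recl unlift_none /=; congr (_ + _).
by apply: eq_bigr => i _; rewrite liftK.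
Qed.

Lemma sum_recl (U : zmodType) n (x1 : U) (x : 'I_n -> U) (z : 'I_n.+1 -> int) :
  \sum_i (oapp x x1 (unlift ord0 i)) *~ z i
    = x1 *~ z ord0 + \sum_i x i *~ z (lift ord0 i).
Proof.
rewrite big_ord_recl unlift_none /=; congr (_ + _).
by apply: eq_bigr => i _; rewrite liftK.
Qed.

(** Gram-Schmidt with size reduction: split off an almost shortest [x1], then recurse with the form
    [h'] made orthogonal to [x1]. The group [S] is kept instead of a quotient, so [h'] kills [x1].
    Hence null vectors are allowed, generation is claimed only up to them, and the rank hypothesis
    concerns relations modulo them. *)
Theorem hermite_reduction (U : zmodType) (S : set U) (sS : subgroup S) s
    (h : U -> U -> rat) (c : rat) :
  (forall x x' y, h (x + x') y = h x y + h x' y) ->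
  (forall x y, h x y = h y x) ->
  0 < c -> (forall x, S x -> h x x = 0 \/ c <= h x x) ->
  (forall f : 'I_s.+1 -> U, (forall i, S (f i)) ->
     exists z : 'I_s.+1 -> int, (exists i, z i != 0) /\
       h (\sum_i f i *~ z i) (\sum_i f i *~ z i) = 0) ->
  exists r (x : 'I_r -> U),
    [/\ (r <= s)%N, forall i, S (x i) /\ 0 < h (x i) (x i),
       forall y, S y -> exists z : 'I_r -> int,
         h (y - \sum_i x i *~ z i) (y - \sum_i x i *~ z i) = 0
     & forall (z : 'I_r -> int) i,
         (z i)%:~R ^+ 2 * h (x i) (x i) <=
         hermite_const s * h (\sum_j x j *~ z j) (\sum_j x j *~ z j)].
Proof.
elim: s h c => [|s IH] h c hDl hC c0 hS rk.
  have hDr x y y' : h x (y + y') = h x y + h x y' by rewrite hC hDl !(hC x).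
  exists 0%N, (fun _ => 0); split=> // [[]//|y Sy|? []//].
  exists (fun=> 0); rewrite big_ord0 subr0.
  have [z [[i zi]]] := rk (fun=> y) (fun=> Sy).
  rewrite big_ord1 (qform_mulz hDl hDr) => /eqP.
  move: zi; rewrite (ord1 i) => zi.
  by rewrite mulf_eq0 expf_eq0 /= intr_eq0 (negPf zi) => /eqP.
have hDr x y y' : h x (y + y') = h x y + h x y' by rewrite hC hDl !(hC x).
have [h0|] := pselect (forall x, S x -> h x x = 0).
  exists 0%N, (fun _ => 0); split=> // [[]//|y Sy|? []//].
  by exists (fun=> 0); rewrite big_ord0 subr0 h0.
move=> /existsNP[x0] /not_implyP[Sx0 hx0].
have {hx0} hx0 : 0 < h x0 x0 by case: (hS _ Sx0) => // ?; apply: lt_le_trans c0 _.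
have [x1 [Sx1 h1 min1]] := almost_minimum c0 hS Sx0 hx0.
have h1n : h x1 x1 != 0 by rewrite gt_eqF.
pose tau x := h x1 x / h x1 x1.
pose h' x y := h x y - tau x * tau y * h x1 x1.
have tauD x y : tau (x + y) = tau x + tau y by rewrite /tau hDr mulrDl.
have tau1 : tau x1 = 1 by rewrite /tau divff.
have tauMz x (z : int) : tau (x *~ z) = tau x * z%:~R.
  by rewrite /tau (biaddMzr hDr) -[h _ _ *~ z]mulrzr mulrAC.
have tauN x : tau (- x) = - tau x by rewrite /tau (biaddNr hDr) mulNr.
have tauE x : h x1 x = tau x * h x1 x1 by rewrite /tau divfK.
have h'Dl x x' y : h' (x + x') y = h' x y + h' x' y.
  by rewrite /h' hDl tauD; ring.
have h'C x y : h' x y = h' y x by rewrite /h' hC; ring.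
have h'Dr x y y' : h' x (y + y') = h' x y + h' x y' by rewrite h'C h'Dl !(h'C x).
have h'1 x : h' x1 x = 0 by rewrite /h' tau1 mul1r tauE subrr.
have h'1r x : h' x x1 = 0 by rewrite h'C.
have h'z x (z : int) : h' (x - x1 *~ z) (x - x1 *~ z) = h' x x.
  rewrite (biaddBl h'Dl) !(biaddBr h'Dr) !(biaddMzl h'Dl) !(biaddMzr h'Dr).
  by rewrite !h'1 h'1r !mul0rz !subr0.
have hE x : h x x = h' x x + tau x ^+ 2 * h x1 x1 by rewrite /h'; ring.
have red x : S x -> exists z : int, [/\ S (x - x1 *~ z), `|tau (x - x1 *~ z)| <= 2%:R^-1
      & tau (x - x1 *~ z) ^+ 2 <= 4%:R^-1].
  move=> Sx; have [z hz] := nearest_int (tau x); exists z.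
  have -> : tau (x - x1 *~ z) = tau x - z%:~R by rewrite tauD tauN tauMz tau1 mul1r.
  split=> //; first exact/(subgroupB sS)/(subgroupMz sS).
  rewrite -real_normK ?num_real // (_ : 4%:R^-1 = 2%:R^-1 ^+ 2) //.
  by rewrite ler_sqr // nnegrE // invr_ge0 ler0n.
(* A null vector is orthogonal to [x1]: otherwise the value at [x1 + x *~ z], affine in [z], would
   be negative for a suitable integer near [- 1 / tau x]. *)
have h0tau x : S x -> h x x = 0 -> tau x = 0.
  move=> Sx hx; apply/eqP/negPn/negP => tx.
  have Sz z : 0 <= h (x1 + x *~ z) (x1 + x *~ z).
    have /hS[->//|] : S (x1 + x *~ z) by apply: (subgroupD sS) => //; apply: subgroupMz.
    by apply: le_trans; exact: ltW.
  have hz z : h (x1 + x *~ z) (x1 + x *~ z) = h x1 x1 * (1 + 2%:R * z%:~R * tau x).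
    rewrite hDl !hDr (qform_mulz hDl hDr) hx mulr0 addr0 (biaddMzl hDl).
    rewrite (biaddMzr hDr) (hC x x1) (tauE x) -[_ *~ z]mulrzr; ring.
  pose z := Num.floor (- (1 / tau x)).
  have zl : z%:~R <= - (1 / tau x) by exact: floor_le_tmp.
  have zu : - (1 / tau x) < z%:~R + 1.
    by have := floorD1_gt (- (1 / tau x)); rewrite intrD.
  have tt : tau x * (1 / tau x) = 1 by rewrite mul1r divff.
  case: (ltrgt0P (tau x)) tx => // tx _.
    have := Sz (z - 1); rewrite hz pmulr_rge0 // intrB; set w := z%:~R in zl zu *.
    set v := 1 / tau x in tt zl zu; nra.
  have := Sz (z + 2); rewrite hz pmulr_rge0 // intrD; set w := z%:~R in zl zu *.
  set v := 1 / tau x in tt zl zu; nra.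
(* After size reduction, [h y y] is at least half of [h x1 x1] by almost minimality and [tau y ^ 2]
   is at most 1/4. This leaves a quarter of [h x1 x1], the discreteness constant for the recursive
   call. *)
have h'S x : S x -> h' x x = 0 \/ h x1 x1 / 4%:R <= h' x x.
  move=> Sx; have [z [Sz _ tz]] := red x Sx; rewrite -(h'z x z).
  set y := x - x1 *~ z in Sz tz *.
  have [hy|hy] := hS _ Sz.
    by left; rewrite /h' hy h0tau // !mul0r subr0.
  right; have := min1 _ Sz (lt_le_trans c0 hy); have := hE y; nra.
(* A relation for [h] among [x1] and the [f i] must involve some [f i], because [h x1 x1] is
   nonzero. *)
have rk' (f : 'I_s.+1 -> U) : (forall i, S (f i)) ->
     exists z : 'I_s.+1 -> int, (exists i, z i != 0) /\
       h' (\sum_i f i *~ z i) (\sum_i f i *~ z i) = 0.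
  move=> Sf.
  have [|z [nz hz]] := rk (fun i => oapp f x1 (unlift ord0 i)).
    by move=> i; case: (unlift _ _).
  rewrite sum_recl in hz; set y := \sum_i _ in hz.
  have Sy : S y by apply: (subgroup_sum sS) => i _; apply: subgroupMz.
  have Syy : S (x1 *~ z ord0 + y) by apply: (subgroupD sS) => //; apply: subgroupMz.
  exists (fun i => z (lift ord0 i)); split; last first.
    have := h'z y (- z ord0); rewrite mulrNz opprK addrC -/y => <-.
    by have := hE (x1 *~ z ord0 + y); rewrite hz h0tau // expr0n mul0r addr0.
  apply: contrapT => nex; have z0 i : z (lift ord0 i) = 0.
    by apply/eqP/negPn/negP => ?; apply: nex; exists i.
  have y0 : y = 0 by rewrite /y big1 // => i _; rewrite z0.
  move: hz; rewrite y0 addr0 (qform_mulz hDl hDr) => /eqP.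
  rewrite mulf_eq0 expf_eq0 /= intr_eq0 (negPf h1n) orbF => /eqP z00.
  case: nz => i; case: (unliftP ord0 i) => [j|] ->; first by rewrite z0.
  by rewrite z00.
have [|r [x [rs Sx gx Hx]]] := IH h' _ h'Dl h'C _ h'S rk'; first by rewrite divr_gt0.
have /choice[t ht] i := red (x i) (Sx i).1.
pose y i := x i - x1 *~ t i.
have ySum z : exists w : int, \sum_i y i *~ z i = \sum_i x i *~ z i - x1 *~ w.
  exists (\sum_i t i * z i); rewrite mulrz_sumr -sumrB; apply: eq_bigr => i _.
  by rewrite mulrzBl mulrzA.
have h'y i : h' (y i) (y i) = h' (x i) (x i) by rewrite h'z.
have h'sum z : h' (\sum_i y i *~ z i) (\sum_i y i *~ z i)
              = h' (\sum_i x i *~ z i) (\sum_i x i *~ z i).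
  by have [w ->] := ySum z; rewrite h'z.
have h'ge i : h x1 x1 / 4%:R <= h' (y i) (y i).
  by rewrite h'y; case: (h'S _ (Sx i).1) => // e; have := (Sx i).2; rewrite e ltxx.
have Sy i : S (y i) by case: (ht i).
(* The part of [h] along [x1] is at most a quarter of [h x1 x1], hence at most [h' (y i) (y i)]. *)
have hy i : h (y i) (y i) <= 2%:R * h' (y i) (y i).
  by have [_ _] := ht i; rewrite -/(y i) hE; have := h'ge i; nra.
exists r.+1, (fun i => oapp y x1 (unlift ord0 i)); split=> //.
- move=> i; case: (unlift _ _) => [j|] //=; split=> //.
  have := (Sx j).2; rewrite -h'y [h _ _]hE.
  by have := mulr_ge0 (sqr_ge0 (tau (y j))) (ltW h1); lra.
- move=> u Su; have [z hz] := gx u Su.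
  have Sv : S (u - \sum_i y i *~ z i).
    by apply: (subgroupB sS) => //; apply: (subgroup_sum sS) => i _; apply: subgroupMz.
  set v := u - _ in Sv; have h'v : h' v v = 0.
    rewrite /v; have [w ->] := ySum z; rewrite opprB addrA addrAC.
    by have := h'z (u - \sum_i x i *~ z i) (- w); rewrite mulrNz opprK hz.
  have [z0 [Sz _ tz]] := red v Sv.
  exists (fun i => oapp z z0 (unlift ord0 i)); rewrite sum_liftl.
  have -> : u - (x1 *~ z0 + \sum_i y i *~ z i) = v - x1 *~ z0.
    by rewrite opprD addrCA addrC.
  set w := v - _ in Sz tz *; have hw : h w w = tau w ^+ 2 * h x1 x1.
    by rewrite hE h'z h'v add0r.
  have [//|hcw] := hS _ Sz; have := min1 _ Sz (lt_le_trans c0 hcw); nra.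
move=> z; rewrite sum_recl; set Y := \sum_i _; set X := x1 *~ _ + Y.
set z' := fun i => z (lift ord0 i).
have h'X : h' X X = h' Y Y.
  by have := h'z Y (- z ord0); rewrite mulrNz opprK addrC.
have C1 := hermite_const_ge1 s; set C := hermite_const s in Hx C1 *.
have Hy i : (z' i)%:~R ^+ 2 * h' (y i) (y i) <= C * h' X X.
  by rewrite h'y h'X h'sum; exact: Hx.
have X0 : 0 <= h' X X.
  rewrite h'X; have /h'S : S Y by apply: (subgroup_sum sS) => i _; apply: subgroupMz.
  by case=> [->//|]; apply: le_trans; rewrite divr_ge0 // ltW.
have hX : h' X X <= h X X by rewrite [h X X]hE lerDl mulr_ge0 ?sqr_ge0 ?ltW.
have r0 : 0 <= s.+1%:R :> rat by rewrite ler0n.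
have s0 : 0 <= s%:R * C by rewrite mulr_ge0 ?ler0n //; lra.
have tail0 : 0 <= s.+1%:R * (1 + s%:R * C) by rewrite mulr_ge0 //; lra.
move=> i; case: (unliftP ord0 i) => [j|] -> /=.
  have := Hy j; rewrite /z'; set w := (_%:~R) ^+ 2 => Hj; rewrite -/C.
  have w0 : 0 <= w by exact: sqr_ge0.
  have : w * h (y j) (y j) <= 2%:R * C * h' X X by have := hy j; nra.
  move: tail0; set T := _ * _; nra.
rewrite -/C; have tX : tau X = (z ord0)%:~R + \sum_i (z' i)%:~R * tau (y i).
  rewrite /X tauD tauMz tau1 mul1r; congr (_ + _).
  have tau_sum (f : 'I_r -> U) : tau (\sum_i f i) = \sum_i tau (f i).
    by rewrite /tau (biadd_sumr hDr) mulr_suml.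
  by rewrite /Y tau_sum; apply: eq_bigr => j _; rewrite tauMz mulrC.
(* The coordinate along [x1] is [tau X] corrected by the tail, so Cauchy-Schwarz over [r.+1] terms
   bounds its square. *)
have -> : (z ord0)%:~R = tau X + \sum_(i < r) (- ((z' i)%:~R * tau (y i))).
  by rewrite sumrN tX addrK.
pose a (j : 'I_r.+1) := oapp (fun i => - ((z' i)%:~R * tau (y i))) (tau X) (unlift ord0 j).
have := sum_sqr_le a; rewrite !big_ord_recl /a unlift_none /=.
under eq_bigr do rewrite liftK /=.
under [X in _ * (_ + X)]eq_bigr do rewrite liftK /=.
set A := tau X + _; set B := \sum_(i < r) _ => hAB.
have hB : B * h x1 x1 <= r%:R * (C * h' X X).
  rewrite /B mulr_suml (le_trans (ler_sum (G := fun=> C * h' X X) _ _)) //; last first.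
    by rewrite sumr_const card_ord mulr_natl.
  move=> j _; apply: le_trans (Hy j); rewrite sqrrN exprMn -mulrA.
  rewrite ler_wpM2l ?sqr_ge0 //; have [_ _] := ht j; rewrite -/(y j).
  by have := h'ge j; nra.
have B0 : 0 <= B by apply: sumr_ge0 => j _; exact: sqr_ge0.
have rs' : r%:R <= s%:R :> rat by rewrite ler_nat.
have rs1 : r.+1%:R <= s.+1%:R :> rat by rewrite ler_nat.
have CX : 0 <= C * h' X X by rewrite mulr_ge0 //; lra.
apply: (@le_trans _ _ (s.+1%:R * (tau X ^+ 2 * h x1 x1 + s%:R * (C * h' X X)))).
  apply: (@le_trans _ _ (r.+1%:R * (tau X ^+ 2 + B) * h x1 x1)).
    by rewrite ler_wpM2r // ltW.
  rewrite -mulrA ler_pM ?mulr_ge0 ?addr_ge0 ?sqr_ge0 ?ler0n ?(ltW h1) //.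
  rewrite mulrDl lerD2l (le_trans hB) // ler_wpM2r //.
have e1 : s%:R * (C * h' X X) <= s%:R * C * h X X.
  by rewrite mulrA ler_wpM2l.
have e2 : tau X ^+ 2 * h x1 x1 <= h X X by rewrite [h X X]hE lerDr.
have hX0 : 0 <= h X X by exact: le_trans hX.
rewrite mulrDl; apply: (@le_trans _ _ (s.+1%:R * (1 + s%:R * C) * h X X)).
  by rewrite -mulrA ler_wpM2l // mulrDl mul1r lerD.
by rewrite lerDl !mulr_ge0 ?ler0n //; lra.
Qed.

(** * Real embeddings *)

Lemma exists_rmorphism (A B : pzRingType) (f : A -> B) :
  {morph f : x y / x - y} -> {morph f : x y / x * y} -> f 1 = 1 ->
  exists g : {rmorphism A -> B}, g =1 f.
Proof.
move=> fB fM f1.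
pose g := HB.pack_for {rmorphism A -> B} f
  (GRing.isZmodMorphism.Build A B f fB)
  (GRing.isMonoidMorphism.Build A B f (conj f1 fM)).
by exists g.
Qed.

Section Embeddings.
Variables (F : fieldExtType rat) (C : closedFieldType) (iota : {rmorphism rat -> C}).

Let pcharF : [pchar F] =i pred0 := ftrans (pchar_lalg F) (@pchar_num _).

(** A primitive element [t] is sent to the roots of its minimal polynomial, distinct by
    separability. Injectivity is recorded at [t] because the powers of [t] will give a Vandermonde
    matrix. *)
Lemma exists_closed_embeddings :
  exists (t : F) (sig : 'I_(\dim {:F}) -> {rmorphism F -> C}),
    injective (fun s => sig s t).
Proof.
pose t := separable_generator 1%AS {:F}%AS.
have sepF : separable 1%AS {:F}%AS.
  by apply/separableP => u _; apply: pcharf0_separable.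
have defF : {:F}%VS = <<1; t>>%VS :> {vspace F}.
  by rewrite (eq_adjoin_separable_generator sepF (sub1v _)).
have /polyOver1P[p Dp] := minPolyOver 1%AS t.
have szp : size p = (\dim {:F}).+1.
  by rewrite -(size_map_poly (in_alg F)) -Dp size_minPoly defF dim_Fadjoin dimv1 muln1.
have gen (x : F) : exists q : {poly rat}, x = (map_poly (in_alg F) q).[t].
  have : x \in <<1; t>>%VS by rewrite -defF memvf.
  by case/Fadjoin_polyP => q /polyOver1P[q' ->] ->; exists q'.
have key (q : {poly rat}) (z : C) :
    root (map_poly iota p) z -> (map_poly (in_alg F) q).[t] = 0 ->
    (map_poly iota q).[z] = 0.
  move=> rz q0; have : p %| q.
    rewrite -(dvdp_map (in_alg F)) -Dp minPoly_dvdp //.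
      by apply/polyOver1P; exists q.
    exact/rootP.
  rewrite -(dvdp_map iota) => /dvdpP[r ->].
  by rewrite hornerM (rootP rz) mulr0.
have /choice[P hP] := gen.
have emb (z : C) : root (map_poly iota p) z ->
    exists g : {rmorphism F -> C}, g t = z.
  (* [P x] is a chosen polynomial expressing [x] in [t]; by [key] any other choice has the same
     value at [z], which makes [f] a ring morphism. *)
  move=> rz; pose f x := (map_poly iota (P x)).[z].
  have fE (x : F) q : x = (map_poly (in_alg F) q).[t] -> f x = (map_poly iota q).[z].
    move=> xE; apply/eqP; rewrite -subr_eq0 /f -hornerN -hornerD -rmorphN -rmorphD.
    by apply/eqP; apply: key => //; rewrite rmorphB hornerD hornerN -xE -hP subrr.
  have [||| g gf] := @exists_rmorphism F C f.
  - move=> x y; rewrite (fE (x - y) (P x - P y)).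
      by rewrite rmorphB hornerD hornerN.
    by rewrite rmorphB hornerD hornerN -!hP.
  - move=> x y; rewrite (fE (x * y) (P x * P y)).
      by rewrite rmorphM hornerM.
    by rewrite rmorphM hornerM -!hP.
  - by rewrite (fE 1 1) ?rmorph1 ?hornerC.
  by exists g; rewrite gf (fE t 'X) map_polyX hornerX.
have [rs rsE] := closed_field_poly_normal (map_poly iota p).
have p0 : p != 0 by rewrite -size_poly_eq0 szp.
have lead0 : lead_coef (map_poly iota p) != 0 by rewrite lead_coef_eq0 map_poly_eq0.
have szrs : size rs = \dim {:F}.
  apply: succn_inj; rewrite -szp -(size_map_poly iota) rsE size_scale //.
  by rewrite size_prod_XsubC.
have sepp : separable_poly p.
  rewrite -(separable_map (in_alg F)) -Dp.
  exact: pcharf0_separable.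
have uniq_rs : uniq rs.
  rewrite -separable_prod_XsubC; move: sepp; rewrite -(separable_map iota) rsE.
  by rewrite (eqp_separable (eqp_scale _ lead0)).
have rootrs (s : 'I_(\dim {:F})) : root (map_poly iota p) rs`_s.
  by rewrite rsE rootZ // root_prod_XsubC mem_nth // szrs.
have /choice[sig sigE] s := emb _ (rootrs s).
exists t, sig => s1 s2; rewrite !sigE => /eqP.
by rewrite nth_uniq ?szrs // => /eqP/val_inj.
Qed.

End Embeddings.

Section RealEmbeddings.
Variables (R : realType) (F : fieldExtType rat).
Hypothesis realF : totally_real R F.
Local Notation d := (\dim {:F}).

Lemma rmorph_alg_rat (A : unitRingType) (g : {rmorphism F -> A}) (q : rat) :
  g q%:A = ratr q.
Proof.
rewrite -[RHS](fmorph_eq_rat (g \o in_alg F)) //.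
Qed.

Lemma exists_real_embeddings :
  exists (t : F) (sig : 'I_d -> {rmorphism F -> R}),
    injective (fun s => sig s t).
Proof.
have [t [sig inj]] := @exists_closed_embeddings F R[i] (@ratr R[i]).
have ReE s x : sig s x = (complex.Re (sig s x))%:C%C.
  by have := realF (sig s) x; case: (sig s x) => a b /= ->.
have emb s : exists g : {rmorphism F -> R}, forall x, sig s x = (g x)%:C%C.
  have [||| g gE] := @exists_rmorphism F R (fun x => complex.Re (sig s x)).
  - by move=> x y; rewrite rmorphB; case: (sig s x) (sig s y) => a b [].
  - by move=> x y; rewrite rmorphM (ReE s x) (ReE s y) /= mulr0 subr0.
  - by rewrite rmorph1.
  by exists g => x; rewrite gE.
have /choice[g gE] := emb.
exists t, g => s1 s2 e; apply: inj; by rewrite /= !gE e.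
Qed.

End RealEmbeddings.

Section EmbeddingTheory.
Variables (R : realType) (F : fieldExtType rat).
Local Notation d := (\dim {:F}).
Variables (t : F) (sig : 'I_d -> {rmorphism F -> R}).
Hypothesis inj_t : injective (fun s => sig s t).
Local Notation b := (vbasis {:F}).

Lemma sig_rat s (q : rat) : sig s q%:A = ratr q.
Proof. exact: rmorph_alg_rat. Qed.

Lemma sigZ s (q : rat) x : sig s (q *: x) = ratr q * sig s x.
Proof. by rewrite -mulr_algl rmorphM sig_rat. Qed.

Definition emb_mx : 'M[R]_d := \matrix_(i, s) sig s b`_i.

(** A linear relation between the embeddings, tested on the powers of [t], contradicts the
    invertibility of a Vandermonde matrix. *)
Lemma emb_mx_unit : emb_mx \in unitmx.
Proof.
rewrite -unitmx_tr -row_free_unit; apply: inj_row_free => v v0.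
have vsum x : \sum_s v 0 s * sig s x = 0.
  rewrite (coord_vbasis (memvf x)).
  under eq_bigr do rewrite rmorph_sum mulr_sumr.
  rewrite exchange_big big1 //= => i _.
  under eq_bigr do rewrite sigZ mulrCA.
  rewrite -mulr_sumr; have /matrixP/(_ 0 i) := v0; rewrite !mxE.
  by under eq_bigr do rewrite !mxE; move=> ->; rewrite mulr0.
pose W := Vandermonde d (\row_s sig s t).
have Wu : W \in unitmx.
  rewrite unitmxE unitfE det_Vandermonde; apply/prodf_neq0 => i _.
  apply/prodf_neq0 => j ij; rewrite !mxE subr_eq0; apply/eqP => /inj_t ji.
  by rewrite ji ltnn in ij.
have : W *m v^T = 0.
  apply/matrixP => i j; rewrite !mxE -[RHS](vsum (t ^+ i)).
  by apply: eq_bigr => s _; rewrite !mxE ord1 rmorphXn mulrC.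
move/(congr1 (mulmx (invmx W))); rewrite mulKmx // mulmx0.
by move/(congr1 trmx); rewrite trmxK trmx0.
Qed.

(** [emb_mx] conjugates multiplication by [x] to the diagonal matrix of the conjugates of [x]. *)
Lemma alg_trace_sum (x : F) : ratr (alg_trace x) = \sum_s sig s x.
Proof.
pose Dg := diag_mx (\row_s sig s x).
have e : map_mx ratr (regular_mx x) *m emb_mx = emb_mx *m Dg.
  apply/matrixP => i s; rewrite mxE.
  under eq_bigr do rewrite !mxE -sigZ.
  rewrite -rmorph_sum /= -coord_vbasis ?memvf // rmorphM mul_mx_diag !mxE.
  by rewrite mulrC.
have -> : ratr (alg_trace x) = \tr (map_mx (@ratr R) (regular_mx x)).
  by rewrite /alg_trace trace_map_mx.
rewrite -[map_mx _ _](mulmxK emb_mx_unit) e -mulmxA mxtrace_mulC -mulmxA.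
rewrite mulVmx ?emb_mx_unit // mulmx1 mxtrace_diag.
by apply: eq_bigr => s _; rewrite mxE.
Qed.

(** Weak approximation at the real places: since [emb_mx] is invertible, [tau] has real coordinates
    in the Q-basis of [F], and these are approximated by rationals. *)
Lemma emb_dense (tau : 'I_d -> R) (e : R) : 0 < e ->
  exists u : F, forall s, `|sig s u - tau s| <= e.
Proof.
move=> e0; pose c := (\row_s tau s) *m invmx emb_mx.
have cE s : \sum_(i < d) c 0 i * sig s b`_i = tau s.
  have : (c *m emb_mx) 0 s = tau s by rewrite mulmxKV ?emb_mx_unit // mxE.
  by rewrite mxE => <-; apply: eq_bigr => i _; rewrite [emb_mx _ _]mxE.
pose B := 1 + \sum_(s < d) \sum_(i < d) `|sig s b`_i|.
have B0 : 0 < B by rewrite ltr_pwDl // sumr_ge0 // => s _; rewrite sumr_ge0.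
have /choice[q qE] i : exists q : rat, `|ratr q - c 0 i| <= e / B.
  have [|q] := @rat_in_itvoo R (c 0 i - e / B) (c 0 i + e / B).
    by have := divr_gt0 e0 B0; lra.
  rewrite in_itv /= => /andP[h1 h2]; exists q; rewrite ler_norml; apply/andP; split; lra.
exists (\sum_(i < d) q i *: b`_i) => s.
rewrite rmorph_sum -(cE s) -sumrB /=.
under eq_bigr do rewrite sigZ -mulrBl.
apply: (le_trans (ler_norm_sum _ _ _)).
apply: (@le_trans _ _ (\sum_(i < d) e / B * `|sig s b`_i|)).
  by apply: ler_sum => i _; rewrite normrM ler_wpM2r.
rewrite -mulr_sumr mulrAC ler_pdivrMr // ler_wpM2l ?ltW //.
rewrite /B [X in _ < 1 + X](bigD1 s) //= addrCA ltrDl ltr_pwDl // sumr_ge0 // => i _.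
by rewrite sumr_ge0.
Qed.

Lemma alg_trace_sqr_gt0 (x : F) : x != 0 -> 0 < alg_trace (x * x).
Proof.
move=> x0; rewrite -(ltr_rat R) rmorph0 alg_trace_sum.
have d0 : (0 < d)%N by exact: (adim_gt0 {:F}%AS).
rewrite (bigD1 (Ordinal d0)) //= ltr_pwDl //.
  by rewrite rmorphM -expr2 exprn_even_gt0 //= fmorph_eq0.
by rewrite sumr_ge0 // => s _; rewrite rmorphM -expr2 sqr_ge0.
Qed.

(** An [f] close to 1 at one place and to 0 at the others lets that place decide the sign of the
    trace. This turns positivity of a rational trace form into positivity at each place. *)
Lemma totally_nonneg (a : F) :
  (forall f : F, 0 <= alg_trace (f * f * a)) -> forall s, 0 <= sig s a.
Proof.
move=> pos s0; rewrite leNgt; apply/negP => neg.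
pose A := \sum_(s | s != s0) `|sig s a|.
have A0 : 0 <= A by rewrite sumr_ge0.
(* With this [e] the chosen place contributes at most [sig s0 a / 4], while the others contribute at
   most [e * A], which is smaller than [- sig s0 a / 4]. *)
pose e : R := Num.min 2%:R^-1 (- sig s0 a / (4%:R * (A + 1))).
have e1 : e <= 2%:R^-1 by rewrite /e ge_min lexx.
have e2 : e * (4%:R * (A + 1)) <= - sig s0 a.
  rewrite -ler_pdivlMr; last by rewrite mulr_gt0 // ltr_wpDl.
  by rewrite /e ge_min lexx orbT.
have e0 : 0 < e.
  rewrite /e lt_min invr_gt0 ltr0n divr_gt0 ?oppr_gt0 //.
  by rewrite mulr_gt0 // ltr_wpDl.
have [f hf] := emb_dense (fun s => (s == s0)%:R) e0.
have := pos f; rewrite -(ler_rat R) rmorph0 alg_trace_sum (bigD1 s0) //=.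
have f0 : 4%:R^-1 <= sig s0 f * sig s0 f.
  have := hf s0; rewrite eqxx mulr1n ler_norml => /andP[].
  by move: (sig s0 f) => g; clear -e1 e0; clearbody e => *; nra.
have le1 : \sum_(s | s != s0) sig s (f * f * a) <= e ^+ 2 * A.
  rewrite /A mulr_sumr; apply: ler_sum => s ss0.
  have := hf s; rewrite (negPf ss0) subr0 => hs.
  apply: (le_trans (ler_norm _)); rewrite !rmorphM !normrM ler_wpM2r //.
  by rewrite expr2 ler_pM.
rewrite !rmorphM /=; have e2A : e ^+ 2 * A <= e * A.
  by rewrite ler_wpM2r // expr2 -{3}[e]mulr1 ler_wpM2l ?ltW //; lra.
move: f0 le1; move: (sig s0 f * sig s0 f) (\sum_(s | _) _) => g S; nra.
Qed.

Lemma alg_trace_mul_le (a c : F) :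
  (forall s, 0 <= sig s a) -> (forall s, 0 <= sig s c) ->
  alg_trace (a * c) <= alg_trace a * alg_trace c.
Proof.
move=> a0 c0; rewrite -(ler_rat R).
have -> : ratr (alg_trace a * alg_trace c) = (\sum_s sig s a) * (\sum_s sig s c).
  by rewrite rmorphM /= !alg_trace_sum.
rewrite alg_trace_sum mulr_suml.
apply: ler_sum => s _; rewrite rmorphM ler_wpM2l // (bigD1 s) //= lerDl.
by rewrite sumr_ge0.
Qed.

Lemma alg_trace_ge0 (a : F) : (forall s, 0 <= sig s a) -> 0 <= alg_trace a.
Proof. by move=> a0; rewrite -(ler_rat R) rmorph0 alg_trace_sum sumr_ge0. Qed.

(** Scaling a vector by [u] in [F] multiplies [psi v v] by [u ^ 2] and its square, an element of
    [F], by [u ^ 4]; this is the scaling that makes that square nearly constant over the places. *)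
Lemma approx_fourth_root (a : F) : (forall s, 0 < sig s a) ->
  exists u : F, forall s, 2%:R^-1 <= sig s (u ^+ 4 * a) <= 2%:R.
Proof.
move=> a0; pose r s := Num.sqrt (Num.sqrt (sig s a)).
have r0 s : 0 < r s by rewrite !sqrtr_gt0.
have rE s : sig s a = r s ^+ 4.
  by rewrite (exprM _ 2 2) !sqr_sqrtr ?sqrtr_ge0 ?ltW.
pose B := 1 + \sum_s r s.
have B1 s : r s <= B.
  by rewrite /B (bigD1 s) //= addrCA lerDl addr_ge0 // sumr_ge0 // => i _; rewrite ltW.
have B0 : 0 < B by rewrite ltr_pwDl // sumr_ge0 // => s _; rewrite ltW.
(* The tolerance puts [w = u r] within 1/10 of 1, so that [w ^ 4] lies between 9/16 and 25/16. *)
have [|u hu] := @emb_dense (fun s => (r s)^-1) (10%:R * B)^-1.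
  by rewrite invr_gt0 mulr_gt0.
exists u => s; rewrite rmorphM rmorphXn rE -exprMn.
set w := sig s u * r s.
have : `|w - 1| <= 10%:R^-1.
  have -> : w - 1 = (sig s u - (r s)^-1) * r s.
    by rewrite mulrBl mulVf ?gt_eqF.
  rewrite normrM (gtr0_norm (r0 s)).
  apply: (@le_trans _ _ ((10%:R * B)^-1 * B)).
    by rewrite ler_pM // ltW.
  by rewrite invfM -mulrA mulVf ?mulr1 // gt_eqF.
rewrite ler_norml => /andP[h1 h2].
have w2a : 3%:R / 4%:R <= w * w by nra.
have w2b : w * w <= 5%:R / 4%:R by nra.
rewrite (exprM _ 2 2) !expr2; move: (w * w) w2a w2b => v v1 v2.
apply/andP; split; nra.
Qed.

End EmbeddingTheory.

(** * Traces and positive involutions *)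

Section AlgTrace.
Variables (K : fieldType) (A : falgType K).

Lemma alg_traceD : {morph @alg_trace K A : x y / x + y}.
Proof. by move=> x y; rewrite -[x in LHS]scale1r alg_traceP mul1r. Qed.

Lemma alg_trace0 : alg_trace (0 : A) = 0.
Proof. by apply: (addrI (alg_trace (0 : A))); rewrite -alg_traceD !addr0. Qed.

Lemma alg_traceZ (a : K) (x : A) : alg_trace (a *: x) = a * alg_trace x.
Proof. by rewrite -[a *: x]addr0 alg_traceP alg_trace0 addr0. Qed.

Lemma alg_traceN (x : A) : alg_trace (- x) = - alg_trace x.
Proof. by rewrite -scaleN1r alg_traceZ mulN1r. Qed.

Lemma alg_trace_sumr (I : finType) (P : pred I) (f : I -> A) :
  alg_trace (\sum_(i | P i) f i) = \sum_(i | P i) alg_trace (f i).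
Proof. by elim/big_rec2: _ => [|i a b _ <-]; rewrite ?alg_trace0 ?alg_traceD. Qed.

End AlgTrace.

Section TraceForm.
Variables (F : fieldExtType rat) (D : falgType F).

Lemma trdP (a : F) (x y : D) : trd (a *: x + y) = a * trd x + trd y.
Proof. by rewrite /trd alg_traceP mulrDr mulrCA. Qed.

Lemma trdD (x y : D) : trd (x + y) = trd x + trd y.
Proof. by rewrite -[x in LHS]scale1r trdP mul1r. Qed.

Lemma trdZ (a : F) (x : D) : trd (a *: x) = a * trd x.
Proof. by rewrite /trd alg_traceZ mulrCA. Qed.

Lemma trd0 : trd (0 : D) = 0.
Proof. by rewrite -(scale0r (0 : D)) trdZ mul0r. Qed.

Lemma trdN (x : D) : trd (- x) = - trd x.
Proof. by rewrite -scaleN1r trdZ mulN1r. Qed.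

Lemma trdC (x y : D) : trd (x * y) = trd (y * x).
Proof. by rewrite /trd alg_traceC. Qed.

Lemma trdQD (x y : D) : trdQ (x + y) = trdQ x + trdQ y.
Proof. by rewrite /trdQ trdD alg_traceD. Qed.

Lemma trdQ0 : trdQ (0 : D) = 0.
Proof. by rewrite /trdQ trd0 alg_trace0. Qed.

Lemma trdQN (x : D) : trdQ (- x) = - trdQ x.
Proof. by rewrite /trdQ trdN alg_traceN. Qed.

Lemma trdQC (x y : D) : trdQ (x * y) = trdQ (y * x).
Proof. by rewrite /trdQ trdC. Qed.

Lemma trdQ_sum (I : finType) (P : pred I) (f : I -> D) :
  trdQ (\sum_(i | P i) f i) = \sum_(i | P i) trdQ (f i).
Proof. by elim/big_rec2: _ => [|i a b _ <-]; rewrite ?trdQ0 ?trdQD. Qed.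

Lemma alg_degree_gt0 : (0 < alg_degree D)%N.
Proof.
have dD : (0 < \dim {:D})%N by exact: (adim_gt0 {:D}%AS).
rewrite /alg_degree; case: (\dim _) dD => // n _.
have := PeanoNat.Nat.sqrt_le_mono 1 n.+1 (le_n_S _ _ (PeanoNat.Nat.le_0_l n)).
by rewrite PeanoNat.Nat.sqrt_1 => /ssrnat.leP.
Qed.

Lemma natF_neq0 n : (0 < n)%N -> n%:R != 0 :> F.
Proof. by move=> n0; rewrite -(rmorph_nat (in_alg F)) fmorph_eq0 pnatr_eq0 -lt0n. Qed.

Lemma alg_trace_trd (x : D) : alg_trace x = (alg_degree D)%:R * trd x.
Proof. by rewrite /trd mulVKf // natF_neq0 // alg_degree_gt0. Qed.

Lemma trQ_trdQ (x : D) : trQ x = (alg_degree D)%:R * trdQ x.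
Proof.
rewrite /trQ /trdQ alg_trace_trd -[_%:R * _](_ : (alg_degree D)%:R *: trd x = _).
  by rewrite alg_traceZ.
by rewrite scaler_nat mulr_natl.
Qed.

End TraceForm.

(** * Identities in quaternion algebras *)

Lemma sqr_anticomm (A : nzRingType) (x y : A) :
  x * y = - (y * x) -> (x + y) * (x + y) = x * x + y * y.
Proof.
by move=> xy; rewrite mulrDl !mulrDr xy; zmod.
Qed.

(** The norm form of a quaternion algebra. It is stated for arbitrary [B] because it is used both in
    [D] and in the 2 by 2 real matrices. *)
Lemma quat_norm_form (K : comNzRingType) (B : algType K)
    (x y : B) (p q a b c e : K) :
  x * x = - p%:A -> y * y = - q%:A -> x * y = - (y * x) ->
  (a%:A + (b *: x + (c *: y + e *: (x * y)))) *
  (a%:A - (b *: x + (c *: y + e *: (x * y))))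
    = (a * a + b * b * p + c * c * q + e * e * (p * q))%:A.
Proof.
move=> xx yy xy.
have scal (u v : B) (f g : K) : u * v = - (v * u) ->
    (f *: u) * (g *: v) = - ((g *: v) * (f *: u)).
  by move=> uv; rewrite -!scalerAl -!scalerAr uv !scalerN !scalerA mulrC.
have sq (u : B) (f g : K) : u * u = - g%:A -> (f *: u) * (f *: u) = - (f * f * g)%:A.
  by move=> uu; rewrite -!scalerAl -!scalerAr uu !scalerN !scalerA.
have zz : (x * y) * (x * y) = - (p * q)%:A.
  rewrite {2}xy mulrN -mulrA [y * (y * x)]mulrA yy mulNr !mulrN opprK.
  by rewrite -scalerAl mul1r -scalerAr xx scalerN scalerA mulrC.
have xz : x * (x * y) = - (x * y * x) by rewrite -[x * y * x]mulrA -mulrN xy.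
have yz : y * (x * y) = - (x * y * y) by rewrite mulrA xy mulNr opprK.
set w := b *: x + _.
have ww : w * w = - (b * b * p + c * c * q + e * e * (p * q))%:A.
  rewrite /w sqr_anticomm; last first.
    by rewrite mulrDr mulrDl opprD; congr (_ + _); apply: scal.
  rewrite sqr_anticomm; last exact: scal.
  by rewrite (sq _ _ _ xx) (sq _ _ _ yy) (sq _ _ _ zz) !scalerDl !opprD addrA.
rewrite mulrDl !mulrBr ww opprK -!scalerAl -!scalerAr !mul1r !mulr1 scalerA.
by rewrite !scalerDl; zmod.
Qed.

Section Quaternion.
Variables (F : fieldExtType rat) (D : falgType F).
Hypothesis quatD : quaternion_algebra D.

Lemma dim_quat : \dim {:D} = 4%N.
Proof. by case: quatD => i [j] [a] [b] [_ _ _ _] /andP[/eqP <- /eqP ->]. Qed.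

Lemma alg_degree_quat : alg_degree D = 2%N.
Proof. by rewrite /alg_degree dim_quat. Qed.

Lemma trd1_quat : trd (1 : D) = 2%:R.
Proof.
rewrite /trd alg_degree_quat alg_trace1 dim_quat.
have -> : 4%:R = 2%:R * 2%:R :> F by rewrite -natrM.
by rewrite mulKf // natF_neq0.
Qed.

Lemma trd_alg_quat (a : F) : trd (a%:A : D) = 2%:R * a.
Proof. by rewrite trdZ trd1_quat mulrC. Qed.

Let two_neq0 : 2%:R != 0 :> F. Proof. exact: natF_neq0. Qed.

(** Every quaternion is a scalar plus a trace-zero element, whose square is central. The statement
    has the form of an elimination principle so that identities in one variable reduce to this
    shape. *)
Lemma quat_decomp (P : D -> Prop) :
  (forall (x0 : F) (y : D) (c : F), y * y = c%:A -> trd y = 0 -> P (x0%:A + y)) ->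
  forall x, P x.
Proof.
case: quatD => i [j] [a] [b] [[a0 b0] ii jj ij bD] H x.
have tz (y : D) : trd y = - trd y -> trd y = 0.
  move=> h; apply/eqP; have /eqP : trd y *+ 2 = 0 by rewrite mulr2n {1}h addNr.
  by rewrite -mulr_natl mulf_eq0 (negPf two_neq0).
have sc (c : F) (y : D) : c != 0 -> c * trd y = 0 -> trd y = 0.
  by move=> c0 /eqP; rewrite mulf_eq0 (negPf c0) => /eqP.
have ti : trd i = 0.
  apply: (sc b) => //; rewrite -trdZ -{1}[ i ]mulr1 scalerAr -jj mulrA.
  by apply: tz; rewrite {1}trdC mulrA -trdN; congr trd; rewrite -mulNr ij opprK.
have tj : trd j = 0.
  apply: (sc a) => //; rewrite -trdZ -{1}[j]mul1r scalerAl -ii -mulrA.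
  by apply: tz; rewrite {1}trdC -mulrA -trdN; congr trd; rewrite -mulrN ij opprK.
have tk : trd (i * j) = 0 by apply: tz; rewrite {1}trdC -trdN ij opprK.
have ji : j * i = - (i * j) by rewrite ij opprK.
have : x \in span [:: 1; i; j; i * j] by rewrite (span_basis bD) memvf.
rewrite !span_cons span_nil addv0.
case/memv_addP=> y0 /vlineP[x0 ->] [y1 hy1 ->].
case/memv_addP: hy1 => y2 /vlineP[x1 ->] [y3 hy3 ->].
case/memv_addP: hy3 => y4 /vlineP[x2 ->] [y5 /vlineP[x3 ->] ->].
set k := i * j in tk *.
have kk : k * k = (- (a * b))%:A.
  rewrite /k mulrA -[i * j * i]mulrA ji mulrN mulNr !mulrA ii -!mulrA jj.
  by rewrite -scalerAl mul1r -scaleNr scalerA mulNr.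
have ik : i * k = - (k * i) by rewrite /k -[i * j * i]mulrA ji mulrN opprK.
have jk : j * k = - (k * j) by rewrite /k mulrA ji mulNr.
have scal (e e' : D) (c c' : F) : e * e' = - (e' * e) ->
    (c *: e) * (c' *: e') = - ((c' *: e') * (c *: e)).
  by move=> ee; rewrite -!scalerAl -!scalerAr ee !scalerN !scalerA mulrC.
have sq (e : D) (c g : F) : e * e = g%:A -> (c *: e) * (c *: e) = (c * c * g)%:A.
  by move=> ee; rewrite -!scalerAl -!scalerAr ee !scalerA.
apply: (H x0 _ (x1 * x1 * a + (x2 * x2 * b + x3 * x3 * (- (a * b))))).
  rewrite sqr_anticomm; last first.
    by rewrite mulrDr mulrDl opprD; congr (_ + _); apply: scal.
  rewrite sqr_anticomm; last exact: scal.
  by rewrite (sq _ _ _ ii) (sq _ _ _ jj) (sq _ _ _ kk) !scalerDl.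
by rewrite !trdD !trdZ ti tj tk !mulr0 !addr0.
Qed.

(** Cayley-Hamilton in degree 2, with the reduced norm expressed through reduced traces. *)
Lemma quat_CH (x : D) :
  x * x = trd x *: x - ((trd x ^+ 2 - trd (x * x)) / 2%:R)%:A.
Proof.
elim/quat_decomp: x => x0 y c yy ty.
have e1 : (x0%:A + y) * (x0%:A + y) = (x0 * x0 + c)%:A + (2%:R * x0) *: y.
  rewrite mulrDl !mulrDr yy -!scalerAl -!scalerAr !mul1r !mulr1 scalerA.
  rewrite [in RHS]scalerDl mulr2n mulrDl mul1r [in RHS]scalerDl.
  rewrite addrA -!addrA; congr (_ + _).
  by rewrite addrA addrC.
rewrite e1 !trdD !trdZ ty mulr0 addr0 trd1_quat scalerDr scalerA addrAC.
congr (_ + _); last by rewrite [x0 * 2%:R]mulrC.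
rewrite -scalerBl; congr (_ *: _); by field.
Qed.

Lemma quat_CH_polar (x y : D) :
  x * y + y * x = trd x *: y + trd y *: x - (trd x * trd y - trd (x * y))%:A.
Proof.
have := quat_CH (x + y); rewrite mulrDl !mulrDr.
rewrite !trdD scalerDl !scalerDr [trd (y * x)]trdC.
have -> : ((trd x + trd y) ^+ 2 -
     (trd (x * x) + trd (x * y) + (trd (x * y) + trd (y * y)))) / 2%:R
   = (trd x ^+ 2 - trd (x * x)) / 2%:R + (trd y ^+ 2 - trd (y * y)) / 2%:R
     + (trd x * trd y - trd (x * y)) by field.
rewrite [(_ + _ + (_ - _))%:A]scalerDl [(_ / _ + _ / _)%:A]scalerDl.
have := quat_CH x; have := quat_CH y; set p := (_ / _)%:A; set q := (_ / _)%:A.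
move=> -> -> H.
have -> : x * y + y * x = (trd x *: x - p + x * y + (y * x + (trd y *: y - q)))
   - (trd x *: x - p) - (trd y *: y - q) by zmod.
by rewrite H !scalerDl; zmod.
Qed.

End Quaternion.

(** * Positive involutions and the norm attached to them *)

Section PositiveInvolution.
Variables (R : realType) (F : fieldExtType rat) (D : falgType F) (dag : D -> D).
Variables (t : F) (sig : 'I_(\dim {:F}) -> {rmorphism F -> R}).
Hypothesis inj_t : injective (fun s => sig s t).
Hypothesis caseD : is_center D \/ quaternion_algebra D.
Hypothesis pos : positive_involution dag.

Lemma dagK : involutive dag. Proof. by case: pos.1. Qed.

Lemma dagM x y : dag (x * y) = dag y * dag x. Proof. by case: pos.1. Qed.

Lemma dagD x y : dag (x + y) = dag x + dag y.
Proof. by case: pos.1 => H _ _; have := H 1 x y; rewrite !scale1r. Qed.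

Lemma dag0 : dag 0 = 0.
Proof. by apply: (addrI (dag 0)); rewrite -dagD !addr0. Qed.

Lemma dagN x : dag (- x) = - dag x.
Proof. by apply: (addrI (dag x)); rewrite -dagD !subrr dag0. Qed.

Lemma dagB x y : dag (x - y) = dag x - dag y.
Proof. by rewrite dagD dagN. Qed.

Lemma dag1 : dag 1 = 1.
Proof. by have := dagM 1 (dag 1); rewrite mul1r dagK mul1r. Qed.

Lemma central_in_center (c : D) : (forall x, c * x = x * c) -> exists a : F, c = a%:A.
Proof.
case: caseD => [hc _|[i [j [a [b [[a0 b0] ii jj ij bD]]]]] cc]; first exact: hc.
have : c \in span [:: 1; i; j; i * j] by rewrite (span_basis bD) memvf.
have fr := basis_free bD.
rewrite !span_cons span_nil addv0.
case/memv_addP=> y0 /vlineP[x0 ->] [y1 hy1 cE].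
case/memv_addP: hy1 cE => y2 /vlineP[x1 ->] [y3 hy3 ->].
case/memv_addP: hy3 => y4 /vlineP[x2 ->] [y5 /vlineP[x3 ->] ->] cE.
have ji : j * i = - (i * j) by rewrite ij opprK.
have two_neq0 : 2%:R != 0 :> F by exact: natF_neq0.
have indep (u0 u1 u2 u3 : F) :
    u0%:A + (u1 *: i + (u2 *: j + u3 *: (i * j))) = 0 ->
    [/\ u0 = 0, u1 = 0, u2 = 0 & u3 = 0].
  move=> e; pose u (l : 'I_4) := [:: u0; u1; u2; u3]`_l.
  have /freeP/(_ u) := fr; rewrite !big_ord_recl big_ord0 /= addr0 => H.
  have {}H := H e; split;
    [have := H ord0|have := H (lift ord0 ord0)|
     have := H (lift ord0 (lift ord0 ord0))|
     have := H (lift ord0 (lift ord0 (lift ord0 ord0)))] => //.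
have half (u : F) : 2%:R * u = 0 -> u = 0.
  by move/eqP; rewrite mulf_eq0 (negPf two_neq0) => /eqP.
have iji : i * j * i = - (a *: j) by rewrite -mulrA ji mulrN mulrA ii -scalerAl mul1r.
have iij : i * (i * j) = a *: j by rewrite mulrA ii -scalerAl mul1r.
have ijj : i * j * j = b *: i by rewrite -mulrA jj -scalerAr mulr1.
have jij : j * (i * j) = - (b *: i) by rewrite mulrA ji mulNr ijj.
have ci : c * i - i * c =
    0%:A + (0 *: i + ((- (2%:R * a * x3)) *: j + (- (2%:R * x2)) *: (i * j))).
  rewrite cE !mulrDl !mulrDr -!scalerAl -!scalerAr !mul1r !mulr1 iji iij ji.
  by rewrite !scale0r !scalerN !scaleNr !scalerDl !scalerA [x3 * a]mulrC; zmod.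
have cj : c * j - j * c =
    0%:A + ((2%:R * b * x3) *: i + (0 *: j + (2%:R * x1) *: (i * j))).
  rewrite cE !mulrDl !mulrDr -!scalerAl -!scalerAr !mul1r !mulr1 ijj jij ji.
  by rewrite !scale0r !scalerN !scalerDl !scalerA [x3 * b]mulrC; zmod.
have := cc i; move/eqP; rewrite -subr_eq0 ci => /eqP /indep[_ _ _ /eqP].
rewrite oppr_eq0 => /eqP/half x20.
have := cc j; move/eqP; rewrite -subr_eq0 cj => /eqP /indep[_ x30 _ /half x10].
move: x30; rewrite -mulrA => /half/eqP; rewrite mulf_eq0 (negPf b0) => /eqP x30.
by exists x0; rewrite cE x10 x20 x30 !scale0r !addr0.
Qed.

(** Positivity forces the involution to fix the centre: [f = dag a - a] is central and skew, so
    [f * dag f] is [- f ^ 2], whose trace is negative unless [f] vanishes. *)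
Lemma dag_alg (a : F) : dag a%:A = a%:A.
Proof.
have [c cE] : exists c : F, dag a%:A = c%:A.
  apply: central_in_center => x; rewrite -[x]dagK -!dagM.
  by rewrite -scalerAl -scalerAr mul1r mulr1.
apply/eqP; rewrite -subr_eq0 cE -scalerBl; apply/negPn/negP => nz.
have := pos.2 _ nz; set f := c - a in nz *.
have -> : dag f%:A = - f%:A.
  by rewrite /f scalerBl dagB -cE dagK opprB cE.
rewrite mulrN trdQN oppr_gt0 -scalerAl mul1r scalerA ltNge => /negP[].
have f0 : f != 0 by apply: contraNneq nz => ->; rewrite scale0r.
rewrite /trdQ trdZ; case: caseD => hD.
  have -> : trd (1 : D) = 1 by have := trd_center 1 hD; rewrite scale1r.
  by rewrite mulr1 ltW // (alg_trace_sqr_gt0 inj_t).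
rewrite trd1_quat // -[_ * 2%:R](_ : 2%:R *: (f * f) = _).
  by rewrite alg_traceZ mulr_ge0 // ltW // (alg_trace_sqr_gt0 inj_t).
by rewrite scaler_nat mulr_natr.
Qed.

Lemma dagZ (a : F) x : dag (a *: x) = a *: dag x.
Proof. by rewrite -[a *: x]mulr_algl dagM dag_alg mulr_algr. Qed.

Lemma trd_dag x : trd (dag x) = trd x.
Proof.
case: caseD => hD; first by have [a ->] := hD x; rewrite dag_alg.
apply: (@quaternion_trace F F D (idfun : {rmorphism F -> F}) (fun x => trd (dag x)) (@trd F D)) => //=.
- by move=> a u v; rewrite dagD dagZ trdP.
- by move=> u v; rewrite !dagM trdC.
- exact: trdP.
- exact: trdC.
- by rewrite dag1.
Qed.

Lemma trdQ_dag x : trdQ (dag x) = trdQ x. Proof. by rewrite /trdQ trd_dag. Qed.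

Definition dsqr (x : D) : rat := trdQ (x * dag x).

Lemma dsqr_gt0 x : x != 0 -> 0 < dsqr x. Proof. exact: pos.2. Qed.

Lemma dsqr0 : dsqr 0 = 0. Proof. by rewrite /dsqr mul0r trdQ0. Qed.

Lemma dsqr_ge0 x : 0 <= dsqr x.
Proof. by have [->|/dsqr_gt0/ltW//] := eqVneq x 0; rewrite dsqr0. Qed.

Lemma dsqr_dag x : dsqr (dag x) = dsqr x.
Proof. by rewrite /dsqr dagK trdQC. Qed.

Lemma dsqrN x : dsqr (- x) = dsqr x.
Proof. by rewrite /dsqr dagN mulrNN. Qed.

Lemma dsqrMn x n : dsqr (x *+ n) = n%:R ^+ 2 * dsqr x.
Proof.
have -> : x *+ n = n%:R *: x by rewrite scaler_nat.
rewrite /dsqr dagZ -scalerAl -scalerAr scalerA /trdQ trdZ -natrM mulr_natl.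
by rewrite -scaler_nat alg_traceZ natrM expr2.
Qed.

Let tn (x : D) : F := trd (x * dag x).

Let tn_ge0 x s : 0 <= sig s (tn x).
Proof.
apply: (totally_nonneg inj_t) => f.
have := dsqr_ge0 (f *: x); rewrite /dsqr dagZ -scalerAl -scalerAr scalerA.
by rewrite /trdQ trdZ.
Qed.

(** The defect [tn x * tn y - tn (x * y)] is again a value of [tn], at [dag xb * y] with [xb] the
    quaternion conjugate of [x] (at 0 when [D] is [F]). As [tn] is nonnegative at every real place,
    the trace of [tn x * tn y] is at most the product of the traces. *)
Lemma dsqrM x y : dsqr (x * y) <= dsqr x * dsqr y.
Proof.
suff [z zE] : exists z, tn (x * y) + tn z = tn x * tn y.
  apply: (@le_trans _ _ (alg_trace (tn x * tn y))).
    rewrite -zE alg_traceD lerDl; apply: (alg_trace_ge0 inj_t) => s.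
    exact: tn_ge0.
  exact: (alg_trace_mul_le inj_t).
case: caseD => hD.
  exists 0; rewrite /tn mul0r trd0 addr0.
  have [a ->] := hD x; have [b ->] := hD y.
  have e (c c' : F) : c%:A * c'%:A = (c * c')%:A :> D.
    by rewrite -scalerAl mul1r scalerA.
  by rewrite !e !dag_alg !e !trd_center //; ring.
pose xb := (trd x)%:A - x; exists (dag xb * y).
have e : xb * dag xb = (trd (x * dag x))%:A - dag x * x.
  rewrite /xb dagB dag_alg mulrBl !mulrBr -!scalerAl -!scalerAr !mul1r mulr1.
  have := quat_CH_polar hD x (dag x); rewrite trd_dag => H.
  have -> : dag x * x = (x * dag x + dag x * x) - x * dag x by zmod.
  rewrite H scalerA scalerBl; zmod.
rewrite /tn !dagM dagK.
have -> : trd (dag xb * y * (dag y * xb)) = trd (xb * dag xb * (y * dag y)).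
  by rewrite mulrA trdC !mulrA.
have -> : trd (x * y * (dag y * dag x)) = trd (dag x * x * (y * dag y)).
  by rewrite !mulrA trdC !mulrA.
by rewrite e mulrBl trdD trdN -scalerAl mul1r trdZ addrCA subrr addr0.
Qed.

Lemma trdQ_dagC x y : trdQ (x * dag y) = trdQ (y * dag x).
Proof. by rewrite -trdQ_dag dagM dagK. Qed.

Lemma dag_sum (I : finType) (P : pred I) (f : I -> D) :
  dag (\sum_(i | P i) f i) = \sum_(i | P i) dag (f i).
Proof. by elim/big_rec2: _ => [|i a b _ <-]; rewrite ?dag0 ?dagD. Qed.

Lemma dsqr_sum n (g : 'I_n -> D) :
  dsqr (\sum_i g i) <= n%:R * \sum_i dsqr (g i).
Proof.
have le2 x y : trdQ (x * dag y) <= (dsqr x + dsqr y) / 2%:R.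
  have := dsqr_ge0 (x - y); rewrite /dsqr dagB mulrBl !mulrBr.
  by rewrite !(trdQD, trdQN) (trdQ_dagC y x); lra.
have -> : dsqr (\sum_i g i) = \sum_i \sum_j trdQ (g i * dag (g j)).
  rewrite /dsqr dag_sum mulr_suml trdQ_sum; apply: eq_bigr => i _.
  by rewrite mulr_sumr trdQ_sum.
apply: (@le_trans _ _ (\sum_(i < n) \sum_(j < n) (dsqr (g i) + dsqr (g j)) / 2%:R)).
  by apply: ler_sum => i _; apply: ler_sum => j _; exact: le2.
under eq_bigr do rewrite -mulr_suml big_split /= sumr_const card_ord.
rewrite -mulr_suml big_split /= sumr_const card_ord sumrMnl -mulr_natl.
by set S := \sum_i _; lra.
Qed.

Lemma dsqrD x y : dsqr (x + y) <= 2%:R * (dsqr x + dsqr y).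
Proof.
have := dsqr_sum (fun i : 'I_2 => if i == ord0 then x else y).
by rewrite !big_ord_recl !big_ord0 /= !addr0.
Qed.

Section Skew.
Hypothesis quatD : quaternion_algebra D.

(** A skew element has reduced trace 0, so its square is central; [x * dag x = - x * x] then gives
    the sign at each place. *)
Lemma skew_sqr x : dag x = - x -> x != 0 ->
  exists a : F, x * x = - a%:A /\ forall s, 0 < sig s a.
Proof.
move=> sx x0.
have tx : trd x = 0.
  apply/eqP; have /eqP : trd x *+ 2 = 0 by rewrite mulr2n -{1}trd_dag sx trdN addNr.
  by rewrite -mulr_natl mulf_eq0 (negPf (natF_neq0 F _)).
pose a := - (trd (x * x) / 2%:R).
have xx : x * x = - a%:A.
  by rewrite (quat_CH quatD) tx scale0r add0r expr0n /= sub0r /a -!scaleNr mulNr.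
exists a; split=> // s; rewrite lt_neqAle eq_sym fmorph_eq0; apply/andP; split.
  apply: contraTneq (dsqr_gt0 x0) => a0.
  by rewrite /dsqr sx mulrN xx a0 scale0r !oppr0 trdQ0 ltxx.
have := tn_ge0 x s; rewrite /tn sx mulrN xx opprK trd_alg_quat // rmorphM rmorph_nat.
by rewrite pmulr_rge0.
Qed.

Lemma skew_unit x : dag x = - x -> x != 0 -> exists y, x * y = 1 /\ y * x = 1.
Proof.
move=> sx x0; have [a [xx ap]] := skew_sqr sx x0.
have a0 : a != 0.
  have d0 : (0 < \dim {:F})%N by exact: (adim_gt0 {:F}%AS).
  by apply: contraTneq (ap (Ordinal d0)) => ->; rewrite rmorph0 ltxx.
exists ((- a^-1) *: x); rewrite -scalerAl -scalerAr xx scalerN scaleNr opprK scalerA.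
by rewrite mulVf // scale1r.
Qed.

(** Such [x] and [y] would give a norm form that is positive definite at each real place, whereas
    the algebra becomes the 2 by 2 matrices there and contains a nonzero nilpotent. *)
Lemma totally_indefinite_no_definite (x y : D) (p q : F) :
  totally_indefinite R D ->
  x * x = - p%:A -> y * y = - q%:A -> x * y = - (y * x) ->
  (forall s, 0 < sig s p) -> (forall s, 0 < sig s q) -> False.
Proof.
move=> indef xx yy xy pp qp.
have d0 : (0 < \dim {:F})%N by exact: (adim_gt0 {:F}%AS).
pose s := Ordinal d0; have p0 := pp s; have q0 := qp s.
have def (a b c e : R) :
   a * a + b * b * sig s p + c * c * sig s q + e * e * (sig s p * sig s q) = 0 ->
   [/\ a = 0, b = 0, c = 0 & e = 0].
  move=> h; have pq := mulr_gt0 p0 q0.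
  have a2 : 0 <= a * a by rewrite -expr2 sqr_ge0.
  have b2 : 0 <= b * b * sig s p by rewrite -expr2 mulr_ge0 ?sqr_ge0 ?ltW.
  have c2 : 0 <= c * c * sig s q by rewrite -expr2 mulr_ge0 ?sqr_ge0 ?ltW.
  have e2 : 0 <= e * e * (sig s p * sig s q) by rewrite -expr2 mulr_ge0 ?sqr_ge0 ?ltW.
  have a0 : a * a = 0 by lra.
  have b0 : b * b * sig s p = 0 by lra.
  have c0 : c * c * sig s q = 0 by lra.
  have e0 : e * e * (sig s p * sig s q) = 0 by lra.
  split; apply/eqP; [move/eqP: a0|move/eqP: b0|move/eqP: c0|move/eqP: e0];
    by rewrite ?mulf_eq0 ?(gt_eqF p0) ?(gt_eqF q0) /= ?orbF orbb.
pose bs := [:: 1; x; y; x * y].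
have fr : free bs.
  change (free [tuple 1; x; y; x * y]); apply/freeP => k; rewrite !big_ord_recl big_ord0 /= addr0.
  set a := k _; set b := k _; set c := k _; set e := k _ => H.
  have := quat_norm_form a b c e xx yy xy; rewrite H mul0r.
  move/esym/eqP; rewrite scaler_eq0 oner_eq0 orbF => /eqP/(congr1 (sig s)).
  rewrite rmorph0 !rmorphD !rmorphM => /def[ka kb kc ke].
  have z (u : F) : sig s u = 0 -> u = 0 by move/eqP; rewrite fmorph_eq0 => /eqP.
  case=> [[|[|[|[|//]]]] hi]; apply: z;
    [rewrite -[RHS]ka /a|rewrite -[RHS]kb /b|rewrite -[RHS]kc /c|rewrite -[RHS]ke /e];
    by congr (sig s (k _)); exact: val_inj.
have bD : basis_of {:D} bs by rewrite basisEfree fr subvf /= dim_quat.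
have [phi [sl bphi]] := indef (sig s).
pose X := phi x; pose Y := phi y.
have XX : X * X = - (sig s p)%:A by rewrite /X -rmorphM xx rmorphN sl rmorph1.
have YY : Y * Y = - (sig s q)%:A by rewrite /Y -rmorphM yy rmorphN sl rmorph1.
have XY : X * Y = - (Y * X) by rewrite /X /Y -!rmorphM xy rmorphN.
pose P (M : 'M[R]_2) := exists a b c e : R,
  M = a%:A + (b *: X + (c *: Y + e *: (X * Y))).
have PD M N : P M -> P N -> P (M + N).
  move=> [a [b [c [e ->]]]] [a' [b' [c' [e' ->]]]].
  by exists (a + a'), (b + b'), (c + c'), (e + e'); rewrite !scalerDl; zmod.
have PZ (r : R) M : P M -> P (r *: M).
  move=> [a [b [c [e ->]]]]; exists (r * a), (r * b), (r * c), (r * e).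
  by rewrite !scalerDr !scalerA.
have P0 : P 0 by exists 0, 0, 0, 0; rewrite !scale0r !addr0.
have Pphi z : P (phi z).
  have : z \in span bs by rewrite (span_basis bD) memvf.
  rewrite !span_cons span_nil addv0.
  case/memv_addP=> y0 /vlineP[x0 ->] [y1 hy1 ->].
  case/memv_addP: hy1 => y2 /vlineP[x1 ->] [y3 hy3 ->].
  case/memv_addP: hy3 => y4 /vlineP[x2 ->] [y5 /vlineP[x3 ->] ->].
  exists (sig s x0), (sig s x1), (sig s x2), (sig s x3).
  by rewrite !rmorphD !sl rmorph1 rmorphM.
have Pall M : P M.
  have : M \in span [seq phi z | z <- vbasis {:D}] by rewrite (span_basis bphi) memvf.
  move=> /coord_span ->; elim/big_ind: _ => // i _; apply: PZ.
  by rewrite /= (nth_map 0) ?size_tuple //; exact: Pphi.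
(* With [n * n = 0], multiplying the product of [n] and its conjugate by [n] on the left shows that
   the norm of [n] is 0, hence that [n] itself is 0. *)
pose n : 'M[R]_2 := delta_mx 0 1.
have [a [b [c [e nE]]]] := Pall n.
have nn : n * n = 0 by rewrite /n -mulmxE mul_delta_mx_cond.
have H := quat_norm_form a b c e XX YY XY.
have : n * (n * (a%:A - (b *: X + (c *: Y + e *: (X * Y))))) =
  n * (a * a + b * b * sig s p + c * c * sig s q + e * e * (sig s p * sig s q))%:A.
  by rewrite -H {2}nE.
rewrite mulrA nn mul0r -scalerAr mulr1 => /esym/eqP.
have n0 : n != 0.
  apply/eqP => /matrixP/(_ 0 1); rewrite !mxE !eqxx /= => /eqP.
  by rewrite oner_eq0.
rewrite scaler_eq0 (negPf n0) orbF => /eqP/def[a0 b0 c0 e0].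
by move: n0; rewrite nE a0 b0 c0 e0 !scale0r !addr0 eqxx.
Qed.

(** The component of [y] that anticommutes with [x] is skew; if it were nonzero, it would form with
    [x] a pair excluded by [totally_indefinite_no_definite]. *)
Lemma skew_line x y : totally_indefinite R D ->
  dag x = - x -> x != 0 -> dag y = - y -> exists f : F, y = f *: x.
Proof.
move=> indef sx x0 sy.
have [a [xx ap]] := skew_sqr sx x0.
have a0 : a != 0.
  have d0 : (0 < \dim {:F})%N by exact: (adim_gt0 {:F}%AS).
  by apply: contraTneq (ap (Ordinal d0)) => ->; rewrite rmorph0 ltxx.
have sq (z : D) : dag z = - z -> exists c : F, z * z = c%:A.
  move=> sz; have [->|z0] := eqVneq z 0; first by exists 0; rewrite mul0r scale0r.
  by have [c [-> _]] := skew_sqr sz z0; exists (- c); rewrite scaleNr.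
have [c cE] : exists c : F, x * y + y * x = c%:A.
  have [|u uE] := sq (x + y); first by rewrite dagD sx sy opprD.
  have [v vE] := sq x sx; have [w wE] := sq y sy.
  exists (u - v - w); rewrite !scalerBl -uE -vE -wE mulrDl !mulrDr; zmod.
have two_neq0 : 2%:R != 0 :> F by exact: natF_neq0.
(* Since [x * x = - a] and [x * y + y * x = c], this [g] is the one for which [y - g *: x]
   anticommutes with [x]. *)
pose g := - (c / (2%:R * a)); pose z := y - g *: x.
have xz : x * z = - (z * x).
  apply/eqP; rewrite -addr_eq0 /z mulrBr mulrBl -scalerAl -scalerAr xx.
  have -> : x * y - g *: - a%:A + (y * x - g *: - a%:A) = c%:A + (g * a + g * a)%:A.
    by rewrite -cE !scalerN !scalerA !scalerDl !opprK; zmod.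
  rewrite -scalerDl /g (_ : c + _ = 0) ?scale0r //.
  by field; rewrite a0.
have [z0|z0] := eqVneq z 0; first by exists g; move/eqP: z0; rewrite subr_eq0 => /eqP.
have sz : dag z = - z by rewrite /z dagB dagZ sx sy scalerN opprB opprK addrC.
have [b [zz bp]] := skew_sqr sz z0.
by case: (totally_indefinite_no_definite indef xx zz xz ap bp).
Qed.

End Skew.

End PositiveInvolution.

(** * Integral structures *)

Lemma common_denominator (I : finType) (q : I -> rat) :
  exists (N : nat) (z : I -> int), (0 < N)%N /\ forall i, q i * N%:R = (z i)%:~R.
Proof.
pose N := \prod_i `|denq (q i)|%N.
have N0 : (0 < N)%N by rewrite prodn_gt0 // => i; rewrite absz_gt0 denq_neq0.
exists N, (fun i => numq (q i) * (\prod_(j | j != i) `|denq (q j)|%N)%:Z); split=> // i.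
rewrite /N (bigD1 i) //= natrM mulrA intrM; congr (_ * _).
have -> : `|denq (q i)|%N%:R = (denq (q i))%:~R :> rat.
  by rewrite natr_absz gtr0_norm ?denq_gt0.
by rewrite -{1}[q i]divq_num_den divfK // intr_eq0 denq_neq0.
Qed.

Lemma int_kernel n (A : 'M[rat]_(n.+1, n)) :
  exists z : 'I_n.+1 -> int, (exists i, z i != 0) /\
    forall j, \sum_i (z i)%:~R * A i j = 0.
Proof.
have : kermx A != 0.
  by rewrite kermx_eq0 -row_leq_rank -ltnNge ltnS rank_leq_col.
move=> /eqP /matrixP /existsNP[i0] /existsNP[j0]; rewrite [X in _ <> X]mxE => k0.
pose u := row i0 (kermx A).
have uA : u *m A = 0 by apply/sub_kermxP; exact: row_sub.
have [N [z [N0 zE]]] := common_denominator (fun i => u 0 i).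
have Nn : N%:R != 0 :> rat by rewrite pnatr_eq0 -lt0n.
exists z; split.
  exists j0; apply/eqP => zj; apply: k0; move: (zE j0); rewrite zj mulr0z.
  by move/eqP; rewrite mulf_eq0 (negPf Nn) orbF mxE => /eqP.
move=> j; under eq_bigr do rewrite -zE mulrAC.
rewrite -mulr_suml; have /matrixP/(_ 0 j) := uA; rewrite !mxE => ->.
by rewrite mul0r.
Qed.

(** A bound on the rank by dependence alone: no basis has to be carried along, and the bound passes
    to subsets and to Q-spans. *)
Definition rank_le (U : zmodType) (s : nat) (S : set U) : Prop :=
  forall f : 'I_s.+1 -> U, (forall i, S (f i)) ->
    exists z : 'I_s.+1 -> int, (exists i, z i != 0) /\ \sum_i f i *~ z i = 0.

Lemma rank_le_sub (U : zmodType) s (S S' : set U) :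
  S' `<=` S -> rank_le s S -> rank_le s S'.
Proof. by move=> sub rk f Sf; apply: rk => i; exact: sub. Qed.

Lemma rank_le_inj (U U' : zmodType) s (S : set U) (S' : set U') (f : U -> U') :
  (forall x y, f (x + y) = f x + f y) -> (forall x, f x = 0 -> x = 0) ->
  (forall x, S x -> S' (f x)) -> rank_le s S' -> rank_le s S.
Proof.
move=> fD f0 fS rk g Sg; have [|z [nz zE]] := rk (f \o g); first by move=> i; apply: fS.
exists z; split=> //; apply: f0; rewrite -[RHS]zE.
pose h (x : U) (_ : U) := f x.
have hDl x x' y : h (x + x') y = h x y + h x' y by exact: fD.
have := biadd_suml hDl predT (fun i => g i *~ z i) 0; rewrite /h => ->.
by apply: eq_bigr => i _; have := biaddMzl hDl (g i) 0 (z i); rewrite /h => ->.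
Qed.

Definition zspan (U : zmodType) n (b : 'I_n -> U) : set U :=
  [set x | exists z : 'I_n -> int, x = \sum_i b i *~ z i].

Section Biadd2.
Variables (U : zmodType) (h : U -> U -> rat).
Hypothesis hDl : forall x x' y, h (x + x') y = h x y + h x' y.
Hypothesis hDr : forall x y y', h x (y + y') = h x y + h x y'.

Lemma biadd_sum2 n (b : 'I_n -> U) (z w : 'I_n -> int) :
  h (\sum_i b i *~ z i) (\sum_i b i *~ w i) =
  \sum_i \sum_j (z i)%:~R * (w j)%:~R * h (b i) (b j).
Proof.
rewrite (biadd_suml hDl); apply: eq_bigr => i _.
rewrite (biadd_sumr hDr); apply: eq_bigr => j _.
rewrite (biaddMzl hDl) (biaddMzr hDr) -[LHS]mulrzr -[h _ _ *~ _]mulrzr.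
by ring.
Qed.

(** The values of [h] on the span have a common denominator [N], so a positive value is at least
    [1 / N]. The family [b] may be dependent and lie outside [S]. *)
Lemma discrete_zspan n (b : 'I_n -> U) (S : set U) :
  S `<=` zspan b -> (forall x, S x -> 0 <= h x x) ->
  exists c : rat, 0 < c /\ forall x, S x -> h x x = 0 \/ c <= h x x.
Proof.
move=> sub pos.
have [N [w [N0 wE]]] := common_denominator (fun p : 'I_n * 'I_n => h (b p.1) (b p.2)).
have Np : 0 < N%:R :> rat by rewrite ltr0n.
exists N%:R^-1; split; first by rewrite invr_gt0.
move=> x Sx; have [z xE] := sub _ Sx.
have [v vE] : exists v : int, h x x * N%:R = v%:~R.
  exists (\sum_i \sum_j z i * z j * w (i, j)).
  rewrite xE biadd_sum2 mulr_suml rmorph_sum; apply: eq_bigr => i _.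
  rewrite mulr_suml rmorph_sum; apply: eq_bigr => j _.
  by rewrite /= !intrM -(wE (i, j)) mulrA.
have := pos _ Sx; rewrite le_eqVlt => /orP[/eqP <-|hx]; first by left.
right; rewrite -[_^-1]mul1r ler_pdivrMr // vE.
have : 0 < v%:~R :> rat by rewrite -vE mulr_gt0.
by rewrite ltr0z => v0; rewrite -[1]/(1%:~R) ler_int.
Qed.

(** For a definite form the null vectors of [hermite_reduction] disappear; freeness is its
    coordinate inequality applied to a vanishing combination. *)
Theorem hermite_basis n (b : 'I_n -> U) (S : set U) s :
  (forall x y, h x y = h y x) -> subgroup S -> S `<=` zspan b -> rank_le s S ->
  (forall x, S x -> x != 0 -> 0 < h x x) ->
  exists r (x : 'I_r -> U),
    [/\ (r <= s)%N, zbasis S x, forall i, 0 < h (x i) (x i)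
     & forall (z : 'I_r -> int) i, (z i)%:~R ^+ 2 * h (x i) (x i) <=
         hermite_const s * h (\sum_j x j *~ z j) (\sum_j x j *~ z j)].
Proof.
move=> hC sS sub rk pos.
have pos0 x : S x -> 0 <= h x x.
  by move=> Sx; have [->|/(pos _ Sx)/ltW//] := eqVneq x 0; rewrite (biadd0l hDl).
have h0 x : S x -> h x x = 0 -> x = 0.
  move=> Sx hx; apply/eqP/negPn/negP => /(pos _ Sx); by rewrite hx ltxx.
have [c [c0 cS]] := discrete_zspan sub pos0.
have [|r [x [rs Sx gx Hx]]] := hermite_reduction sS (s := s) hDl hC c0 cS.
  by move=> f Sf; have [z [nz e]] := rk f Sf; exists z; rewrite e (biadd0l hDl).
have Ssum (z : 'I_r -> int) : S (\sum_i x i *~ z i).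
  by apply: (subgroup_sum sS) => i _; apply: (subgroupMz sS); case: (Sx i).
exists r, x; split=> // [|i]; last by case: (Sx i).
split=> [y|z zE i].
  split=> [Sy|[z ->]]; last exact: Ssum.
  have [z hz] := gx y Sy; exists z; apply/eqP; rewrite -subr_eq0; apply/eqP.
  by apply: h0 => //; apply: (subgroupB sS).
have := Hx z i; rewrite zE (biadd0l hDl) mulr0 => hz.
have [_ xi] := Sx i; apply/eqP; rewrite -(@intr_eq0 rat) -sqrf_eq0.
by rewrite eq_le sqr_ge0 andbT -(pmulr_lle0 _ xi).
Qed.

End Biadd2.

Section Zbasis.
Variables (U : zmodType) (S : set U) (n : nat) (b : 'I_n -> U).
Hypothesis bS : zbasis S b.

Lemma zbasis_subgroup : subgroup S.
Proof.
split=> [|u v /bS.1[s ->] /bS.1[t ->]].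
  by apply/bS.1; exists (fun=> 0); rewrite big1.
apply/bS.1; exists (fun i => s i - t i).
by rewrite -sumrB; apply: eq_bigr => i _; rewrite mulrzBr.
Qed.

Lemma zbasis_mem i : S (b i).
Proof.
apply/bS.1; exists (fun j => (j == i)%:R); rewrite (bigD1 i) //= eqxx.
by rewrite big1 ?addr0 // => j /negPf ->.
Qed.

Lemma zbasis_coord : exists co : U -> 'I_n -> int,
  forall x, S x -> x = \sum_i b i *~ co x i.
Proof.
have /choice[co coE] : forall x, exists z : 'I_n -> int, S x -> x = \sum_i b i *~ z i.
  move=> x; have [/bS.1[z ->]|nS] := pselect (S x); first by exists z.
  by exists (fun=> 0) => /nS.
by exists co.
Qed.

Lemma zbasis_inj (z w : 'I_n -> int) :
  \sum_i b i *~ z i = \sum_i b i *~ w i -> forall i, z i = w i.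
Proof.
move=> e i; apply/eqP; rewrite -subr_eq0; apply/eqP.
apply: (bS.2 (fun i => z i - w i)); under eq_bigr do rewrite mulrzBr.
by rewrite sumrB e subrr.
Qed.

End Zbasis.

(** The Q-span of [S], expressed by integer multiples so that it makes sense in any abelian
    group. *)
Definition inQ (U : zmodType) (S : set U) (x : U) : Prop :=
  exists N : nat, (0 < N)%N /\ S (x *+ N).

Lemma inQ_family (U : zmodType) (S : set U) n (x : 'I_n -> U) :
  subgroup S -> (forall i, inQ S (x i)) ->
  exists N : nat, (0 < N)%N /\ forall i, S (x i *+ N).
Proof.
move=> sS /choice[M hM]; exists (\prod_i M i)%N; split.
  by rewrite prodn_gt0 // => i; case: (hM i).
by move=> i; rewrite (bigD1 i) //= mulrnA; apply: (subgroupMn sS); case: (hM i).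
Qed.

Lemma inQD (U : zmodType) (S : set U) x y :
  subgroup S -> inQ S x -> inQ S y -> inQ S (x + y).
Proof.
move=> sS [M [M0 Mx]] [N [N0 Ny]]; exists (M * N)%N; rewrite muln_gt0 M0 N0; split=> //.
rewrite mulrnDl; apply: (subgroupD sS); first by rewrite mulrnA; apply: subgroupMn.
by rewrite mulnC mulrnA; apply: subgroupMn.
Qed.

Lemma inQ_sum (U : zmodType) (S : set U) (I : finType) (f : I -> U) :
  subgroup S -> (forall i, inQ S (f i)) -> inQ S (\sum_i f i).
Proof.
move=> sS fS; elim/big_ind: _ => // [|x y]; last exact: inQD.
by exists 1%N; split=> //; rewrite mul0rn; exact: subgroup0.
Qed.

Lemma rank_le_inQ (U : zmodType) s (S : set U) :
  subgroup S -> rank_le s S -> rank_le s (inQ S).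
Proof.
move=> sS rk f SQ.
have [K [K0 KS]] := inQ_family sS SQ.
have [z [[i zi] zE]] := rk (fun i => f i *+ K) KS.
exists (fun i => K%:Z * z i); split.
  by exists i; rewrite mulf_neq0 // -lt0n.
by rewrite -[RHS]zE; apply: eq_bigr => j _; rewrite mulrzA -pmulrn.
Qed.

Lemma inQ_subgroup (U : zmodType) (S : set U) : subgroup S -> subgroup (inQ S).
Proof.
move=> sS; split=> [|x y Sx [K [K0 Ky]]].
  by exists 1%N; split=> //; rewrite mul0rn; exact: subgroup0.
by apply: inQD => //; exists K; split=> //; rewrite mulNrn; exact: subgroupN.
Qed.

Lemma sub_inQ (U : zmodType) (S : set U) : S `<=` inQ S.
Proof. by move=> x Sx; exists 1%N. Qed.

Section Scalars.
Variables (F : fieldExtType rat) (D : falgType F).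

Definition qD (q : rat) : D := (q%:A : F)%:A.

Lemma qD_nat n : qD n%:R = n%:R.
Proof. by rewrite /qD !scaler_nat. Qed.

Lemma qD_int z : qD z%:~R = z%:~R.
Proof. by rewrite /qD !scaler_int. Qed.

Lemma qDD p q : qD (p + q) = qD p + qD q.
Proof. by rewrite /qD !scalerDl. Qed.

Lemma qDM p q : qD (p * q) = qD p * qD q.
Proof. by rewrite /qD -scalerAl mul1r scalerA -scalerAl mul1r scalerA. Qed.

Lemma qD_C q x : qD q * x = x * qD q.
Proof. by rewrite /qD mulr_algl mulr_algr. Qed.

Lemma natD_inv n : (0 < n)%N -> qD n%:R^-1 * n%:R = 1.
Proof.
by move=> n0; rewrite -qD_nat -qDM mulVf ?pnatr_eq0 -?lt0n // -[1]/(1%:R) qD_nat.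
Qed.

Variable V : lmodType D.

Lemma scale_natV n (x : V) : x *+ n = (n%:R : D) *: x.
Proof. by rewrite scaler_nat. Qed.

Lemma scale_intV (z : int) (x : V) : x *~ z = (z%:~R : D) *: x.
Proof. by rewrite scaler_int. Qed.

Lemma natV_inv n (x : V) : (0 < n)%N -> qD n%:R^-1 *: (x *+ n) = x.
Proof. by move=> n0; rewrite scale_natV scalerA natD_inv // scale1r. Qed.

Lemma mulrn_eq0V n (x : V) : (0 < n)%N -> x *+ n = 0 -> x = 0.
Proof. by move=> n0 e; rewrite -(natV_inv x n0) e scaler0. Qed.

Lemma mulrz_eq0V (z : int) (x : V) : x *~ z = 0 -> z <> 0 -> x = 0.
Proof.
move=> e /eqP nz; apply: (@mulrn_eq0V `|z|%N); first by rewrite absz_gt0.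
case: z e {nz} => n //=; rewrite NegzE mulrNz => /eqP.
by rewrite oppr_eq0 => /eqP.
Qed.

(** Products of basis elements of [F], of [D] over [F] and of [V] over [D] give rational
    coordinates, where [int_kernel] applies. *)
Lemma rank_le_module m : has_dim V m -> rank_le (m * dimQ D) [set: V].
Proof.
move=> [v [gen _]] f _; rewrite /dimQ.
have /choice[a aE] := gen.
pose J := ('I_m * ('I_(\dim {:F}) * 'I_(\dim {:D})))%type.
have cJ : #|{: J}| = (m * (\dim {:F} * \dim {:D}))%N by rewrite !card_prod !card_ord.
pose g (j : J) : V := ((vbasis {:F})`_j.2.1 *: (vbasis {:D})`_j.2.2) *: v j.1.
pose co x (j : J) : rat :=
  coord (vbasis {:F}) j.2.1 (coord (vbasis {:D}) j.2.2 (a x j.1)).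
have coE x : x = \sum_j qD (co x j) *: g j.
  rewrite {1}(aE x) (eq_bigr (fun i => \sum_(p : 'I_(\dim {:F}) * 'I_(\dim {:D}))
     qD (co x (i, p)) *: g (i, p))).
    by rewrite pair_bigA /=; apply: eq_bigr => -[i p].
  move=> i _; rewrite {1}(coord_vbasis (memvf (a x i))) scaler_suml.
  rewrite -(pair_bigA _ (fun c d => qD (co x (i, (c, d))) *: g (i, (c, d)))) /=.
  rewrite exchange_big /=; apply: eq_bigr => d _.
  rewrite {1}(coord_vbasis (memvf (coord _ d (a x i)))) scaler_suml scaler_suml.
  apply: eq_bigr => c _; rewrite /g /co /qD /= scalerA -scalerAl mul1r.
  by rewrite scalerA mulr_algl.
rewrite -cJ in f *.
pose A : 'M[rat]_(#|{: J}|.+1, #|{: J}|) := \matrix_(i, j) co (f i) (enum_val j).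
have [z [nz zE]] := int_kernel A; exists z; split=> //.
under eq_bigr => i _ do rewrite (coE (f i)) scale_intV scaler_sumr.
rewrite exchange_big big1 //= => j _.
under eq_bigr => i _ do rewrite scalerA -qD_int -qDM.
rewrite -scaler_suml; have := zE (enum_rank j).
under eq_bigr do rewrite mxE enum_rankK.
move=> e; have -> : \sum_i qD ((z i)%:~R * co (f i) j) = 0; last by rewrite scale0r.
have qD0 : qD 0 = 0 by rewrite /qD !scale0r.
by rewrite -[RHS]qD0 -e; elim/big_rec2: _ => // i x y _ ->; rewrite qDD.
Qed.

(** In a relation between [x] and enough independent vectors of [L], the coefficient of [x] cannot
    vanish. *)
Lemma rank_le_full m (L : set V) n (b : 'I_n -> V) : has_dim V m -> zbasis L b ->
  (m * dimQ D <= n)%N -> forall x, inQ L x.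
Proof.
move=> dV bL mn x; have rk := rank_le_module dV.
pose w (i : 'I_(m * dimQ D)) := b (widen_ord mn i).
have [//|z [nz zE]] := rk (fun i => oapp w x (unlift ord0 i)).
rewrite sum_recl in zE.
have sL := zbasis_subgroup bL.
have wL : L (\sum_i w i *~ z (lift ord0 i)).
  by apply: (subgroup_sum sL) => i _; apply: (subgroupMz sL); exact: (zbasis_mem bL (widen_ord mn i)).
have z0 : z ord0 != 0.
  apply/eqP => z0; move: zE; rewrite z0 mulr0z add0r => zE.
  pose z' (i : 'I_n) := if insub (val i) is Some j then z (lift ord0 j) else 0.
  have e : \sum_i b i *~ z' i = 0.
    rewrite -[RHS]zE (bigID (fun i : 'I_n => (i < m * dimQ D)%N)) /=.
    rewrite [X in _ + X]big1 ?addr0; last first.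
      by move=> i; rewrite /z' => hi; rewrite insubF ?mulr0z //; apply/negbTE.
    rewrite (big_ord_narrow mn); apply: eq_bigr => i _; rewrite /w /z' /=.
    case: insubP => [u _ ui|]; last by rewrite ltn_ord.
    by congr (_ *~ z (lift _ _)); exact: val_inj.
  case: nz => i; case: (unliftP ord0 i) => [j|] ->; last by rewrite z0.
  have := bL.2 _ e (widen_ord mn j); rewrite /z' /=; case: insubP => [u _ uj|].
    by move=> <-; rewrite (_ : u = j) ?eqxx //; exact: val_inj.
  by rewrite ltn_ord.
exists `|z ord0|%N; split; first by rewrite absz_gt0.
move/eqP: zE; rewrite addr_eq0 => /eqP xz.
have : L (x *~ z ord0) by rewrite xz; apply: (subgroupN sL).
by case: (z ord0) z0 => [k|k] //= _ /(subgroupN sL); rewrite NegzE mulrNz opprK.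
Qed.

End Scalars.

(** * Orders *)

Section BimoduleTrace.
Variables (F : fieldExtType rat) (D : falgType F).
Local Notation b := (vbasis {:D}).

Definition rmul_mx (s : D) : 'M[F]_(\dim {:D}) := \matrix_(i, j) coord b j (b`_i * s).

Lemma rmul_mxE s (i : 'I_(\dim {:D})) : b`_i * s = \sum_j rmul_mx s i j *: b`_j.
Proof.
by rewrite {1}(coord_vbasis (memvf (b`_i * s))); apply: eq_bigr => j _; rewrite mxE.
Qed.

Lemma mul_regular_rmul r s i k :
  (regular_mx r *m rmul_mx s) i k = coord b k (r * b`_i * s).
Proof.
rewrite regular_mxE mulr_suml linear_sum mxE; apply: eq_bigr => j _.
by rewrite -scalerAl linearZ /= [rmul_mx s j k]mxE.
Qed.

Lemma mul_rmul_regular r s i k :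
  (rmul_mx s *m regular_mx r) i k = coord b k (r * b`_i * s).
Proof.
rewrite -mulrA rmul_mxE mulr_sumr linear_sum mxE; apply: eq_bigr => j _.
by rewrite -scalerAr linearZ /= [regular_mx r j k]mxE.
Qed.

Lemma rmul_mxM s s' : rmul_mx (s * s') = rmul_mx s *m rmul_mx s'.
Proof.
apply/matrixP => i j; rewrite mxE mulrA rmul_mxE mulr_suml linear_sum mxE.
by apply: eq_bigr => k _; rewrite -scalerAl linearZ /= [rmul_mx s' k j]mxE.
Qed.

Lemma rmul_mxP a x y : rmul_mx (a *: x + y) = a *: rmul_mx x + rmul_mx y.
Proof. by apply/matrixP => i j; rewrite !mxE mulrDr linearD -scalerAr linearZ. Qed.

Lemma rmul_mx1 : rmul_mx 1 = 1%:M.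
Proof.
apply/matrixP => i j; rewrite !mxE mulr1.
by rewrite coord_free ?(basis_free (vbasisP _)) // eq_sym.
Qed.

Lemma regular_mxP a (x y : D) : regular_mx (a *: x + y) = a *: regular_mx x + regular_mx y.
Proof. by apply/matrixP => i j; rewrite !mxE mulrDl linearD -scalerAl linearZ. Qed.

Lemma trace_rmul s : quaternion_algebra D -> \tr (rmul_mx s) = alg_trace s.
Proof.
move=> qD; apply: (@quaternion_trace F F D (idfun : {rmorphism F -> F})
  (fun s => \tr (rmul_mx s)) (@alg_trace F D)) => //=.
- by move=> a x y; rewrite rmul_mxP linearP.
- by move=> x y; rewrite !rmul_mxM mxtrace_mulC.
- exact: alg_traceP.
- exact: alg_traceC.
- by rewrite rmul_mx1 mxtrace1 alg_trace1.
Qed.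

(* The trace of [x |-> r x s] on a central simple algebra; it makes the numbers
   [Tr_{F/Q} (trd r * trd s)] integral for [r], [s] in an order. *)
Lemma bimodule_trace (r s : D) : quaternion_algebra D ->
  \sum_i coord b i (r * b`_i * s) = trd r * trd s.
Proof.
move=> qD.
have -> : \sum_i coord b i (r * b`_i * s) = \tr (regular_mx r *m rmul_mx s).
  by apply: eq_bigr => i _; rewrite mul_regular_rmul.
apply: (@quaternion_trace F F D (idfun : {rmorphism F -> F})
  (fun r => \tr (regular_mx r *m rmul_mx s)) (fun r => trd r * trd s)) => //=.
- by move=> a x y; rewrite regular_mxP mulmxDl -scalemxAl linearP.
- move=> x y; rewrite !regular_mxM -[regular_mx x *m _ *m _]mulmxA mxtrace_mulC.
  rewrite [in LHS]mulmxA [LHS]mxtrace_mulC; congr (\tr (_ *m _)); apply/matrixP => i j.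
  by rewrite mul_rmul_regular mul_regular_rmul.
- by move=> a x y; rewrite trdP mulrDl -mulrA.
- by move=> x y; rewrite trdC.
have -> : regular_mx (1 : D) = 1%:M.
  apply/matrixP => i j; rewrite !mxE mul1r.
  by rewrite coord_free ?(basis_free (vbasisP _)) // eq_sym.
by rewrite mul1mx trace_rmul // alg_trace_trd alg_degree_quat // trd1_quat.
Qed.

End BimoduleTrace.

Section OrderTheory.
Variables (R : realType) (F : fieldExtType rat) (D : falgType F) (dag : D -> D).
Variables (t : F) (sig : 'I_(\dim {:F}) -> {rmorphism F -> R}).
Hypothesis inj_t : injective (fun s => sig s t).
Hypothesis caseD : is_center D \/ quaternion_algebra D.
Hypothesis pos : positive_involution dag.
Local Notation dsqr := (dsqr dag).

Variables (O : set D) (N : nat).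
Hypothesis sO : subgroup O.
Hypothesis O1 : O 1.
Hypothesis OM : forall x y, O x -> O y -> O (x * y).
Hypothesis OQ : forall d, inQ O d.
Hypothesis Ospan : exists n (c : 'I_n -> D), O `<=` zspan c.
Hypothesis Ork : rank_le N O.

Let form (x y : D) : rat := trdQ (x * dag y).

Let formDl x x' y : form (x + x') y = form x y + form x' y.
Proof. by rewrite /form mulrDl trdQD. Qed.

Let formC x y : form x y = form y x.
Proof. exact: (trdQ_dagC inj_t caseD pos). Qed.

Let formDr x y y' : form x (y + y') = form x y + form x y'.
Proof. by rewrite formC formDl !(formC x). Qed.

Lemma order_hermite : exists r (x : 'I_r -> D),
    [/\ (r <= N)%N, zbasis O x, forall i, 0 < dsqr (x i)
     & forall (z : 'I_r -> int) i, (z i)%:~R ^+ 2 * dsqr (x i) <=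
         hermite_const N * dsqr (\sum_j x j *~ z j)].
Proof.
have [n [c sub]] := Ospan.
have posO x : O x -> x != 0 -> 0 < form x x by move=> _; exact: dsqr_gt0.
by have [r [x [rN bx px Hx]]] := hermite_basis formDl formDr formC sO sub Ork posO; exists r, x.
Qed.

Section Coordinates.
Variables (r : nat) (rho : 'I_r -> D).
Hypothesis brho : zbasis O rho.

Lemma order_Qfree (u : 'I_r -> rat) :
  \sum_i qD D (u i) * rho i = 0 -> forall i, u i = 0.
Proof.
move=> e; have [K [z [K0 zE]]] := common_denominator u.
have Kn : K%:R != 0 :> rat by rewrite pnatr_eq0 -lt0n.
have /brho.2 zz : \sum_i rho i *~ z i = 0.
  have -> : \sum_i rho i *~ z i = (\sum_i qD D (u i) * rho i) * K%:R.
    rewrite mulr_suml; apply: eq_bigr => i _.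
    rewrite -mulrzl -qD_int -zE qDM qD_nat -!mulrA; congr (_ * _).
    by rewrite mulr_natl mulr_natr.
  by rewrite e mul0r.
by move=> i; have := zE i; rewrite zz mulr0z => /eqP; rewrite mulf_eq0 (negPf Kn) orbF => /eqP.
Qed.

Lemma order_Qinj (u w : 'I_r -> rat) :
  \sum_i qD D (u i) * rho i = \sum_i qD D (w i) * rho i -> forall i, u i = w i.
Proof.
move=> e i; apply/eqP; rewrite -subr_eq0; apply/eqP.
apply: (order_Qfree (u := fun i => u i - w i)).
have qDB p q : qD D (p - q) = qD D p - qD D q by rewrite /qD !scalerBl.
by under eq_bigr do rewrite qDB mulrBl; rewrite sumrB e subrr.
Qed.

Lemma order_Qcoord : exists co : D -> 'I_r -> rat,
  [/\ forall x, x = \sum_i qD D (co x i) * rho i,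
      forall x y i, co (x + y) i = co x i + co y i,
      forall q x i, co (qD D q * x) i = q * co x i
    & forall i j, co (rho i) j = (i == j)%:R].
Proof.
have /choice[co coE] x : exists u : 'I_r -> rat, x = \sum_i qD D (u i) * rho i.
  have [K [K0 /brho.1[z zE]]] := OQ x.
  exists (fun i => (z i)%:~R / K%:R).
  rewrite -[LHS]mul1r -(natD_inv D K0) -mulrA mulr_natl zE mulr_sumr.
  by apply: eq_bigr => i _; rewrite mulrC qDM qD_int -mulrA mulrzl.
exists co; split=> // [x y|q x|i j].
- apply: order_Qinj; rewrite -coE {1}(coE x) {1}(coE y) -big_split /=.
  by apply: eq_bigr => i _; rewrite qDD mulrDl.
- apply: order_Qinj; rewrite -coE {1}(coE x) mulr_sumr.
  by apply: eq_bigr => i _; rewrite qDM mulrA.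
- apply: (order_Qinj (w := fun j => (i == j)%:R)).
  rewrite -coE (bigD1 i) //= eqxx qD_nat mul1r big1 ?addr0 // => l.
  by rewrite eq_sym => /negPf ->; rewrite qD_nat mul0r.
Qed.

End Coordinates.

(** Over Q, the trace of [g] can be computed in a Z-basis of [O], where its matrix is integral. The
    coordinates [phi] (product basis) and [co] (basis of [O]) are contracted against each other to
    pass between the two bases. *)
Lemma order_trace_int (g : D -> D) :
  (forall (a : F) x y, g (a *: x + y) = a *: g x + g y) ->
  (forall x, O x -> O (g x)) ->
  alg_trace (\sum_j coord (vbasis {:D}) j (g (vbasis {:D})`_j)) \is a Num.int.
Proof.
move=> gP gO; have [r [rho [_ brho _ _]]] := order_hermite.
have [co [coE coD coQ co1]] := order_Qcoord brho.
have g0 : g 0 = 0.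
  by have := gP (-1) 0 0; rewrite scaler0 add0r scaleN1r addNr.
have gZ a x : g (a *: x) = a *: g x by rewrite -[a *: x]addr0 gP g0 addr0.
have gD x y : g (x + y) = g x + g y by rewrite -[x in LHS]scale1r gP scale1r.
have gsum (I : finType) (f : I -> D) : g (\sum_i f i) = \sum_i g (f i).
  by elim/big_rec2: _ => [|i x y _ <-]; rewrite ?g0 ?gD.
have qZ q (x : D) : qD D q * x = (q%:A : F) *: x by rewrite /qD mulr_algl.
pose phi (c : 'I_(\dim {:F})) (d : 'I_(\dim {:D})) (x : D) : rat :=
  coord (vbasis {:F}) c (coord (vbasis {:D}) d x).
have phi_sum c d (I : finType) (f : I -> D) : phi c d (\sum_i f i) = \sum_i phi c d (f i).
  by rewrite /phi linear_sum linear_sum.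
have phiQ c d q x : phi c d (qD D q * x) = q * phi c d x.
  by rewrite /phi qZ linearZ /= mulr_algl linearZ.
pose G c d : D := (vbasis {:F})`_c *: (vbasis {:D})`_d.
have GE x : x = \sum_c \sum_d qD D (phi c d x) * G c d.
  rewrite exchange_big /= {1}(coord_vbasis (memvf x)); apply: eq_bigr => d _.
  rewrite {1}(coord_vbasis (memvf (coord _ d x))) scaler_suml; apply: eq_bigr => c _.
  by rewrite qZ /G scalerA mulr_algl.
have co_sum i (I : finType) (f : I -> D) : co (\sum_l f l) i = \sum_l co (f l) i.
  have co0 : co 0 i = 0 by apply: (addrI (co 0 i)); rewrite -coD !addr0.
  by elim/big_rec2: _ => [|l x y _ <-]; rewrite ?co0 ?coD.
have /choice[A AE] i : exists z : 'I_r -> int, g (rho i) = \sum_j rho j *~ z j.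
  by apply/brho.1/gO; exact: (zbasis_mem brho).
suff -> : alg_trace (\sum_j coord (vbasis {:D}) j (g (vbasis {:D})`_j))
   = (\sum_i A i i)%:~R by exact: intr_int.
rewrite alg_trace_sumr.
transitivity (\sum_d \sum_c phi c d (g (G c d))).
  apply: eq_bigr => d _; rewrite /alg_trace /mxtrace; apply: eq_bigr => c _.
  by rewrite mxE /phi /G gZ linearZ /= mulrC.
have e c d : phi c d (g (G c d)) =
    \sum_i \sum_j (A i j)%:~R * (phi c d (rho j) * co (G c d) i).
  rewrite {1}(coE (G c d)) gsum phi_sum; apply: eq_bigr => i _.
  rewrite qZ gZ -qZ phiQ AE phi_sum mulr_sumr; apply: eq_bigr => j _.
  by rewrite -mulrzl -qD_int phiQ mulrCA [co _ _ * _]mulrC.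
have coG i x : \sum_c \sum_d phi c d x * co (G c d) i = co x i.
  rewrite [in RHS](GE x) co_sum; apply: eq_bigr => c _.
  by rewrite co_sum; apply: eq_bigr => d _; rewrite coQ.
transitivity (\sum_i \sum_j (A i j)%:~R * \sum_c \sum_d phi c d (rho j) * co (G c d) i).
  rewrite exchange_big /=; under eq_bigr do under eq_bigr do rewrite e.
  rewrite pair_bigA /= exchange_big /=; apply: eq_bigr => i _.
  rewrite exchange_big /=; apply: eq_bigr => j _.
  rewrite mulr_sumr; under [RHS]eq_bigr do rewrite mulr_sumr.
  by rewrite pair_bigA.
rewrite rmorph_sum; apply: eq_bigr => i _.
rewrite (bigD1 i) //= coG co1 eqxx mulr1 big1 ?addr0 // => j /negPf ji.
by rewrite coG co1 ji mulr0.
Qed.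

Lemma order_trQ_int x : O x -> trQ x \is a Num.int.
Proof.
move=> Ox; have := @order_trace_int (fun y => x * y).
have -> : \sum_j coord (vbasis {:D}) j (x * (vbasis {:D})`_j) = alg_trace x.
  by apply: eq_bigr => i _; rewrite mxE.
apply=> [a y z|y Oy]; last exact: OM.
by rewrite mulrDr -scalerAr.
Qed.

Lemma order_trd_mul_int x y : quaternion_algebra D -> O x -> O y ->
  alg_trace (trd x * trd y) \is a Num.int.
Proof.
move=> qD Ox Oy; rewrite -bimodule_trace //.
apply: (@order_trace_int (fun u => x * u * y)) => [a u v|u Ou].
  by rewrite mulrDr mulrDl -scalerAr -scalerAl.
by apply: (OM) => //; exact: OM.
Qed.

(** By Cramer's rule the Gram determinant kills the quotient of the trace dual of [O] by [O]. This
    is the only way the discriminant of the order enters the estimates. *)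
Lemma disc_order_spec : exists k : nat,
  [/\ (0 < k)%N, `|disc_order O| = k%:R
    & forall c, (forall x, O x -> trQ (x * c) \is a Num.int) -> O (c *+ k)].
Proof.
have [r0 [rho0 [_ brho0 _ _]]] := order_hermite.
rewrite /disc_order /gram_disc; set P := [set d | _].
have [r [rho [brho ->]]] : P (xget 0 P).
  by apply: (xgetPex 0); exists (\det (\matrix_(i, j) trQ (rho0 i * rho0 j))), r0, rho0.
set G := \matrix_(i, j) _.
have Orho i : O (rho i) := zbasis_mem brho i.
have /choice[g gE] (p : 'I_r * 'I_r) : exists z : int, trQ (rho p.1 * rho p.2) = z%:~R.
  by have /intrP := order_trQ_int (OM (Orho p.1) (Orho p.2)).
pose H := \matrix_(i, j) g (i, j).
have GH : G = map_mx intr H by apply/matrixP => i j; rewrite !mxE -(gE (i, j)).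
have detGH : \det G = (\det H)%:~R by rewrite GH det_map_mx.
have [co [coE coD coQ co1]] := order_Qcoord brho.
have trQD (x y : D) : trQ (x + y) = trQ x + trQ y by rewrite !trQ_trdQ trdQD mulrDr.
have trQ0 : trQ (0 : D) = 0 by rewrite trQ_trdQ trdQ0 mulr0.
have trQsum (I : finType) (f : I -> D) : trQ (\sum_i f i) = \sum_i trQ (f i).
  by elim/big_rec2: _ => [|i x y _ <-]; rewrite ?trQ0 ?trQD.
have trQq q (x : D) : trQ (qD D q * x) = q * trQ x.
  rewrite /trQ /qD mulr_algl alg_traceZ -[q%:A * _]/(_) mulr_algl.
  by rewrite alg_traceZ.
(* An [x] orthogonal to [O] is orthogonal to [dag x], and positivity of the involution then forces
   [x = 0]. *)
have Gu : G \in unitmx.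
  rewrite -row_free_unit; apply: inj_row_free => v v0.
  pose x := \sum_i qD D (v 0 i) * rho i.
  have xr j : trQ (x * rho j) = 0.
    rewrite /x mulr_suml trQsum; have /matrixP/(_ 0 j) := v0; rewrite !mxE => e.
    by rewrite -[RHS]e; apply: eq_bigr => i _; rewrite mxE -mulrA trQq.
  have xd : trQ (x * dag x) = 0.
    rewrite (coE (dag x)) mulr_sumr trQsum big1 // => i _.
    by rewrite mulrA -qD_C -mulrA trQq xr mulr0.
  have x0 : x = 0.
    apply/eqP/negPn/negP => /(dsqr_gt0 pos); rewrite /dsqr.
    move: xd; rewrite trQ_trdQ => /eqP; rewrite mulf_eq0 pnatr_eq0.
    by rewrite eqn0Ngt alg_degree_gt0 /= => /eqP ->; rewrite ltxx.
  by apply/rowP => i; rewrite mxE; exact: (order_Qfree brho x0).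
have detn0 : \det H != 0 by rewrite -(@intr_eq0 rat) -detGH -unitfE -unitmxE.
exists `|\det H|%N; split; first by rewrite absz_gt0.
  by rewrite detGH -intr_norm natr_absz.
move=> c hc.
have /choice[w wE] i : exists z : int, trQ (rho i * c) = z%:~R.
  by have /intrP := hc _ (Orho i).
have sys : G *m (\col_i co c i) = \col_i (w i)%:~R.
  apply/matrixP => i j; rewrite !mxE -wE {2}(coE c) mulr_sumr trQsum.
  by apply: eq_bigr => l _; rewrite !mxE mulrA -qD_C -mulrA trQq mulrC.
(* Cramer's rule: the coordinates of [det H] times [c] are those of [adj H] applied to the integral
   traces [w]. *)
pose z := \adj H *m (\col_i w i).
have cz i : co c i * (\det H)%:~R = (z i 0)%:~R.
  have : \adj G *m (G *m (\col_i co c i)) = \adj G *m (\col_i (w i)%:~R) by rewrite sys.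
  rewrite mulmxA mul_adj_mx mul_scalar_mx detGH => /matrixP/(_ i 0).
  rewrite !mxE mulrC => ->; rewrite rmorph_sum; apply: eq_bigr => j _.
  have -> : (\adj G) i j = ((\adj H) i j)%:~R by rewrite GH -map_mx_adj mxE.
  by rewrite [(\col_i _) j 0]mxE [(\col_i w i) j 0]mxE /= intrM.
have Odet : O (c *~ \det H).
  apply/brho.1; exists (fun i => z i 0).
  rewrite {1}(coE c) -mulrzr mulr_suml; apply: eq_bigr => i _.
  have -> : rho i *~ z i 0 = qD D (z i 0)%:~R * rho i by rewrite qD_int mulrzl.
  by rewrite -cz qDM qD_int -!mulrA; congr (_ * _); rewrite mulrzl mulrzr.
case: (\det H) Odet => l //= /(subgroupN sO).
by rewrite NegzE mulrNz opprK.
Qed.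

(** The multiplier is the absolute determinant of multiplication by [b] in a Hermite-reduced basis.
    The entries are bounded relative to the lengths of the basis vectors, and in each Leibniz term
    these lengths cancel, so the bound depends on [b] only. *)
Lemma order_inverse_bound (b y : D) : O b -> b * y = 1 -> y * b = 1 ->
  exists M : nat, [/\ (0 < M)%N,
    M%:R <= N`!%:R * (1 + hermite_const N * dsqr b) ^+ N & O (y *+ M)].
Proof.
move=> Ob by1 yb1; have [r [rho [rN brho pr Hr]]] := order_hermite.
have Orho i : O (rho i) := zbasis_mem brho i.
have /choice[a aE] i : exists z : 'I_r -> int, b * rho i = \sum_j rho j *~ z j.
  by apply/brho.1/OM.
pose A := \matrix_(i, j) a i j.
pose B := 1 + hermite_const N * dsqr b.
have C1 := hermite_const_ge1 N; have db := dsqr_ge0 pos b.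
have B1 : 1 <= B by rewrite lerDl mulr_ge0 //; lra.
have ab i j : (a i j)%:~R ^+ 2 * dsqr (rho j) <= B * dsqr (rho i).
  apply: (le_trans (Hr (a i) j)); rewrite -aE.
  have := dsqrM inj_t caseD pos b (rho i); have := pr i.
  rewrite /B; move: (dsqr (b * rho i)) (dsqr (rho i)) => u v v0 uv.
  rewrite mulrDl mul1r -mulrA; apply: (@le_trans _ _ (hermite_const N * (dsqr b * v))).
    by rewrite ler_wpM2l //; lra.
  by rewrite lerDr ltW.
have prodle (s : 'S_r) : `|\prod_i A i (s i)|%:~R <= B ^+ N.
  have p1 : (\prod_i A i (s i))%:~R ^+ 2 <= B ^+ r.
    have pp : 0 < \prod_i dsqr (rho i) by apply: prodr_gt0 => i _; exact: pr.
    rewrite -(ler_pM2r pp).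
    (* A permutation merely reorders the product of the lengths, hence the cancellation. *)
    have {1}-> : \prod_i dsqr (rho i) = \prod_i dsqr (rho (s i)).
      by rewrite [LHS](reindex_inj (@perm_inj _ s)).
    rewrite rmorph_prod -prodrXl -big_split /= -[r in B ^+ r]card_ord -prodr_const.
    rewrite -big_split /=; apply: ler_prod => i _; rewrite mxE; apply/andP; split.
      by rewrite mulr_ge0 ?sqr_ge0 ?(dsqr_ge0 pos).
    exact: ab.
  (* An integer is at most its square in absolute value, so no square root has to be taken. *)
  apply: (@le_trans _ _ ((\prod_i A i (s i))%:~R ^+ 2)).
    rewrite -rmorphXn /= ler_int; move: (\prod_i _) => u.
    rewrite -[leRHS]real_normK ?num_real //.
    move: `|u| (normr_ge0 u) => v v0; rewrite expr2; nia.
  by apply: (le_trans p1); rewrite ler_weXn2l.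
have detle : `|\det A|%:~R <= N`!%:R * B ^+ N.
  apply: (@le_trans _ _ (\sum_(s : 'S_r) B ^+ N)).
    rewrite /determinant (@le_trans _ _ (\sum_(s : 'S_r) `|\prod_i A i (s i)|)%:~R) //.
      rewrite ler_int (le_trans (ler_norm_sum _ _ _)) //; apply: ler_sum => s _.
      by rewrite normrM normrX normrN1 expr1n mul1r.
    by rewrite rmorph_sum; apply: ler_sum => s _; exact: prodle.
  rewrite sumr_const card_Sn -[_ ^+ N *+ _]mulr_natl ler_wpM2r ?exprn_ge0 ?ler_nat ?leq_fact //.
  exact: le_trans B1.
(* Multiplication by [K y] also has an integral matrix [A'], and [A' A = K] shows that [det A] is
   nonzero. *)
have [K [K0 OK]] := OQ y.
have /choice[a' aE'] i : exists z : 'I_r -> int, (y *+ K) * rho i = \sum_j rho j *~ z j.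
  by apply/brho.1/OM.
pose A' := \matrix_(i, j) a' i j.
have AA' : A' *m A = (K%:Z)%:M.
  apply/matrixP => i j; rewrite !mxE.
  move: j; apply: (zbasis_inj brho (z := fun j => \sum_l A' i l * A l j)
                              (w := fun j => K%:Z *+ (i == j))).
  transitivity (rho i *+ K).
    have -> : rho i *+ K = b * ((y *+ K) * rho i).
      by rewrite mulrA mulrnAr by1 mulrnAl mul1r.
    rewrite aE' mulr_sumr.
    under [RHS]eq_bigr => l _ do rewrite mulrzAr aE mulrz_suml.
    rewrite exchange_big /=; apply: eq_bigr => l _.
    rewrite mulrz_sumr; apply: eq_bigr => u _; rewrite !mxE.
    by rewrite -mulrzA mulrC.
  rewrite (bigD1 i) //= eqxx big1 ?addr0 // => l.
  by rewrite eq_sym => /negPf ->.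
have det0 : \det A != 0.
  apply/eqP => d0; have := congr1 determinant AA'; rewrite det_mulmx d0 mulr0 det_scalar.
  by move/esym/eqP; rewrite expf_eq0 => /andP[_ /eqP[K00]]; rewrite K00 in K0.
have Oy : O (y *~ \det A).
  have [u uE] : exists z : 'I_r -> int, (1 : D) = \sum_j rho j *~ z j by apply/brho.1.
  (* With [u] the coordinates of 1, the adjugate yields the element of [O] whose product with [b] is
     [det A]; that element is [y] times [det A]. *)
  pose v := (\row_i u i) *m \adj A.
  have bv : b * (\sum_i rho i *~ v 0 i) = 1 *~ \det A.
    rewrite mulr_sumr.
    under eq_bigr => i _ do rewrite mulrzAr aE mulrz_suml.
    rewrite exchange_big /= [X in _ = X *~ _]uE mulrz_suml; apply: eq_bigr => j _.
    under eq_bigr => i _ do rewrite -mulrzA mulrC.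
    rewrite -mulrz_sumr -mulrzA; congr (_ *~ _).
    have : (v *m A) 0 j = ((\row_i u i) *m (\det A)%:M) 0 j.
      by rewrite /v -mulmxA mul_adj_mx.
    rewrite mul_mx_scalar !mxE mulrC => <-; apply: eq_bigr => i _.
    by rewrite [A i j]mxE.
  suff -> : y *~ \det A = \sum_i rho i *~ v 0 i by apply/brho.1; exists (v 0).
  by rewrite -[RHS]mul1r -yb1 -mulrA bv mulrzr.
exists `|\det A|%N; split; first by rewrite absz_gt0.
  by rewrite natr_absz.
case: (\det A) Oy => l //= /(subgroupN sO).
by rewrite NegzE mulrNz opprK.
Qed.

(** [tau] is a Hermite basis of the lattice of reduced traces of [O], and [f] is its dual basis for
    the trace form. Duality puts [k f_j] into [O] and integrality of the traces keeps [f_j] short,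
    so elements of [F] can be reduced modulo central elements of [O] with bounded remainder. *)
Lemma order_center_basis (k : nat) : quaternion_algebra D ->
  (forall c, (forall x, O x -> trQ (x * c) \is a Num.int) -> O (c *+ k)) ->
  exists e (tau f : 'I_e -> F),
    [/\ (e <= N)%N, forall j, O ((f j)%:A *+ k),
        forall j, alg_trace (f j * f j) <= hermite_const N
      & forall x : F, x = \sum_j alg_trace (x * tau j) *: f j].
Proof.
move=> qD hk.
pose T : set F := [set a | exists2 x, O x & a = trd x].
have sT : subgroup T.
  split; first by exists 0; [exact: subgroup0 sO|rewrite trd0].
  move=> _ _ [x Ox ->] [y Oy ->]; exists (x - y); first exact: subgroupB.
  by rewrite trdD trdN.
pose h (x y : F) : rat := alg_trace (x * y).
have hDl x x' y : h (x + x') y = h x y + h x' y by rewrite /h mulrDl alg_traceD.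
have hC x y : h x y = h y x by rewrite /h mulrC.
have hDr x y y' : h x (y + y') = h x y + h x y' by rewrite hC hDl !(hC x).
have posT x : T x -> x != 0 -> 0 < h x x by move=> _; exact: (alg_trace_sqr_gt0 inj_t).
have [r0 [rho [_ brho _ _]]] := order_hermite.
have Tspan : T `<=` zspan (fun i => trd (rho i)).
  move=> _ [x /brho.1[z ->] ->]; exists z.
  elim/big_rec2: _ => [|i a c _ <-]; first by rewrite trd0.
  by rewrite trdD; congr (_ + _); rewrite -scaler_int trdZ mulrzl.
have Trk : rank_le N T.
  apply: (@rank_le_inj F D N T [set: D] (fun a => a%:A)) => //.
  - by move=> x y; rewrite scalerDl.
  - by move=> x /eqP; rewrite scaler_eq0 oner_eq0 orbF => /eqP.
  exact: rank_le_sub (fun x _ => OQ x) (rank_le_inQ sO Ork).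
have [e [tau [eN btau ptau Htau]]] := hermite_basis hDl hDr hC sT Tspan Trk posT.
have Ttau i : T (tau i) := zbasis_mem btau i.
(* The value is positive and, by the trace of a two-sided multiplication on [O], an integer. *)
have tau1 i : 1 <= h (tau i) (tau i).
  have [x Ox xE] := Ttau i; have := ptau i.
  have /intrP[z zE] := order_trd_mul_int qD Ox Ox.
  by rewrite /h xE zE ltr0z -[1]/(1%:~R) ler_int.
have hZl q x y : h (q *: x) y = q * h x y by rewrite /h -scalerAl alg_traceZ.
have hZr q x y : h x (q *: y) = q * h x y by rewrite hC hZl hC.
(* The Hermite inequality is homogeneous, so clearing denominators extends it to rational
   coefficients, as needed for the dual basis. *)
have HQ (u : 'I_e -> rat) i : u i ^+ 2 * h (tau i) (tau i) <=
    hermite_const N * h (\sum_j u j *: tau j) (\sum_j u j *: tau j).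
  have [K [z [K0 zE]]] := common_denominator u.
  have Kp : 0 < K%:R ^+ 2 :> rat by rewrite exprn_gt0 ?ltr0n.
  have := Htau z i; rewrite -zE.
  have -> : \sum_j tau j *~ z j = K%:R *: \sum_j u j *: tau j.
    rewrite scaler_sumr; apply: eq_bigr => j _.
    by rewrite scalerA mulrC zE scaler_int.
  rewrite hZl hZr exprMn => H; rewrite -(ler_pM2r Kp); move: H.
  move: (u i ^+ 2) (h (tau i) (tau i)) (h _ _) (hermite_const N) => p q w C; lra.
pose G := \matrix_(i, j) h (tau i) (tau j).
have hsuml (u : 'I_e -> rat) y : h (\sum_j u j *: tau j) y = \sum_j u j * h (tau j) y.
  by rewrite (biadd_suml hDl); apply: eq_bigr => j _; rewrite hZl.
have hsumr (u : 'I_e -> rat) y : h y (\sum_j u j *: tau j) = \sum_j u j * h y (tau j).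
  by rewrite (biadd_sumr hDr); apply: eq_bigr => j _; rewrite hZr.
have Gu : G \in unitmx.
  rewrite -row_free_unit; apply: inj_row_free => v v0; apply/rowP => i; rewrite mxE.
  have := HQ (v 0) i; rewrite hsuml.
  have -> : \sum_j v 0 j * h (tau j) (\sum_l v 0 l *: tau l) = 0.
    rewrite -hsuml hsumr big1 // => j _; rewrite hsuml.
    have /matrixP/(_ 0 j) := v0; rewrite !mxE => ve.
    rewrite (eq_bigr (fun l => v 0 l * G l j)) ?ve ?mulr0 // => l _.
    by rewrite mxE.
  rewrite mulr0 => le0; have t0 : 0 < h (tau i) (tau i) by exact: ptau.
  by apply/eqP; rewrite -sqrf_eq0 eq_le sqr_ge0 andbT -(pmulr_lle0 _ t0).
pose f i := \sum_j invmx G i j *: tau j.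
have fdual i l : h (f i) (tau l) = (i == l)%:R.
  rewrite /f hsuml; have /matrixP/(_ i l) := mulVmx Gu; rewrite !mxE => <-.
  by apply: eq_bigr => j _; rewrite mxE.
exists e, tau, f; split=> //.
- move=> j; apply: hk => x Ox; rewrite mulr_algr trQ_trdQ /trdQ trdZ.
  rewrite rpredM ?rpred_nat //.
  have /btau.1[z ->] : T (trd x) by exists x.
  rewrite -[alg_trace _]/(h (f j) _) (biadd_sumr hDr) rpred_sum // => i _.
  by rewrite (biaddMzr hDr) fdual; apply: rpredMz; exact: rpred_nat.
(* The number [g = h (f j) (f j)] is also the coordinate of [f j] along [tau j]. The Hermite
   inequality reads [g ^ 2 * h (tau j) (tau j) <= C * g], with [h (tau j) (tau j) >= 1]. *)
- move=> j; rewrite -[alg_trace _]/(h (f j) (f j)).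
  have ff : h (f j) (f j) = invmx G j j.
    rewrite {2}/f hsumr (bigD1 j) //= fdual eqxx mulr1 big1 ?addr0 // => l.
    by rewrite fdual eq_sym => /negPf ->; rewrite mulr0.
  have := HQ (fun l => invmx G j l) j; rewrite -/(f j) -ff; have := tau1 j.
  have := hermite_const_ge1 N.
  move: (h (f j) (f j)) (h (tau j) (tau j)) (hermite_const N) => g q C C1 q1 gq.
  rewrite leNgt; apply/negP => Cg; nra.
- move=> x; apply/eqP; rewrite -subr_eq0; apply/eqP; set y := x - _.
  have yt l : h y (tau l) = 0.
    rewrite /y (biaddBl hDl) (biadd_suml hDl).
    under eq_bigr do rewrite hZl fdual.
    rewrite (bigD1 l) //= eqxx mulr1 big1 ?addr0 ?subrr // => j /negPf ->.
    by rewrite mulr0.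
  have [K [K0 OK]] := OQ y%:A.
  have : T (y *+ (2 * K)).
    exists (y%:A *+ K) => //; rewrite -scaler_nat trdZ trd_alg_quat //.
    by rewrite mulrnA mulr_natl mulr_natl.
  move=> /btau.1[z zE]; have : h y (y *+ (2 * K)) = 0.
    by rewrite zE (biadd_sumr hDr) big1 // => i _; rewrite (biaddMzr hDr) yt mul0rz.
  rewrite (biaddMnr hDr) => /eqP; rewrite mulrn_eq0 muln_eq0 /= eqn0Ngt K0 /= => /eqP hy.
  by apply/eqP/negPn/negP => /(alg_trace_sqr_gt0 inj_t); rewrite -/(h y y) hy ltxx.
Qed.

End OrderTheory.

(** * Stabilizers and skew-Hermitian forms *)

Section Stabilizer.
Variables (F : fieldExtType rat) (D : falgType F) (V : lmodType D).
Variables (m n : nat) (L : set V) (b : 'I_n -> V).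
Hypothesis m_gt0 : (0 < m)%N.
Hypothesis dimV : has_dim V m.
Hypothesis bL : zbasis L b.
Hypothesis LQ : forall x, inQ L x.

Let sL := zbasis_subgroup bL.

Lemma stab_subgroup : subgroup (stab L).
Proof.
split=> [x Lx|x y Sx Sy z Lz]; first by rewrite scale0r; exact: subgroup0.
by rewrite scalerBl; apply: (subgroupB sL); [exact: Sx|exact: Sy].
Qed.

Lemma stab1 : stab L 1.
Proof. by move=> x Lx; rewrite scale1r. Qed.

Lemma stabM x y : stab L x -> stab L y -> stab L (x * y).
Proof. by move=> Sx Sy z Lz; rewrite -scalerA; apply/Sx/Sy. Qed.

Lemma stab_inQ d : inQ (stab L) d.
Proof.
have [K [K0 KL]] := inQ_family sL (fun i => LQ (d *: b i)).
exists K; split=> // x /bL.1[z ->]; rewrite scaler_sumr.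
apply: (subgroup_sum sL) => i _.
have -> : (d *+ K) *: (b i *~ z i) = (d *: b i *+ K) *~ z i.
  rewrite -scalerMnl (biaddMzr (h := fun (a : D) (x : V) => a *: x) (fun a x y => scalerDr a x y)).
  by rewrite [LHS]pmulrn -mulrzA mulrC mulrzA -pmulrn.
by apply: (subgroupMz sL).
Qed.

(** [r] is recovered as one coordinate of [r *: (v i0 *+ K)], which is an integral combination of
    the [b i]. *)
Lemma stab_zspan : exists l (c : 'I_l -> D), stab L `<=` zspan c.
Proof.
have [v [gen ind]] := dimV.
pose i0 := Ordinal m_gt0.
have /choice[a aE] := gen.
have inj (u w : 'I_m -> D) : \sum_i u i *: v i = \sum_i w i *: v i -> u i0 = w i0.
  move=> e; apply/eqP; rewrite -subr_eq0; apply/eqP.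
  apply: (ind (fun i => u i - w i)); under eq_bigr do rewrite scalerBl.
  by rewrite sumrB e subrr.
have [K [K0 KL]] := LQ (v i0).
exists n, (fun i => qD D K%:R^-1 * a (b i) i0) => r Sr.
have /bL.1[z zE] : L (r *: (v i0 *+ K)) by exact: Sr.
exists z.
have e : r *+ K = \sum_i a (b i) i0 *~ z i.
  have := @inj (fun i => if i == i0 then r *+ K else 0)
               (fun j => \sum_i a (b i) j *~ z i); rewrite eqxx; apply.
  rewrite (bigD1 i0) //= big1 ?addr0; last first.
    by move=> j /negPf ->; rewrite scale0r.
  have -> : (r *+ K) *: v i0 = r *: (v i0 *+ K).
    by rewrite !scale_natV scalerA mulr_natr.
  rewrite zE; transitivity (\sum_(i < n) \sum_(j < m) (a (b i) j *~ z i) *: v j).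
    apply: eq_bigr => i _; rewrite {1}(aE (b i)) scale_intV scaler_sumr.
    by apply: eq_bigr => j _; rewrite scalerA mulrzl.
  by rewrite exchange_big; apply: eq_bigr => j _; rewrite scaler_suml.
rewrite -[LHS]mul1r -(natD_inv D K0) -mulrA mulr_natl e mulr_sumr.
by apply: eq_bigr => i _; rewrite mulrzAr.
Qed.

Lemma stab_rank : rank_le (m * dimQ D) (stab L).
Proof.
have [v [_ ind]] := dimV; pose i0 := Ordinal m_gt0.
apply: (@rank_le_inj D V _ (stab L) [set: V] (fun d => d *: v i0)) => //.
- by move=> x y; rewrite scalerDl.
- move=> x x0; have := ind (fun i => if i == i0 then x else 0); rewrite (bigD1 i0) //=.
  rewrite big1 ?addr0; last by move=> i /negPf ->; rewrite scale0r.
  by move/(_ x0)/(_ i0); rewrite eqxx.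
exact: rank_le_module.
Qed.

End Stabilizer.

Section Form.
Variables (R : realType) (F : fieldExtType rat) (D : falgType F) (dag : D -> D).
Variables (t : F) (sig : 'I_(\dim {:F}) -> {rmorphism F -> R}).
Hypothesis inj_t : injective (fun s => sig s t).
Hypothesis caseD : is_center D \/ quaternion_algebra D.
Hypothesis pos : positive_involution dag.
Variables (V : lmodType D) (psi : V -> V -> D).
Hypothesis psiP : skew_hermitian_form dag psi.
Local Notation dsqr := (dsqr dag).
Local Notation E x y := (trdQ (psi x y)).

Lemma psiDl x x' y : psi (x + x') y = psi x y + psi x' y. Proof. by case: psiP. Qed.

Lemma psiDr x y y' : psi x (y + y') = psi x y + psi x y'. Proof. by case: psiP. Qed.

Lemma psiZl a x y : psi (a *: x) y = a * psi x y.
Proof.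
by case: psiP => _ _ H _; rewrite -[y in LHS]scale1r H (dag1 pos) mulr1.
Qed.

Lemma psiZr a x y : psi x (a *: y) = psi x y * dag a.
Proof. by case: psiP => _ _ H _; rewrite -[x in LHS]scale1r H mul1r. Qed.

Lemma psiC x y : psi y x = - dag (psi x y). Proof. by case: psiP. Qed.

Lemma psiC0 x y : psi x y = 0 -> psi y x = 0.
Proof. by move=> e; rewrite psiC e (dag0 pos) oppr0. Qed.

Definition unit_pair (c y : D) : Prop := c * y = 1 /\ y * c = 1.

(* A family whose Gram matrix is supported on the graph of the involution [tau],
   with invertible entries [c i] of inverse [y i]: an orthogonal family for
   [tau = id], a family of hyperbolic planes when [tau] exchanges [2k, 2k+1]. *)
Definition block p (v : 'I_p -> V) (tau : 'I_p -> 'I_p) (y : 'I_p -> D) : Prop :=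
  [/\ forall i, tau (tau i) = i,
      forall i j, j != tau i -> psi (v i) (v j) = 0
    & forall i, unit_pair (psi (v i) (v (tau i))) (y i)].

(** The coefficient of [v i] in the orthogonal projection of [x] to the span of the block. *)
Definition bcoef p (v : 'I_p -> V) (tau : 'I_p -> 'I_p) (y : 'I_p -> D) (x : V)
    (i : 'I_p) : D := psi x (v (tau i)) * y i.

Definition spanned p (v : 'I_p -> V) tau y (S : set V) : Prop :=
  forall x, S x -> x = \sum_i bcoef v tau y x i *: v i.

Section Block.
Variables (p : nat) (v : 'I_p -> V) (tau : 'I_p -> 'I_p) (y : 'I_p -> D).
Hypothesis blk : block v tau y.

Lemma psi_block_sum (a : 'I_p -> D) j :
  psi (\sum_i a i *: v i) (v j) = a (tau j) * psi (v (tau j)) (v j).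
Proof.
have [tt orth _] := blk; rewrite (biadd_suml psiDl) (bigD1 (tau j)) //= psiZl.
rewrite big1 ?addr0 // => i ij; rewrite psiZl orth ?mulr0 //.
by apply: contra_neq ij => ->; rewrite tt.
Qed.

Lemma psi_bcoef x j : psi (\sum_i bcoef v tau y x i *: v i) (v j) = psi x (v j).
Proof.
have [tt _ inv] := blk; rewrite psi_block_sum /bcoef tt -mulrA.
by have [_] := inv (tau j); rewrite tt => ->; rewrite mulr1.
Qed.

Lemma block_free (a : 'I_p -> D) : \sum_i a i *: v i = 0 -> forall i, a i = 0.
Proof.
have [tt _ inv] := blk; move=> e i.
have := psi_block_sum a (tau i); rewrite e (biadd0l psiDl) tt => /esym.
move/(congr1 (fun d => d * y i)); rewrite mul0r -mulrA.
by have [-> _] := inv i; rewrite mulr1.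
Qed.

Lemma bcoefD x x' i : bcoef v tau y (x + x') i = bcoef v tau y x i + bcoef v tau y x' i.
Proof. by rewrite /bcoef psiDl mulrDl. Qed.

End Block.

Definition perp p (v : 'I_p -> V) (S : set V) : set V :=
  [set x | S x /\ forall i, psi x (v i) = 0].

Lemma perp_subgroup p (v : 'I_p -> V) S : subgroup S -> subgroup (perp v S).
Proof.
move=> sS; split=> [|x x' [Sx ox] [Sx' ox']].
  by split=> [|i]; [exact: subgroup0|rewrite (biadd0l psiDl)].
by split=> [|i]; [exact: subgroupB|rewrite (biaddBl psiDl) ox ox' subr0].
Qed.

(** The vector [v i0] pairs to a unit with its partner, while elements of the complement pair to 0.
    A relation that includes [v i0] therefore has coefficient 0 there. A drop by one suffices for
    the inductions. *)
Lemma perp_rank p (v : 'I_p -> V) tau y S s :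
  block v tau y -> (0 < p)%N -> (forall i, S (v i)) ->
  rank_le s.+1 S -> rank_le s (perp v S).
Proof.
move=> [tt orth inv] p0 Sv rk f Sf; pose i0 := Ordinal p0.
have [|z [nz zE]] := rk (fun i => oapp f (v i0) (unlift ord0 i)).
  by move=> i; case: (unlift _ _) => [j|] //=; case: (Sf j).
rewrite sum_recl in zE.
have z0 : z ord0 = 0.
  apply: contrapT => z0.
  have := congr1 (fun x => psi x (v (tau i0))) zE; rewrite psiDl (biadd0l psiDl).
  rewrite (biadd_suml psiDl) big1 ?addr0; last first.
    by move=> i _; rewrite (biaddMzl psiDl) (Sf i).2 mul0rz.
  rewrite (biaddMzl psiDl) => e; have := @mulrz_eq0V F D (D^o : lmodType D) _ _ e z0.
  move=> c0; have [c1 _] := inv i0; move: c1; rewrite c0 mul0r => /eqP.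
  by rewrite eq_sym oner_eq0.
exists (fun i => z (lift ord0 i)); split; last by move: zE; rewrite z0 mulr0z add0r.
case: nz => i; case: (unliftP ord0 i) => [j|] ->; first by exists j.
by rewrite z0.
Qed.

Definition nondeg (S : set V) : Prop :=
  forall x, S x -> x != 0 -> exists y, S y /\ psi x y != 0.

Definition stable (A : set D) (S : set V) : Prop :=
  forall a x, A a -> S x -> S (a *: x).

Lemma perp_stable A p (v : 'I_p -> V) S : stable A S -> stable A (perp v S).
Proof. by move=> st a x Aa [Sx ox]; split=> [|i]; [exact: st|rewrite psiZl ox mulr0]. Qed.

(** * Splitting off a block with a multiplier *)

Section Split.
Variables (A : set D) (S : set V) (p : nat) (v : 'I_p -> V).
Variables (tau : 'I_p -> 'I_p) (y : 'I_p -> D) (M : nat).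
Hypothesis sS : subgroup S.
Hypothesis stS : stable A S.
Hypothesis Sv : forall i, S (v i).
Hypothesis blk : block v tau y.
Hypothesis M_gt0 : (0 < M)%N.
Hypothesis AM : forall x i, S x -> A (bcoef v tau y x i *+ M).

(** [M] times the orthogonal projection to the complement; the factor [M] keeps it inside [S]. *)
Definition bproj (x : V) : V := x *+ M - \sum_i (bcoef v tau y x i *+ M) *: v i.

Lemma bprojE x : x *+ M = \sum_i (bcoef v tau y x i *+ M) *: v i + bproj x.
Proof. by rewrite /bproj addrC subrK. Qed.

Lemma bproj_perp x : S x -> perp v S (bproj x).
Proof.
move=> Sx; split.
  apply: (subgroupB sS); first exact: subgroupMn.
  by apply: (subgroup_sum sS) => i _; apply: stS => //; exact: AM.
move=> j; rewrite /bproj.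
have -> : \sum_i (bcoef v tau y x i *+ M) *: v i = (\sum_i bcoef v tau y x i *: v i) *+ M.
  by rewrite -sumrMnl; apply: eq_bigr => i _; rewrite !scale_natV scalerA mulr_natl.
by rewrite (biaddBl psiDl) !(biaddMnl psiDl) psi_bcoef // subrr.
Qed.

Lemma bprojD x x' : bproj (x + x') = bproj x + bproj x'.
Proof.
rewrite /bproj mulrnDl.
under eq_bigr do rewrite bcoefD mulrnDl scalerDl.
by rewrite big_split /=; zmod.
Qed.

Lemma bproj_id x : perp v S x -> bproj x = x *+ M.
Proof.
move=> [_ ox]; rewrite /bproj big1 ?subr0 // => i _.
by rewrite /bcoef ox mul0r mul0rn scale0r.
Qed.

Lemma psi_bproj x x' : perp v S x' -> psi (bproj x) x' = psi x x' *+ M.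
Proof.
move=> [_ ox]; rewrite /bproj (biaddBl psiDl) (biaddMnl psiDl) (biadd_suml psiDl).
by rewrite big1 ?subr0 // => i _; rewrite psiZl psiC0 ?mulr0.
Qed.

(** A vector of [S] that detects [x] is moved into the complement by [bproj], which only multiplies
    its pairing with [x] by [M]. *)
Lemma perp_nondeg : nondeg S -> nondeg (perp v S).
Proof.
move=> nd x px x0; have [x' [Sx' xx']] := nd x px.1 x0.
exists (bproj x'); split; first exact: bproj_perp.
rewrite psiC psi_bproj // oppr_eq0; apply: contra_neq xx' => e.
have : dag (dag (psi x' x *+ M)) = 0 by rewrite e (dag0 pos).
rewrite (dagK pos) => /(@mulrn_eq0V F D (D^o : lmodType D) _ _ M_gt0).
exact: psiC0.
Qed.

(** Substitute for a discriminant bound: [q] kills the cokernel of the map from [S] to its integral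
    functionals given by the trace form. *)
Definition dual (S : set V) (q : nat) : Prop :=
  forall lam : V -> int, (forall x x', S x -> S x' -> lam (x + x') = lam x + lam x') ->
  exists2 w, S w & forall x, S x -> E w x = (q%:Z * lam x)%:~R.

(** One factor [M] comes from extending [lam] to [S] through [bproj], the other from projecting the
    representing vector back into the complement. *)
Lemma perp_dual q : dual S q -> dual (perp v S) (M ^ 2 * q)%N.
Proof.
move=> dS lam lamD.
have [x x' Sx Sx'|w Sw wE] := dS (fun x => lam (bproj x)).
  by rewrite bprojD lamD //; exact: bproj_perp.
exists (bproj w) => [|x px]; first exact: bproj_perp.
have lamMn : lam (x *+ M) = M%:Z * lam x.
  by rewrite pmulrn (additive_on_mulz (perp_subgroup v sS) lamD).
rewrite psi_bproj //.
have trMn (d : D) l : trdQ (d *+ l) = l%:R * trdQ d.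
  elim: l => [|l IH]; first by rewrite mulr0n trdQ0 mul0r.
  by rewrite mulrS trdQD IH -natr1 mulrDl mul1r addrC.
rewrite trMn wE; last by case: px.
rewrite bproj_id // lamMn.
have -> : M%:R = (M%:Z)%:~R :> rat by rewrite -pmulrn.
by rewrite -intrM; congr (_%:~R); rewrite PoszM expnS expn1 PoszM; ring.
Qed.

End Split.

Section Concat.
Variables (p1 p2 : nat) (v1 : 'I_p1 -> V) (v2 : 'I_p2 -> V).
Variables (tau1 : 'I_p1 -> 'I_p1) (tau2 : 'I_p2 -> 'I_p2).
Variables (y1 : 'I_p1 -> D) (y2 : 'I_p2 -> D).

Definition cat_fam (T : Type) (f1 : 'I_p1 -> T) (f2 : 'I_p2 -> T) (i : 'I_(p1 + p2)) : T :=
  match fintype.split i with inl j => f1 j | inr j => f2 j end.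

Definition cat_tau (i : 'I_(p1 + p2)) : 'I_(p1 + p2) :=
  cat_fam (fun j => lshift p2 (tau1 j)) (fun j => rshift p1 (tau2 j)) i.

Lemma cat_faml T (f1 : 'I_p1 -> T) f2 j : cat_fam f1 f2 (lshift p2 j) = f1 j.
Proof. by rewrite /cat_fam (unsplitK (inl _ j)). Qed.

Lemma cat_famr T (f1 : 'I_p1 -> T) f2 j : cat_fam f1 f2 (rshift p1 j) = f2 j.
Proof. by rewrite /cat_fam (unsplitK (inr _ j)). Qed.

Lemma cat_block : block v1 tau1 y1 -> block v2 tau2 y2 ->
  (forall i j, psi (v2 j) (v1 i) = 0) ->
  block (cat_fam v1 v2) cat_tau (cat_fam y1 y2).
Proof.
move=> [tt1 o1 u1] [tt2 o2 u2] o12; split=> [i|i j|i].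
- by rewrite /cat_tau; case: (splitP i) => k ik;
    [rewrite (_ : i = lshift p2 k)|rewrite (_ : i = rshift p1 k)];
    rewrite ?(cat_faml, cat_famr) ?tt1 ?tt2 //; exact: val_inj.
- rewrite -(splitK i) -(splitK j); case: (fintype.split i) => k; case: (fintype.split j) => l /=;
    rewrite /cat_tau ?(cat_faml, cat_famr).
  + by rewrite (inj_eq (@lshift_inj _ _)); exact: o1.
  + by move=> _; apply: psiC0.
  + by [].
  + by rewrite (inj_eq (@rshift_inj _ _)); exact: o2.
- rewrite -(splitK i); case: (fintype.split i) => k /=;
    rewrite /cat_tau ?(cat_faml, cat_famr); [exact: u1|exact: u2].
Qed.

Lemma cat_bcoefl x j : bcoef (cat_fam v1 v2) cat_tau (cat_fam y1 y2) x (lshift p2 j)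
  = bcoef v1 tau1 y1 x j.
Proof. by rewrite /bcoef /cat_tau ?(cat_faml, cat_famr). Qed.

Lemma cat_bcoefr x j : bcoef (cat_fam v1 v2) cat_tau (cat_fam y1 y2) x (rshift p1 j)
  = bcoef v2 tau2 y2 x j.
Proof. by rewrite /bcoef /cat_tau ?(cat_faml, cat_famr). Qed.

Lemma cat_bcoef_sum x :
  \sum_i bcoef (cat_fam v1 v2) cat_tau (cat_fam y1 y2) x i *: cat_fam v1 v2 i
  = \sum_i bcoef v1 tau1 y1 x i *: v1 i + \sum_i bcoef v2 tau2 y2 x i *: v2 i.
Proof.
rewrite big_split_ord /=; congr (_ + _); apply: eq_bigr => i _.
  by rewrite cat_bcoefl cat_faml.
by rewrite cat_bcoefr cat_famr.
Qed.

End Concat.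

End Form.

(** * Normalized frames *)

Definition pairing (symp : bool) (i : nat) : nat :=
  if symp then (if odd i then i.-1 else i.+1) else i.

Definition shape symp p (tau : 'I_p -> 'I_p) : Prop :=
  forall i, tau i = pairing symp i :> nat.

(** A central element at most 2 at each real place has trace at most 2 times the degree of [F], and
    the reduced trace to [F] doubles it. *)
Definition frame_const (n : nat) : rat := (4 * n)%:R.

Section Reduction.
Variables (R : realType) (F : fieldExtType rat) (D : falgType F) (dag : D -> D).
Variables (t : F) (sig : 'I_(\dim {:F}) -> {rmorphism F -> R}).
Hypothesis inj_t : injective (fun s => sig s t).
Hypothesis pos : positive_involution dag.
Variable symp : bool.
Hypothesis caseS : if symp then is_center D
                   else quaternion_algebra D /\ totally_indefinite R D.
Variables (V : lmodType D) (psi : V -> V -> D).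
Hypothesis psiP : skew_hermitian_form dag psi.
Local Notation dsqr := (dsqr dag).
Local Notation E x y := (trdQ (psi x y)).

Let caseD : is_center D \/ quaternion_algebra D.
Proof. by move: caseS; case: symp => [|[]]; [left|right]. Qed.

Let psiDl := psiDl psiP.
Let psiDr := psiDr psiP.
Let psiZl := psiZl pos psiP.
Let psiZr := psiZr psiP.
Let psiC := psiC psiP.
Let psiC0 := psiC0 pos psiP.

(** When [D] is its centre, [dag] is the identity and [psi] is alternating, so any pair with
    invertible pairing is hyperbolic. *)
Lemma block_of_pair (v0 v1 : V) (y : D) : is_center D ->
  unit_pair (psi v0 v1) y ->
  block psi (fun i : 'I_2 => if i == ord0 then v0 else v1) (@rev_ord 2)
    (fun i => if i == ord0 then y else - y).
Proof.
move=> cD [cy yc].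
have dagE d : dag d = d by have [a ->] := cD d; rewrite (dag_alg inj_t caseD pos).
have alt x : psi x x = 0.
  have /eqP := psiC x x; rewrite dagE -addr_eq0 -mulr2n => /eqP e.
  exact: (@mulrn_eq0V F D (D^o : lmodType D) 2).
have s10 : psi v1 v0 = - psi v0 v1 by rewrite psiC dagE.
split=> [i|i j|i]; first exact: rev_ordK.
- case: i => -[|[|//]] hi; case: j => -[|[|//]] hj; rewrite -!val_eqE //= ?eqxx //.
case: i => -[|[|//]] hi; rewrite -!val_eqE //= ?eqxx //.
by split; rewrite s10 mulrNN.
Qed.

Lemma block_of_vector (v : V) (y : D) : unit_pair (psi v v) y ->
  block psi (fun _ : 'I_1 => v) id (fun=> y).
Proof. by move=> u; split=> // i j; rewrite !ord1 eqxx. Qed.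

Lemma skew_psi x : dag (psi x x) = - psi x x.
Proof. by rewrite [in RHS]psiC opprK. Qed.

(** If all these sums vanished, [c = psi y x] would satisfy [d * c = c * dag d] for every [d]. Then
    all commutators of [D] annihilate [c], and the commutator of [i] and [j] is invertible. *)
Lemma unitary_vector (A : set D) (S : set V) :
  quaternion_algebra D -> (forall d, inQ A d) -> stable A S -> subgroup S ->
  forall x, S x -> (exists y, S y /\ psi y x != 0) ->
  exists y, S y /\ psi y x + psi x y != 0.
Proof.
move=> qD AQ stS sS x Sx [y [Sy yx]]; apply: contrapT => nex.
have b0 z : S z -> psi z x + psi x z = 0.
  by move=> Sz; apply/eqP/negPn/negP => ?; apply: nex; exists z.
pose c := psi y x.
have dc d : d * c = c * dag d.
  have sym a : A a -> a * c = dag (a * c).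
    move=> Aa; have := b0 _ (stS _ _ Aa Sy); rewrite psiZl [psi x _]psiC psiZl.
    by move/eqP; rewrite subr_eq0 => /eqP.
  have symd e : e * c = dag (e * c).
    have [K [K0 AK]] := AQ e; have := sym _ AK.
    rewrite mulrnAl -[_ *+ K]mulr_natr (dagM pos).
    have -> : dag K%:R = K%:R.
      by rewrite -[K%:R](qD_nat D) /qD (dag_alg inj_t caseD pos).
    rewrite mulr_natl mulr_natr => /eqP; rewrite -subr_eq0 -mulrnBl => /eqP.
    move/(@mulrn_eq0V F D (D^o : lmodType D) _ _ K0)/eqP.
    by rewrite subr_eq0 => /eqP.
  rewrite symd (dagM pos); congr (_ * _).
  by have := symd 1; rewrite mul1r => <-.
have comm d e : (d * e - e * d) * c = 0.
  rewrite mulrBl; apply/eqP; rewrite subr_eq0; apply/eqP.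
  by rewrite dc (dagM pos) mulrA -dc -mulrA -dc mulrA.
have [i [j [a [b [[a0 b0'] ii jj ij _]]]]] := qD.
have := comm i j; have ji : j * i = - (i * j) by rewrite ij opprK.
rewrite ji opprK -mulr2n mulrnAl => /(@mulrn_eq0V F D (D^o : lmodType D) 2 _ isT).
move/(congr1 (fun u => i * u)); rewrite mulr0 !mulrA ii.
rewrite -scalerAl mul1r -scalerAl => /eqP; rewrite scaler_eq0 (negPf a0) /=.
move/eqP/(congr1 (fun u => j * u)); rewrite mulr0 mulrA jj -scalerAl mul1r => /eqP.
by rewrite scaler_eq0 (negPf b0') /= (negPf yx).
Qed.

(** If every vector were isotropic, polarization would contradict [unitary_vector]. *)
Lemma exists_nonisotropic (A : set D) (S : set V) :
  quaternion_algebra D -> (forall d, inQ A d) -> stable A S -> subgroup S ->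
  nondeg psi S -> (exists2 x, S x & x != 0) -> exists2 x, S x & psi x x != 0.
Proof.
move=> qD AQ stS sS nd [x Sx x0]; apply: contrapT => nex.
have q0 z : S z -> psi z z = 0.
  by move=> Sz; apply/eqP/negPn/negP => ?; apply: nex; exists z.
have [y [Sy xy]] := nd x Sx x0.
have [|z [Sz]] := unitary_vector qD AQ stS sS Sx.
  by exists y; split=> //; apply: contra_neq xy; exact: psiC0.
have := q0 _ (subgroupD sS Sz Sx); rewrite psiDl !psiDr !q0 // add0r addr0.
by move=> ->; rewrite eqxx.
Qed.

Lemma dimF_le : (\dim {:F} <= dimQ D)%N.
Proof. by rewrite /dimQ leq_pmulr // (adim_gt0 {:D}%AS). Qed.

Lemma alg_trace_le (a : F) (c : R) : (forall s, sig s a <= c) ->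
  ratr (alg_trace a) <= (\dim {:F})%:R * c.
Proof.
move=> h; rewrite (alg_trace_sum inj_t).
apply: (@le_trans _ _ (\sum_(s < \dim {:F}) c)); first exact: ler_sum.
by rewrite sumr_const card_ord mulr_natl.
Qed.

(** In the field case a rescaling makes the pairing equal to 1. In the quaternion case the square of
    [psi v v] is [- b] with [b] between 1/2 and 2 at every place, which bounds both [psi v v] and
    its inverse. *)
Lemma normalized_block_start (W : set V) :
  subgroup W -> stable [set: D] W -> nondeg psi W -> (exists2 x, W x & x != 0) ->
  exists (v : 'I_symp.+1 -> V) tau y,
    [/\ block psi v tau y, forall i, W (v i),
        forall i, dsqr (psi (v i) (v (tau i))) <= frame_const (dimQ D)
      & forall i, dsqr (y i) <= frame_const (dimQ D)].
Proof.
move=> sW stW nd nz.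
have setQ (d : D) : inQ [set: D] d by exists 1%N.
move: caseS; case: symp => [cD|[qD indef]].
  have [x Wx x0] := nz; have [z [Wz xz]] := nd x Wx x0.
  have d1 : dsqr 1 <= frame_const (dimQ D).
    rewrite /dsqr mul1r (dag1 pos) /trdQ.
    have -> : trd (1 : D) = 1 by have := trd_center 1 cD; rewrite scale1r.
    rewrite alg_trace1 ler_nat (leq_trans dimF_le) // leq_pmull //.
  have [a aE] := cD (psi x z).
  have a0 : a != 0 by apply: contra_neq xz; rewrite aE => ->; rewrite scale0r.
  pose x' := (a^-1)%:A *: x.
  have x'z : psi x' z = 1 by rewrite psiZl aE mulr_algl scalerA mulVf // scale1r.
  have u : unit_pair (psi x' z) 1 by rewrite /unit_pair x'z mulr1.
  exists (fun i : 'I_2 => if i == ord0 then x' else z), (@rev_ord 2),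
    (fun i => if i == ord0 then 1 else - 1); split.
  - exact: block_of_pair.
  - by move=> i; case: ifP => _ //; exact: stW.
  - have dagE d : dag d = d by have [b ->] := cD d; rewrite (dag_alg inj_t caseD pos).
    case=> -[|[|//]] hi; rewrite -!val_eqE /=; first by rewrite x'z.
    by rewrite psiC dagE x'z (dsqrN pos).
  - by move=> i; case: ifP => _ //; rewrite (dsqrN pos).
have [x Wx xx] := exists_nonisotropic qD setQ stW sW nd nz.
have [a [aE ap]] := skew_sqr inj_t caseD pos qD (skew_psi x) xx.
have [u ub] := approx_fourth_root inj_t ap.
pose v := u%:A *: x; pose b := u ^+ 4 * a; pose c := psi v v.
have dagu : dag u%:A = u%:A by rewrite (dag_alg inj_t caseD pos).
have cE : c = (u ^+ 2) *: psi x x.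
  by rewrite /c psiZl psiZr dagu mulr_algl mulr_algr scalerA.
have cc : c * c = - b%:A.
  rewrite cE -scalerAl -scalerAr aE !scalerN !scalerA /b -mulrA; congr (- (_ *: _)).
  by ring.
have bp s : 0 < sig s b by case/andP: (ub s) => h _; apply: lt_le_trans h; rewrite invr_gt0.
have d0 : (0 < \dim {:F})%N by exact: (adim_gt0 {:F}%AS).
have b0 : b != 0 by apply: contraTneq (bp (Ordinal d0)) => ->; rewrite rmorph0 ltxx.
pose y := - (b^-1 *: c).
have uy : unit_pair c y.
  by split; rewrite /y ?mulrN ?mulNr -?scalerAr -?scalerAl cc scalerN opprK scalerA mulVf ?scale1r.
have sc : dag c = - c by exact: skew_psi.
have bound (e : F) : (forall s, sig s e <= 2%:R) -> trdQ (e%:A : D) <= frame_const (dimQ D).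
  move=> he; rewrite /trdQ trd_alg_quat // -[_ * e](_ : 2%:R *: e = _); last first.
    by rewrite scaler_nat mulr_natl.
  rewrite alg_traceZ -(ler_rat R) rmorphM /= /frame_const !ratr_nat.
  have h1 := alg_trace_le he.
  have h2 : (\dim {:F})%:R <= (dimQ D)%:R :> R by rewrite ler_nat dimF_le.
  by rewrite natrM; lra.
exists (fun=> v), id, (fun=> y); split=> //.
- exact: block_of_vector.
- by move=> _; exact: stW.
- move=> _; rewrite -/c /dsqr sc mulrN cc opprK; apply: bound => s.
  by case/andP: (ub s).
- move=> _; rewrite /dsqr.
  have -> : dag y = - y by rewrite /y (dagN pos) (dagZ inj_t caseD pos) sc scalerN.
  have -> : y * - y = (b^-1)%:A.
    rewrite /y opprK mulNr -scalerAl -scalerAr cc !scalerN opprK !scalerA.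
    by rewrite -mulrA mulVf ?mulr1.
  by apply: bound => s; rewrite fmorphV invf_ple ?posrE ?bp ?ltr0n //; case/andP: (ub s).
Qed.

(** Each step adds at most two vectors and lowers the rank bound by one, whence [2 * s]. *)
Lemma normalized_block s : forall W : set V,
  subgroup W -> stable [set: D] W -> nondeg psi W -> rank_le s W ->
  exists p (v : 'I_p -> V) tau y,
    [/\ block psi v tau y, (p <= 2 * s)%N, spanned psi v tau y W,
        forall i, W (v i) &
        (forall i, dsqr (psi (v i) (v (tau i))) <= frame_const (dimQ D)) /\
        (forall i, dsqr (y i) <= frame_const (dimQ D))].
Proof.
elim: s => [|s IH] W sW stW nd rk.
  exists 0%N, (fun=> 0), id, (fun=> 0); split=> //; try (by case); last by split; case.
  - by split; case.
  - move=> x Wx; rewrite big_ord0; have [z [[i zi]]] := rk (fun=> x) (fun=> Wx).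
    move: zi; rewrite (ord1 i) => zi; rewrite big_ord1 => /mulrz_eq0V; apply.
    exact/eqP.
have [nz|z0] := pselect (exists2 x, W x & x != 0); last first.
  exists 0%N, (fun=> 0), id, (fun=> 0); split=> //; try (by case); last by split; case.
  - by split; case.
  - move=> x Wx; rewrite big_ord0; apply/eqP/negPn/negP => x0.
    by apply: z0; exists x.
have [v [tau [y [blk Wv c1 y1]]]] := normalized_block_start sW stW nd nz.
(* All of [D] acts on [W], so the multiplier of the splitting is 1 and [bproj] is the true
   projection. *)
have AM x i : W x -> [set: D] (bcoef psi v tau y x i *+ 1) by [].
have nd' := perp_nondeg pos psiP sW stW Wv blk (ltn0Sn 0) AM nd.
have rk' := perp_rank psiP blk (ltn0Sn symp) Wv rk.
have [p [v2 [tau2 [y2 [blk2 p2 sp2 Wv2 [c2 y2b]]]]]] :=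
  IH _ (perp_subgroup psiP v sW) (perp_stable pos psiP stW) nd' rk'.
exists (symp.+1 + p)%N, (cat_fam v v2), (cat_tau tau tau2), (cat_fam y y2); split.
- apply: (cat_block pos psiP blk blk2) => i j; exact: (Wv2 j).2.
- by rewrite mulnS (leq_add _ p2) //; case: symp.
- move=> x Wx; rewrite cat_bcoef_sum.
  have pb := bproj_perp pos psiP sW stW Wv blk AM Wx.
  have := sp2 _ pb; rewrite {1}/bproj mulr1n => /eqP; rewrite subr_eq => /eqP e.
  rewrite [LHS]e [LHS]addrC; congr (_ + _); apply: eq_bigr => i _ //.
  by rewrite /bcoef (@psi_bproj _ _ _ pos _ _ psiP W _ v tau y 1 x _ (Wv2 (tau2 i))) mulr1n.
- move=> i; rewrite -(splitK i); case: (fintype.split i) => j /=.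
    by rewrite cat_faml.
  by rewrite cat_famr; case: (Wv2 j).
- split=> i; rewrite -(splitK i); case: (fintype.split i) => j /=;
    by rewrite /cat_tau ?(cat_faml, cat_famr).
Qed.

End Reduction.

(** * Short blocks *)

Lemma const_bound (P Z a b : rat) : 0 <= P -> 0 <= Z -> 1 <= a -> 0 <= b ->
  4%:R * P * b <= (Z + 4%:R) * P * (a * b).
Proof.
move=> P0 Z0 a1 b0.
have -> : (Z + 4%:R) * P * (a * b) = (Z + 4%:R) * a * (P * b) by ring.
rewrite -mulrA ler_wpM2r ?mulr_ge0 //; nra.
Qed.

Lemma const_bound_mul (P n h a b : rat) : 0 <= P -> 0 <= a -> 0 <= b ->
  2%:R * n * h * a * (4%:R * P * b) <= (8%:R * n * h + 4%:R) * P * (a * b).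
Proof.
move=> P0 a0 b0.
have -> : 2%:R * n * h * a * (4%:R * P * b) = 8%:R * n * h * (P * (a * b)) by ring.
by rewrite -[leRHS]mulrA ler_wpM2r ?mulr_ge0 // lerDl.
Qed.

(** The first term is the cost of expanding [psi] over at most [2 * N] frame vectors, the second the
    cost of passing from [w] to its representing vector in [cform_represents], and 1 makes the
    constant at least 1. *)
Definition form_const (n N : nat) : rat :=
  (4 * N ^ 2)%:R * frame_const n + frame_const n + 1.

Definition pair_const (n N : nat) : rat := form_const n N ^+ 2 * hermite_const N ^+ 2.

(** The factor 8 is the product of 2, from the bound on [f + s], and 4, from the bound on the skew
    element [b]; the summand 4 covers the case where the value is [b] itself. *)
Definition block_const (n N : nat) : rat :=
  (8%:R * N%:R ^+ 2 * hermite_const N + 4%:R) * pair_const n N.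

Section Quantitative.
Variables (R : realType) (F : fieldExtType rat) (D : falgType F) (dag : D -> D).
Variables (t : F) (sig : 'I_(\dim {:F}) -> {rmorphism F -> R}).
Hypothesis inj_t : injective (fun s => sig s t).
Hypothesis pos : positive_involution dag.
Variable symp : bool.
Hypothesis caseS : if symp then is_center D
                   else quaternion_algebra D /\ totally_indefinite R D.
Variables (V : lmodType D) (psi : V -> V -> D).
Hypothesis psiP : skew_hermitian_form dag psi.
Local Notation dsqr := (dsqr dag).
Local Notation E x y := (trdQ (psi x y)).

Let caseD : is_center D \/ quaternion_algebra D.
Proof. by move: caseS; case: symp => [|[]]; [left|right]. Qed.

Let psiDl := psiDl psiP.
Let psiDr := psiDr psiP.
Let psiZl := psiZl pos psiP.
Let psiZr := psiZr psiP.
Let psiC := psiC psiP.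
Let psiC0 := psiC0 pos psiP.

Variables (O : set D) (N k : nat).
Hypothesis sO : subgroup O.
Hypothesis O1 : O 1.
Hypothesis OM : forall x y, O x -> O y -> O (x * y).
Hypothesis OQ : forall d, inQ O d.
Hypothesis Ospan : exists n (c : 'I_n -> D), O `<=` zspan c.
Hypothesis Ork : rank_le N O.
Hypothesis k_gt0 : (0 < k)%N.
Hypothesis Ok : forall c, (forall x, O x -> trQ (x * c) \is a Num.int) -> O (c *+ k).

Lemma stable_inQ (S : set V) : subgroup S -> stable O S -> stable [set: D] (inQ S).
Proof.
move=> sS stS a x _ [K [K0 Kx]]; have [M [M0 Ma]] := OQ a.
exists (M * K)%N; rewrite muln_gt0 M0 K0; split=> //.
have -> : a *: x *+ (M * K) = (a *+ M) *: (x *+ K).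
  by rewrite -scalerMnl -scalerMnr -mulrnA mulnC.
exact: stS.
Qed.

Lemma nondeg_inQ (S : set V) : nondeg psi S -> nondeg psi (inQ S).
Proof.
move=> nd x [K [K0 Kx]] x0.
have [|y [Sy xy]] := nd _ Kx; first by apply: contra_neq x0; exact: mulrn_eq0V.
exists y; split; first exact: sub_inQ.
by apply: contra_neq xy => e; rewrite (biaddMnl psiDl) e mul0rn.
Qed.

Lemma frame_const_ge0 : 0 <= frame_const (dimQ D). Proof. exact: ler0n. Qed.

Lemma form_const_ge1 : 1 <= form_const (dimQ D) N.
Proof.
by rewrite lerDr addr_ge0 ?mulr_ge0 ?ler0n ?frame_const_ge0.
Qed.

(** * The positive definite form of a normalized frame *)

Section CompatibleForm.
Variables (S : set V) (p : nat) (v : 'I_p -> V) (tau : 'I_p -> 'I_p) (y : 'I_p -> D).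
Hypothesis sS : subgroup S.
Hypothesis stS : stable O S.
Hypothesis blk : block psi v tau y.
Hypothesis p_le : (p <= 2 * N)%N.
Hypothesis spv : spanned psi v tau y (inQ S).
Hypothesis vS : forall i, inQ S (v i).
Hypothesis c_le : forall i, dsqr (psi (v i) (v (tau i))) <= frame_const (dimQ D).
Hypothesis y_le : forall i, dsqr (y i) <= frame_const (dimQ D).

(** This is h of the overview. It is definite on the Q-span of [S] because the frame spans it. *)
Definition cform (x x' : V) : rat := \sum_i trdQ (psi x (v i) * dag (psi x' (v i))).

Lemma cformDl x x' z : cform (x + x') z = cform x z + cform x' z.
Proof.
rewrite /cform -big_split; apply: eq_bigr => i _ /=.
by rewrite psiDl mulrDl trdQD.
Qed.

Lemma cformC x z : cform x z = cform z x.
Proof. by apply: eq_bigr => i _; exact: (trdQ_dagC inj_t caseD pos). Qed.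

Lemma cformDr x z z' : cform x (z + z') = cform x z + cform x z'.
Proof. by rewrite cformC cformDl !(cformC x). Qed.

Lemma dsqr_le_cform x i : dsqr (psi x (v i)) <= cform x x.
Proof. by rewrite /cform (bigD1 i) //= lerDl sumr_ge0 // => j _; exact: (dsqr_ge0 pos). Qed.

Lemma cform_ge0 x : 0 <= cform x x.
Proof. by apply: sumr_ge0 => j _; exact: (dsqr_ge0 pos). Qed.

Lemma cform_gt0 x : inQ S x -> x != 0 -> 0 < cform x x.
Proof.
move=> Sx x0; rewrite lt_neqAle cform_ge0 andbT eq_sym; apply: contra_neq x0 => h0.
rewrite (spv Sx) big1 // => i _; rewrite /bcoef.
have -> : psi x (v (tau i)) = 0; last by rewrite mul0r scale0r.
apply/eqP/negPn/negP => /(dsqr_gt0 pos); rewrite ltNge => /negP[].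
by rewrite -h0 dsqr_le_cform.
Qed.

Lemma psi_expand x x' : inQ S x ->
  psi x x' = - \sum_i psi x (v (tau i)) * y i * dag (psi x' (v i)).
Proof.
move=> Sx; rewrite {1}(spv Sx) (biadd_suml psiDl) -sumrN; apply: eq_bigr => i _.
by rewrite psiZl [psi (v i) x']psiC mulrN.
Qed.

(** Expand [x] over the frame and use submultiplicativity of [dsqr]; each factor [psi x (v i)] is
    bounded by [cform]. *)
Lemma psi_le_cform x x' : inQ S x ->
  dsqr (psi x x') <= form_const (dimQ D) N * (cform x x * cform x' x').
Proof.
move=> Sx; rewrite psi_expand // (dsqrN pos); apply: (le_trans (dsqr_sum inj_t caseD pos _)).
have hh : 0 <= cform x x * cform x' x' by rewrite mulr_ge0 ?cform_ge0.
apply: (@le_trans _ _ (p%:R * \sum_(i < p) frame_const (dimQ D) * (cform x x * cform x' x'))).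
  rewrite ler_wpM2l ?ler0n //; apply: ler_sum => i _.
  apply: (le_trans (dsqrM inj_t caseD pos _ _)); rewrite (dsqr_dag pos).
  rewrite mulrA ler_pM ?(dsqr_ge0 pos) ?dsqr_le_cform //.
  apply: (le_trans (dsqrM inj_t caseD pos _ _)); rewrite mulrC.
  by rewrite ler_pM ?(dsqr_ge0 pos) ?dsqr_le_cform.
move: (cform x x * cform x' x') hh => h2 hh.
rewrite sumr_const card_ord -(mulr_natl (frame_const (dimQ D) * h2)) !mulrA ler_wpM2r //.
rewrite /form_const -addrA -[leLHS]addr0 lerD ?addr_ge0 ?frame_const_ge0 //.
rewrite ler_wpM2r ?frame_const_ge0 // -natrM ler_nat.
by rewrite (_ : 4 * N ^ 2 = (2 * N) * (2 * N))%N ?leq_mul //; lia.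
Qed.

(** Through the Gram matrix of the frame, [w] is converted into [u0] with [cform u0 x = E w x].
    Since [u0] lies only in the Q-span, it is multiplied by [K]; the last inequality records that
    [K] scales both sides alike. *)
Lemma cform_represents w : S w -> exists (K : nat) (u : V),
  [/\ (0 < K)%N, S u, forall x, S x -> cform u x = K%:R * E w x
    & K%:R ^+ 2 * cform w w <= form_const (dimQ D) N * cform u u].
Proof.
move=> Sw; have [tt _ inv] := blk.
(* One inverse undoes the Gram entry met when pairing with [v j], the other is the one occurring in
   [psi_expand]. *)
pose a j := - (psi w (v j) * y (tau j) * y j).
pose u0 := \sum_j a j *: v j.
have u0v j : psi u0 (v j) = - (psi w (v (tau j)) * y j).
  rewrite /u0 (psi_block_sum pos psiP blk) /a tt mulNr -!mulrA.
  by have [_] := inv (tau j); rewrite tt => ->; rewrite mulr1.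
have Su0 : inQ S u0.
  by apply: inQ_sum => // j; apply: (stable_inQ sS stS) => //.
have [K [K0 SK]] := Su0; exists K, (u0 *+ K); split=> //.
  move=> x Sx; rewrite (biaddMnl cformDl) -[cform u0 x *+ K]mulr_natl; congr (_ * _).
  rewrite psi_expand; last exact: sub_inQ.
  rewrite trdQN trdQ_sum -sumrN; apply: eq_bigr => i _.
  by rewrite u0v mulNr trdQN.
rewrite (biaddMnl cformDl) (biaddMnr cformDr) -[_ *+ K *+ K]mulr_natl.
rewrite -[cform u0 u0 *+ K]mulr_natl [K%:R * (K%:R * _)]mulrA -expr2 mulrCA.
rewrite ler_wpM2l ?sqr_ge0 //.
apply: (@le_trans _ _ (frame_const (dimQ D) * cform u0 u0)); last first.
  rewrite ler_wpM2r ?cform_ge0 // /form_const addrAC lerDr.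
  by rewrite addr_ge0 ?mulr_ge0 ?ler0n ?frame_const_ge0.
rewrite /cform mulr_sumr (reindex_inj (can_inj tt)) /=; apply: ler_sum => j _.
rewrite -[trdQ _]/(dsqr _) -[X in _ * X]/(dsqr _).
have -> : psi w (v (tau j)) = - (psi u0 (v j) * psi (v j) (v (tau j))).
  by rewrite u0v mulNr opprK -mulrA; have [_ ->] := inv j; rewrite mulr1.
rewrite (dsqrN pos) (le_trans (dsqrM inj_t caseD pos _ _)) // mulrC.
by rewrite ler_wpM2r ?(dsqr_ge0 pos).
Qed.

End CompatibleForm.

(* The basis vector of largest norm is paired, through the dual basis, with a
   basis vector that is so short that its pairings with all the others are
   bounded. *)
Lemma short_partner (S : set V) (q : nat) :
  subgroup S -> stable O S -> nondeg psi S -> rank_le N S ->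
  (exists n (b : 'I_n -> V), S `<=` zspan b) -> (0 < q)%N -> dual psi S q ->
  (exists2 x, S x & x != 0) ->
  exists r (x : 'I_r -> V) j, zbasis S x /\
    forall l, dsqr (psi (x l) (x j)) <= pair_const (dimQ D) N * q%:R ^+ 2.
Proof.
move=> sS stS nd rk [n [b sub]] q0 dS [x0 Sx0 x00].
have [p [v [tau [y [blk p2 spv vS [c_le y_le]]]]]] :=
  normalized_block inj_t pos caseS psiP (inQ_subgroup sS) (stable_inQ sS stS)
    (nondeg_inQ nd) (rank_le_inQ sS rk).
pose h := cform v.
have hDl := cformDl v; have hDr := cformDr v; have hC := cformC v.
have posS x : S x -> x != 0 -> 0 < h x x.
  by move=> Sx; apply: (cform_gt0 spv); exact: sub_inQ.
have [r [x [rN bx px Hx]]] := hermite_basis hDl hDr hC sS sub rk posS.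
have Sx i : S (x i) := zbasis_mem bx i.
have r0 : (0 < r)%N.
  rewrite lt0n; apply/eqP => r0; move: x bx {px Hx Sx}; rewrite r0 => x bx.
  by have /bx.1[z x0E] := Sx0; move: x00; rewrite x0E big_ord0 eqxx.
have [i imax] : exists i, forall l, h (x l) (x l) <= h (x i) (x i).
  case: (@Order.TotalTheory.arg_maxP _ rat _ (Ordinal r0) xpredT (fun l => h (x l) (x l)) isT).
  by move=> i _ im; exists i => l; exact: im.
have [co coE] := zbasis_coord bx.
(* [w] is [q] times the dual vector of the longest basis vector [x i]. *)
have [|w Sw wE] := dS (fun z => co z i).
  move=> z z' Sz Sz'; have Szz := subgroupD sS Sz Sz'.
  apply: (zbasis_inj bx (z := co (z + z')) (w := fun i => co z i + co z' i)).
  rewrite -coE // {1}(coE z Sz) {1}(coE z' Sz') -big_split /=.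
  by apply: eq_bigr => j _; rewrite mulrzDr.
have coxi : co (x i) i = 1.
  have := zbasis_inj bx (z := co (x i)) (w := fun j => (j == i)%:R); rewrite -coE //.
  move=> /(_ _ i); rewrite eqxx; apply.
  by rewrite (bigD1 i) //= eqxx big1 ?addr0 // => j /negPf ->.
have q0R : 0 < q%:R :> rat by rewrite ltr0n.
have [K [u [K0 Su uE wu]]] := cform_represents sS stS blk spv vS c_le Sw.
have K0R : 0 < K%:R :> rat by rewrite ltr0n.
set C := form_const (dimQ D) N in wu; have C1 : 1 <= C := form_const_ge1.
pose H := hermite_const N; have H1 : 1 <= H := hermite_const_ge1 N.
have w0 : w != 0.
  apply/eqP => w0; have := wE _ (Sx i); rewrite w0 (biadd0l psiDl) trdQ0 coxi mulr1.
  by move/esym/eqP; rewrite intr_eq0 eqz_nat eqn0Ngt q0.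
have hw : 0 < h w w by exact: posS.
(* As [cform u] is [K] times pairing with [w], [h u u] is [K * q * z]. The Hermite inequality for
   the coordinate [z] then loses one factor [z] and bounds [z * h (x i) (x i)]. *)
pose z : rat := (co u i)%:~R.
have guE : h u u = K%:R * q%:R * z.
  by rewrite /h uE // wE // intrM mulrA -pmulrn.
have Hu : z ^+ 2 * h (x i) (x i) <= H * h u u by have := Hx (co u) i; rewrite -coE.
have hxi := px i; rewrite -/(h _ _) in hxi.
have gu : 0 < h u u.
  rewrite -(pmulr_rgt0 _ (lt_le_trans ltr01 C1)); apply: lt_le_trans wu.
  by rewrite mulr_gt0 ?exprn_gt0.
have z0 : 0 < z by move: gu; rewrite guE pmulr_rgt0 // mulr_gt0.
have zH : z * h (x i) (x i) <= H * (K%:R * q%:R).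
  rewrite -(ler_pM2l z0) (_ : z * (z * _) = z ^+ 2 * h (x i) (x i)); last by ring.
  by rewrite (le_trans Hu) // guE; lra.
(* The estimate of [w] by [u] and the bound on [z] are multiplied together, and the denominator [K]
   cancels. *)
have hwx : h w w * h (x i) (x i) <= C * H * q%:R ^+ 2.
  have KK : 0 < K%:R ^+ 2 :> rat by rewrite exprn_gt0.
  rewrite -(ler_pM2l KK) mulrA (le_trans (ler_wpM2r (ltW hxi) wu)) //.
  rewrite -[cform v u u]/(h u u) guE.
  have -> : C * (K%:R * q%:R * z) * h (x i) (x i) =
            C * (K%:R * q%:R) * (z * h (x i) (x i)) by ring.
  have -> : K%:R ^+ 2 * (C * H * q%:R ^+ 2) = C * (K%:R * q%:R) * (H * (K%:R * q%:R)) by ring.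
  rewrite ler_wpM2l // !mulr_ge0 ?ler0n //; lra.
(* A nonzero integral coordinate of [w] is at least 1 in absolute value, so the Hermite inequality
   makes [x j] no longer than [w] up to a constant. *)
have [j coj] : exists j, co w j != 0.
  apply: contrapT => nex; move/negP: w0; apply; apply/eqP.
  rewrite (coE _ Sw) big1 // => j _.
  have -> : co w j = 0 by apply/eqP/negPn/negP => ?; apply: nex; exists j.
  by rewrite mulr0z.
have hj : h (x j) (x j) <= H * h w w.
  have := Hx (co w) j; rewrite -coE //; apply: le_trans.
  rewrite -[leLHS]mul1r ler_wpM2r ?(ltW (px j)) //.
  rewrite -rmorphXn /= -[1]/(1%:~R) ler_int -[leRHS]real_normK ?num_real //.
  by rewrite exprn_ege1 // -gtz0_ge1 normr_gt0.
exists r, x, j; split=> // l.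
apply: (le_trans (psi_le_cform p2 spv y_le _ (sub_inQ (Sx l)))).
rewrite /pair_const -/C -/H -/(h (x l) (x l)) -/(h (x j) (x j)).
have hl := imax l; have hlp := ltW (px l); have hjp := ltW (px j).
rewrite -!/(h _ _) in hlp hjp.
apply: (@le_trans _ _ (C * (h (x i) (x i) * (H * h w w)))).
  by rewrite ler_wpM2l ?(le_trans ler01 C1) // ler_pM.
have -> : C * (h (x i) (x i) * (H * h w w)) = C * H * (h w w * h (x i) (x i)) by ring.
have -> : C ^+ 2 * H ^+ 2 * q%:R ^+ 2 = C * H * (C * H * q%:R ^+ 2) by ring.
by rewrite ler_wpM2l // mulr_ge0 //; lra.
Qed.

(** If [D] is a field, any basis vector pairing nontrivially with the short [x j] completes the
    plane. In the quaternion case only an isotropic [x j] needs work: [x l] is corrected by an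
    integral central multiple of [x j], chosen to make its value small and nonzero. *)
Lemma quantitative_block (S : set V) (q : nat) :
  subgroup S -> stable O S -> nondeg psi S -> rank_le N S ->
  (exists n (b : 'I_n -> V), S `<=` zspan b) -> (0 < q)%N -> dual psi S q ->
  (exists2 x, S x & x != 0) ->
  exists (v : 'I_symp.+1 -> V) tau y,
    [/\ block psi v tau y, shape symp tau, forall i, S (v i)
      & forall i, dsqr (psi (v i) (v (tau i))) <= block_const (dimQ D) N * (k * q)%:R ^+ 2].
Proof.
move=> sS stS nd rk sub q0 dS nz.
have [r [x [j [bx hx]]]] := short_partner sS stS nd rk sub q0 dS nz.
have Sx i : S (x i) := zbasis_mem bx i.
have k1 : 1 <= k%:R :> rat by rewrite ler1n.
have P0 : 0 <= pair_const (dimQ D) N by rewrite /pair_const mulr_ge0 ?sqr_ge0.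
have H1 := hermite_const_ge1 N.
have H0 : 0 <= 8%:R * N%:R ^+ 2 * hermite_const N.
  by rewrite !mulr_ge0 ?sqr_ge0 //; lra.
have q2 : 0 <= q%:R ^+ 2 :> rat by exact: sqr_ge0.
have k2 : 1 <= k%:R ^+ 2 :> rat by rewrite exprn_ege1.
have xj0 : x j != 0.
  apply/eqP => xj; have /(bx.2 (fun l => (l == j)%:R))/(_ j) : \sum_l x l *~ (l == j)%:R = 0.
    by rewrite (bigD1 j) //= eqxx xj mul0rz add0r big1 // => l /negPf ->.
  by rewrite eqxx => /eqP; rewrite oner_eq0.
have generate (P : V -> D) : (forall u w, P (u + w) = P u + P w) ->
    (exists u, S u /\ P u != 0) -> exists l, P (x l) != 0.
  move=> PD [u [Su Pu]]; apply: contrapT => nex; move/negP: Pu; apply; apply/eqP.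
  have /bx.1[z ->] := Su.
  have PDl (w w' : V) (_ : V) : P (w + w') = P w + P w' by exact: PD.
  rewrite (biadd_suml (h := fun w (_ : V) => P w) PDl _ _ 0) big1 // => l _.
  rewrite (biaddMzl (h := fun w (_ : V) => P w) PDl _ 0).
  have -> : P (x l) = 0 by apply/eqP/negPn/negP => ?; apply: nex; exists l.
  by rewrite mul0rz.
have base e : e <= pair_const (dimQ D) N * q%:R ^+ 2 -> e <= block_const (dimQ D) N * (k * q)%:R ^+ 2.
  move=> he; apply: (le_trans he); rewrite /block_const natrM exprMn.
  apply: le_trans (const_bound P0 H0 k2 q2).
  by have := mulr_ge0 P0 q2; lra.
have caseS' := caseS; have caseS2 := caseS.
move: caseS caseS'; case: symp => [cD _|[qD indef] _].
  have [u [Su ju]] := nd _ (Sx j) xj0.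
  have [||l hl] := generate (fun u => psi u (x j)).
  - by move=> w w'; rewrite psiDl.
  - by exists u; split=> //; apply: contra_neq ju; exact: psiC0.
  have [a aE] := cD (psi (x l) (x j)).
  have a0 : a != 0 by apply: contra_neq hl; rewrite aE => ->; rewrite scale0r.
  have up : unit_pair (psi (x l) (x j)) (a^-1)%:A.
    by split; rewrite aE mulr_algl scalerA ?mulfV ?mulVf ?scale1r.
  exists (fun i : 'I_2 => if i == ord0 then x l else x j), (@rev_ord 2),
    (fun i => if i == ord0 then (a^-1)%:A else - (a^-1)%:A); split.
  - exact: (block_of_pair inj_t pos caseS2 psiP).
  - by case=> -[|[|//]] hi.
  - by move=> i; case: ifP.
  - case=> -[|[|//]] hi; rewrite -!val_eqE /=; apply: base; first exact: hx.
    by rewrite psiC (dsqrN pos) (dsqr_dag pos).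
have vec u : S u -> psi u u != 0 -> dsqr (psi u u) <= block_const (dimQ D) N * (k * q)%:R ^+ 2 ->
  exists (v : 'I_1 -> V) tau y,
    [/\ block psi v tau y, shape false tau, forall i, S (v i)
      & forall i, dsqr (psi (v i) (v (tau i))) <= block_const (dimQ D) N * (k * q)%:R ^+ 2].
  move=> Su u0 ub.
  have [y yE] := skew_unit inj_t caseD pos qD (skew_psi psiP u) u0.
  by exists (fun=> u), id, (fun=> y); split=> //; exact: block_of_vector.
have [jj|jj] := eqVneq (psi (x j) (x j)) 0; last first.
  by apply: (vec (x j)) => //; apply: base.
have [u [Su ju]] := nd _ (Sx j) xj0.
have [||l hl] := generate (fun u => psi u (x j) + psi (x j) u).
- by move=> w w'; rewrite psiDl psiDr; zmod.
- apply: (unitary_vector inj_t pos caseS2 psiP qD OQ stS sS (Sx j)).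
  by exists u; split=> //; apply: contra_neq ju; exact: psiC0.
set b := psi (x l) (x j) + psi (x j) (x l) in hl.
have sb : dag b = - b.
  by rewrite /b (dagD pos) [psi (x j) (x l)]psiC (dagN pos) (dagK pos) opprD opprK addrC.
have bb : dsqr b <= 4%:R * pair_const (dimQ D) N * q%:R ^+ 2.
  apply: (le_trans (dsqrD inj_t caseD pos _ _)).
  rewrite [psi (x j) (x l)]psiC (dsqrN pos) (dsqr_dag pos).
  by have := hx l; lra.
(* [psi (x l) (x l)] and [b] are both skew, hence proportional over [F], but [f] has no bound
   yet. *)
have [f fE] := skew_line inj_t caseD pos qD indef sb hl (skew_psi psiP (x l)).
have [e [tu [g [eN Og gle gE]]]] :=
  order_center_basis inj_t caseD pos sO OM OQ Ospan Ork qD Ok.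
pose a j := alg_trace (f * tu j).
pose z j := Num.floor (a j / k%:R).
have kp : 0 < k%:R :> rat by rewrite ltr0n.
(* [- s] is [f] rounded down in the lattice generated by the [k g_j], which lie in [O]; the
   coordinates left over are between 0 and [k]. *)
pose s : F := - \sum_j (g j *+ k) *~ z j.
have Os : O s%:A.
  rewrite /s scaleNr; apply: (subgroupN sO); rewrite scaler_suml.
  apply: (subgroup_sum sO) => i _.
  have -> : (g i *+ k *~ z i)%:A = ((g i)%:A *+ k) *~ z i :> D.
    by rewrite -scalerMzl -scalerMnl.
  exact: (subgroupMz sO).
pose w j := a j - k%:R * (z j)%:~R.
have w01 i : 0 <= w i /\ w i <= k%:R.
  have h1 := floor_le_tmp (a i / k%:R); have h2 := floorD1_gt (a i / k%:R).
  rewrite ler_pdivlMr // in h1; rewrite ltr_pdivrMr // intrD mulrDl mul1r in h2.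
  by rewrite /w -/(z i) in h1 h2 *; split; lra.
have fs : f + s = \sum_i w i *: g i.
  rewrite {1}(gE f) /s -sumrB; apply: eq_bigr => i _.
  rewrite /w scalerBl; congr (_ - _).
  by rewrite -scaler_int -scaler_nat scalerA mulrC.
have dalg (c : F) : dsqr (c%:A : D) = 2%:R * alg_trace (c * c).
  rewrite /dsqr (dag_alg inj_t caseD pos) mulr_algl scalerA /trdQ trd_alg_quat //.
  by rewrite -[_ * (c * c)](_ : 2%:R *: (c * c) = _) ?alg_traceZ // scaler_nat mulr_natl.
have fsb : dsqr ((f + s)%:A : D) <= 2%:R * N%:R ^+ 2 * hermite_const N * k%:R ^+ 2.
  rewrite fs scaler_suml (le_trans (dsqr_sum inj_t caseD pos _)) //.
  apply: (@le_trans _ _ (e%:R * \sum_(i < e) k%:R ^+ 2 * (2%:R * hermite_const N))).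
    rewrite ler_wpM2l ?ler0n //; apply: ler_sum => i _.
    rewrite dalg.
    have -> : w i *: g i * (w i *: g i) = (w i ^+ 2) *: (g i * g i).
      by rewrite -scalerAl -scalerAr scalerA expr2.
    rewrite alg_traceZ mulrCA ler_pM ?sqr_ge0 //.
    - rewrite mulr_ge0 //; have [->|g0] := eqVneq (g i) 0; first by rewrite mul0r alg_trace0.
      exact/ltW/(alg_trace_sqr_gt0 inj_t).
    - by have [h1 h2] := w01 i; rewrite ler_sqr ?nnegrE ?ler0n.
    - by rewrite ler_wpM2l.
  rewrite sumr_const card_ord -(mulr_natl (k%:R ^+ 2 * _)) mulrA -natrM.
  have eN2 : (e * e)%:R <= N%:R ^+ 2 :> rat by rewrite -natrX ler_nat expnS expn1 leq_mul.
  rewrite (le_trans (ler_wpM2r _ eN2)) //; last lra.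
  by rewrite mulr_ge0 ?sqr_ge0 //; lra.
have dags : dag s%:A = s%:A by exact: (dag_alg inj_t caseD pos).
have psiv (c : F) : psi (x l + c%:A *: x j) (x l + c%:A *: x j) = (f + c) *: b.
  rewrite psiDl !psiDr !psiZl !psiZr jj mul0r mulr0 addr0 (dag_alg inj_t caseD pos).
  rewrite fE mulr_algl mulr_algr -addrA -scalerDr -scalerDl; congr (_ *: _).
have Sc (c : F) : O c%:A -> S (x l + c%:A *: x j).
  by move=> Oc; apply: (subgroupD sS) => //; exact: stS.
(* If rounding kills [f] exactly, one more [x j] makes the value equal to [b], which is nonzero and
   bounded. *)
have [fs0|fs0] := eqVneq (f + s) 0.
  apply: (vec (x l + (s + 1)%:A *: x j)).
  - by apply: Sc; rewrite scalerDl scale1r; exact: (subgroupD sO).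
  - by rewrite psiv addrA fs0 add0r scale1r.
  - rewrite psiv addrA fs0 add0r scale1r (le_trans bb) //.
    by rewrite /block_const natrM exprMn; exact: const_bound.
apply: (vec (x l + s%:A *: x j)); first exact: Sc.
  by rewrite psiv scaler_eq0 negb_or fs0.
rewrite psiv -mulr_algl (le_trans (dsqrM inj_t caseD pos _ _)) //.
apply: (le_trans (ler_pM (dsqr_ge0 pos _) (dsqr_ge0 pos _) fsb bb)).
rewrite /block_const natrM exprMn; apply: const_bound_mul => //.
exact: le_trans k2.
Qed.

End Quantitative.

(** * Induction on the rank *)

Definition block_bound (n N : nat) : nat := Num.bound (block_const n N).

(** From [order_inverse_bound] applied to [k] times a Gram entry: its [dsqr] is at most a constant
    times [(k q) ^ 4], and the [N]-th power gives the exponent [4 * N] split off in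
    [mult_const_bound]. *)
Definition mult_const (n N : nat) : nat :=
  N`! * (1 + Num.bound (hermite_const N) * block_bound n N) ^ N.

(* Splitting off a block with multiplier [M1 <= (mult_const * (k q)^(4 N))^2]
   replaces [q] by [M1^2 q]; [bexp] and [bcst] accumulate this over [s] steps. *)
Fixpoint bexp (N s : nat) : nat :=
  if s is s'.+1 then 2 + 8 * N + (16 * N + 1) * bexp N s' else 0.

Fixpoint bcst (n N s : nat) : nat :=
  if s is s'.+1 then
    block_bound n N + mult_const n N ^ 2 * (bcst n N s' * mult_const n N ^ (4 * bexp N s'))
  else 1.

Lemma block_const_ge0 n N : 0 <= block_const n N.
Proof.
have H1 := hermite_const_ge1 N.
rewrite /block_const /pair_const; apply: mulr_ge0; last by apply: mulr_ge0; exact: sqr_ge0.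
apply: addr_ge0 => //; apply: mulr_ge0; last lra.
by apply: mulr_ge0 => //; exact: sqr_ge0.
Qed.

Lemma block_const_le n N : block_const n N <= (block_bound n N)%:R.
Proof. exact/ltW/archi_boundP/block_const_ge0. Qed.

Lemma mult_const_gt0 n N : (0 < mult_const n N)%N.
Proof. by rewrite /mult_const muln_gt0 fact_gt0 expn_gt0. Qed.

Lemma bcst_gt0 n N s : (0 < bcst n N s)%N.
Proof.
by elim: s => //= s IH; rewrite addn_gt0 !muln_gt0 !expn_gt0 mult_const_gt0 IH.
Qed.

Lemma mult_const_term (h h' a b c x : rat) : 0 <= h -> h <= h' -> 0 <= a ->
  a <= x ^+ 2 -> 0 <= c -> c <= b * x ^+ 2 -> h * (a * c) <= h' * b * x ^+ 4.
Proof.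
move=> h0 hh a0 ax c0 cb.
have -> : h' * b * x ^+ 4 = h' * (x ^+ 2 * (b * x ^+ 2)) by ring.
by apply: ler_pM => //; [exact: mulr_ge0|exact: ler_pM].
Qed.

Lemma mult_const_bound n N (k q : nat) (c : rat) : (0 < k)%N -> (0 < q)%N ->
  0 <= c -> c <= block_const n N * (k * q)%:R ^+ 2 ->
  N`!%:R * (1 + hermite_const N * (k%:R ^+ 2 * c)) ^+ N
    <= (mult_const n N * (k * q) ^ (4 * N))%:R.
Proof.
move=> k0 q0 c0 cB; set X := (k * q)%N in cB *.
have X1 : 1 <= X%:R :> rat by rewrite ler1n muln_gt0 k0.
have H1 := hermite_const_ge1 N.
have Hb : hermite_const N <= (Num.bound (hermite_const N))%:R.
  by apply/ltW/archi_boundP; lra.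
have kX : k%:R ^+ 2 <= X%:R ^+ 2 :> rat.
  by rewrite ler_sqr ?nnegrE ?ler0n // ler_nat leq_pmulr.
have cX : c <= (block_bound n N)%:R * X%:R ^+ 2.
  by apply: (le_trans cB); rewrite ler_wpM2r ?sqr_ge0 // block_const_le.
have X4 : 1 <= X%:R ^+ 4 :> rat by rewrite exprn_ege1.
have main : 1 + hermite_const N * (k%:R ^+ 2 * c)
   <= (1 + Num.bound (hermite_const N) * block_bound n N)%:R * X%:R ^+ 4.
  rewrite natrD mulrDl mul1r lerD //.
  rewrite natrM; exact: mult_const_term (le_trans ler01 H1) Hb (sqr_ge0 _) kX c0 cX.
rewrite /mult_const !natrM -mulrA ler_wpM2l ?ler0n //.
rewrite natrX [(X ^ _)%:R]natrX exprM -exprMn.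
have p0 : 0 <= 1 + hermite_const N * (k%:R ^+ 2 * c).
  apply: addr_ge0 => //; apply: mulr_ge0; first lra.
  by apply: mulr_ge0 => //; exact: sqr_ge0.
move: main p0; move: (1 + _ * _) (_%:R * _ ^+ 4) => u w uw u0.
by apply: lerXn2r; rewrite ?nnegrE // (le_trans u0 uw).
Qed.

(** With [C = mult_const n N], the complement has parameter [X * M1 ^ 2], at most
    [C ^ 4 * X ^ (16 * N + 1)], and [M1] itself is at most [C ^ 2 * X ^ (8 * N)]; these are the
    exponents in [bexp] and [bcst]. *)
Lemma bcst_step_mult n N s (X M1 M2 : nat) : (0 < X)%N ->
  (M1 <= (mult_const n N * X ^ (4 * N)) ^ 2)%N ->
  (M2 <= bcst n N s * (X * M1 ^ 2) ^ bexp N s)%N ->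
  (M1 * M2 <= bcst n N s.+1 * X ^ bexp N s.+1)%N /\
  (bcst n N s * (X * M1 ^ 2) ^ bexp N s <= bcst n N s.+1 * X ^ bexp N s.+1)%N.
Proof.
move=> X0 h1 h2; set C := mult_const n N in h1 *; have C0 : (0 < C)%N := mult_const_gt0 n N.
set e := bexp N s in h2 *; set B := bcst n N s in h2 *.
have hX : (X * M1 ^ 2 <= C ^ 4 * X ^ (16 * N + 1))%N.
  apply: (@leq_trans (X * ((C * X ^ (4 * N)) ^ 2) ^ 2)); first by rewrite leq_mul2l leq_exp2r // h1 orbT.
  have -> : (((C * X ^ (4 * N)) ^ 2) ^ 2 = C ^ 4 * X ^ (16 * N))%N.
    by rewrite -expnM expnMn -expnM; congr (_ * X ^ _)%N; lia.
  by rewrite expnD expn1 mulnCA [(X * _)%N]mulnC.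
have h3 : (B * (X * M1 ^ 2) ^ e <= B * (C ^ (4 * e) * X ^ ((16 * N + 1) * e)))%N.
  rewrite leq_mul2l; apply/orP; right.
  apply: (@leq_trans ((C ^ 4 * X ^ (16 * N + 1)) ^ e)); last first.
    by rewrite expnMn -!expnM.
  by case: (posnP e) => [->|e0]; rewrite ?expn0 // leq_exp2r.
have big Y : (Y <= C ^ 2 * X ^ (8 * N) * (B * (C ^ (4 * e) * X ^ ((16 * N + 1) * e))))%N ->
    (Y <= bcst n N s.+1 * X ^ bexp N s.+1)%N.
  move=> hY; apply: (leq_trans hY); rewrite /= -/C -/e -/B.
  apply: (@leq_trans ((C ^ 2 * (B * C ^ (4 * e))) * X ^ (8 * N + (16 * N + 1) * e))).
    by rewrite expnD; apply: eq_leq; ring.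
  apply: leq_mul; first exact: leq_addl.
  by rewrite leq_pexp2l // -addnA leq_addl.
split; apply: big.
  apply: (@leq_trans ((C * X ^ (4 * N)) ^ 2 * (B * (X * M1 ^ 2) ^ e))); first exact: leq_mul.
  apply: leq_mul h3; rewrite expnMn -expnM.
  by rewrite (_ : 4 * N * 2 = 8 * N)%N //; lia.
by apply: (leq_trans h3); rewrite leq_pmull // muln_gt0 !expn_gt0 C0 X0.
Qed.

Lemma bcst_step_block n N s (X : nat) : (0 < X)%N ->
  (block_bound n N * X ^ 2 <= bcst n N s.+1 * X ^ bexp N s.+1)%N.
Proof.
move=> X0 /=; apply: leq_mul; first exact: leq_addr.
by rewrite leq_pexp2l // -addnA leq_addr.
Qed.

Section MainInduction.
Variables (R : realType) (F : fieldExtType rat) (D : falgType F) (dag : D -> D).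
Variables (t : F) (sig : 'I_(\dim {:F}) -> {rmorphism F -> R}).
Hypothesis inj_t : injective (fun s => sig s t).
Hypothesis pos : positive_involution dag.
Variable symp : bool.
Hypothesis caseS : if symp then is_center D
                   else quaternion_algebra D /\ totally_indefinite R D.
Variables (V : lmodType D) (psi : V -> V -> D).
Hypothesis psiP : skew_hermitian_form dag psi.
Local Notation dsqr := (dsqr dag).
Local Notation E x y := (trdQ (psi x y)).
Local Notation n := (dimQ D).

Let caseD : is_center D \/ quaternion_algebra D.
Proof. by move: caseS; case: symp => [|[]]; [left|right]. Qed.

Variables (O : set D) (N k : nat).
Hypothesis sO : subgroup O.
Hypothesis O1 : O 1.
Hypothesis OM : forall x y, O x -> O y -> O (x * y).
Hypothesis OQ : forall d, inQ O d.
Hypothesis Ospan : exists n (c : 'I_n -> D), O `<=` zspan c.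
Hypothesis Ork : rank_le N O.
Hypothesis k_gt0 : (0 < k)%N.
Hypothesis Ok : forall c, (forall x, O x -> trQ (x * c) \is a Num.int) -> O (c *+ k).

(** [trQ (a * psi x y)] is an integer multiple of [E (a *: x) y], so [psi x y] lies in the trace
    dual of [O], which [k] sends into [O]. *)
Lemma psi_order (S : set V) x y : stable O S ->
  (forall x y, S x -> S y -> E x y \is a Num.int) -> S x -> S y -> O (psi x y *+ k).
Proof.
move=> stS Eint Sx Sy; apply: Ok => a Oa.
by rewrite trQ_trdQ -(psiZl pos psiP) rpredM ?rpred_nat // Eint //; exact: stS.
Qed.

(** A coefficient is a pairing times the inverse of a Gram entry. The first has denominator [k]; the
    second is controlled by the norm estimate for [k] times the entry. *)
Lemma block_multiplier (S : set V) q p (v : 'I_p -> V) tau y :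
  stable O S -> (forall x y, S x -> S y -> E x y \is a Num.int) -> (0 < q)%N ->
  block psi v tau y -> (forall i, S (v i)) -> (p <= 2)%N ->
  (forall i, dsqr (psi (v i) (v (tau i))) <= block_const n N * (k * q)%:R ^+ 2) ->
  exists M : nat, [/\ (0 < M)%N, (M <= (mult_const n N * (k * q) ^ (4 * N)) ^ 2)%N
    & forall x i, S x -> O (bcoef psi v tau y x i *+ M)].
Proof.
move=> stS Eint q0 [tt orth inv] Sv p2 cB.
set X := (mult_const n N * (k * q) ^ (4 * N))%N.
have X0 : (0 < X)%N by rewrite muln_gt0 mult_const_gt0 expn_gt0 muln_gt0 k_gt0 q0.
have /choice[M hM] i : exists M : nat, [/\ (0 < M)%N, (M <= X)%N
    & forall x, S x -> O (bcoef psi v tau y x i *+ M)].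
  pose c := psi (v i) (v (tau i)); have [cy yc] := inv i.
  have Oc : O (c *+ k) by exact: (psi_order stS Eint).
  pose y' := qD D k%:R^-1 * y i.
  have kk : k%:R * qD D k%:R^-1 = 1 by rewrite -qD_C natD_inv.
  have cy' : (c *+ k) * y' = 1.
    by rewrite /y' -[c *+ k]mulr_natr -mulrA [k%:R * _]mulrA kk mul1r.
  have yc' : y' * (c *+ k) = 1.
    by rewrite /y' mulrnAr -mulr_natr -!mulrA [y i * (_ * _)]mulrA yc mul1r natD_inv.
  have [M [M0 Mle OyM]] :=
    order_inverse_bound inj_t caseD pos sO O1 OM OQ Ospan Ork Oc cy' yc'.
  exists M; split=> //.
    rewrite -(ler_nat rat) (le_trans Mle) // (dsqrMn inj_t caseD pos).
    exact: mult_const_bound (dsqr_ge0 pos _) (cB i).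
  move=> x Sx; have -> : bcoef psi v tau y x i *+ M = (psi x (v (tau i)) *+ k) * (y' *+ M).
    rewrite /bcoef /y' mulrnAr; congr (_ *+ M).
    by rewrite -[_ *+ k]mulr_natr -!mulrA [k%:R * _]mulrA kk mul1r.
  by apply: OM => //; exact: (psi_order stS Eint).
(* The block has at most two vectors, which accounts for the square in the bound. *)
exists (\prod_i M i)%N; split.
- by rewrite prodn_gt0 // => i; case: (hM i).
- apply: (@leq_trans (\prod_(i < p) X)); first by apply: leq_prod => i _; case: (hM i).
  by rewrite prod_nat_const card_ord leq_pexp2l.
- move=> x i Sx; rewrite (bigD1 i) //= mulrnA; apply: (subgroupMn sO).
  by case: (hM i) => _ _; apply.
Qed.

(** Two rank bounds are kept: [N] stays fixed and governs the constants, while [s] decreases and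
    drives the induction. *)
Theorem reduced_family s : forall (S : set V) (q : nat),
  subgroup S -> stable O S -> nondeg psi S -> rank_le N S -> rank_le s S ->
  (exists l (b : 'I_l -> V), S `<=` zspan b) ->
  (forall x y, S x -> S y -> E x y \is a Num.int) -> (0 < q)%N -> dual psi S q ->
  exists p (v : 'I_p -> V) tau y M,
    [/\ block psi v tau y /\ shape symp tau, (forall i, S (v i)) /\ spanned psi v tau y S,
        forall i, dsqr (psi (v i) (v (tau i))) <= (bcst n N s * (k * q) ^ bexp N s)%:R,
        (0 < M)%N /\ (M <= bcst n N s * (k * q) ^ bexp N s)%N
      & forall x i, S x -> O (bcoef psi v tau y x i *+ M)].
Proof.
elim: s => [|s IH] S q sS stS nd rkN rk sub Eint q0 dS.
all: have kq0 : (0 < k * q)%N by rewrite muln_gt0 k_gt0.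
all: have triv s' : (forall x, S x -> x = 0) -> exists p (v : 'I_p -> V) tau y M,
    [/\ block psi v tau y /\ shape symp tau, (forall i, S (v i)) /\ spanned psi v tau y S,
        forall i, dsqr (psi (v i) (v (tau i))) <= (bcst n N s' * (k * q) ^ bexp N s')%:R,
        (0 < M)%N /\ (M <= bcst n N s' * (k * q) ^ bexp N s')%N
      & forall x i, S x -> O (bcoef psi v tau y x i *+ M)].
  1,3: move=> S0; exists 0%N, (fun=> 0), id, (fun=> 0), 1%N.
  1,2: split; [by split; [split; case|case]| |by case| |by move=> x; case].
  1,3: by split; [case|move=> x /S0 ->; rewrite big_ord0].
  1,2: by rewrite muln_gt0 bcst_gt0 expn_gt0 kq0.
- apply: triv => x Sx; have [z [[i zi]]] := rk (fun=> x) (fun=> Sx).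
  move: zi; rewrite (ord1 i) => zi; rewrite big_ord1 => /mulrz_eq0V; apply.
  exact/eqP.
have [nz|z0] := pselect (exists2 x, S x & x != 0); last first.
  apply: triv => x Sx; apply/eqP/negPn/negP => x0; by apply: z0; exists x.
have [v [tau [y [blk shp Sv cB]]]] :=
  quantitative_block inj_t pos caseS psiP sO O1 OM OQ Ospan Ork k_gt0 Ok sS stS nd rkN sub q0 dS nz.
have p2 : (symp.+1 <= 2)%N by case: symp.
have [M1 [M10 M1le OM1]] := block_multiplier stS Eint q0 blk Sv p2 cB.
have Sp : perp psi v S `<=` S by move=> x [].
have sub' : exists l (b : 'I_l -> V), perp psi v S `<=` zspan b.
  by have [l [b hb]] := sub; exists l, b => x /Sp/hb.
have [|||||||p [v2 [tau2 [y2 [M2 [[blk2 shp2] [Sv2 sp2] c2 [M20 M2le] OM2]]]]]] :=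
  IH (perp psi v S) (M1 ^ 2 * q)%N (perp_subgroup psiP v sS) (perp_stable pos psiP stS).
- exact: (perp_nondeg pos psiP sS stS Sv blk M10 OM1).
- exact: rank_le_sub rkN.
- exact: (perp_rank psiP blk _ Sv rk).
- exact: sub'.
- by move=> x x' /Sp Sx /Sp; exact: Eint.
- by rewrite muln_gt0 expn_gt0 M10 q0.
- exact: (perp_dual pos psiP sS stS Sv blk OM1).
- have kE : (k * (M1 ^ 2 * q) = k * q * M1 ^ 2)%N by ring.
  rewrite kE in c2 M2le.
  have [MM CC] := bcst_step_mult kq0 M1le M2le.
  (* Coefficients along the complement, once multiplied by [M1], are those of [bproj x], which lies
     in the complement lattice. Hence [M1 * M2] serves for all coefficients. *)
  have bproj2 x i : bcoef psi v2 tau2 y2 (bproj psi v tau y M1 x) i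
      = bcoef psi v2 tau2 y2 x i *+ M1.
    rewrite /bcoef (@psi_bproj _ _ _ pos _ _ psiP S _ v tau y M1 x _ (Sv2 (tau2 i))).
    by rewrite mulrnAl.
  exists (symp.+1 + p)%N, (cat_fam v v2), (cat_tau tau tau2), (cat_fam y y2), (M1 * M2)%N.
  split.
  + split; first by apply: (cat_block pos psiP blk blk2) => i j; exact: (Sv2 j).2.
    move=> i; rewrite -(splitK i); case: (fintype.split i) => j /=.
      by rewrite /cat_tau cat_faml /= shp.
    rewrite /cat_tau cat_famr /= shp2 /pairing; clear.
    by case: symp => //=; rewrite !addSn !add0n /= negbK; case: (nat_of_ord j) => [|l] //=; case: ifP.
  + split.
      move=> i; rewrite -(splitK i); case: (fintype.split i) => j /=.
        by rewrite cat_faml.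
      by rewrite cat_famr; exact/Sp.
    move=> x Sx; rewrite cat_bcoef_sum.
    have pb := bproj_perp pos psiP sS stS Sv blk OM1 Sx.
    have e := bprojE psi v tau y M1 x; rewrite (sp2 _ pb) in e.
    apply/eqP; rewrite -subr_eq0; apply/eqP/(mulrn_eq0V M10).
    rewrite mulrnBl e mulrnDl -!sumrMnl; apply/eqP; rewrite subr_eq0; apply/eqP.
    congr (_ + _); apply: eq_bigr => i _; first by rewrite scalerMnl.
    by rewrite bproj2 scalerMnl.
  + move=> i; rewrite -(splitK i); case: (fintype.split i) => j /=;
      rewrite /cat_tau ?(cat_faml, cat_famr).
      apply: (le_trans (cB j)).
      apply: (@le_trans _ _ (block_bound n N * (k * q) ^ 2)%:R).
        rewrite [leRHS]natrM [(_ ^ 2)%:R]natrX; apply: ler_wpM2r; [exact: sqr_ge0|exact: block_const_le].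
      by rewrite ler_nat bcst_step_block.
    by apply: (le_trans (c2 j)); rewrite ler_nat.
  + by rewrite muln_gt0 M10 M20.
  + move=> x i Sx; rewrite -(splitK i); case: (fintype.split i) => j /=.
      by rewrite cat_bcoefl mulrnA; apply: (subgroupMn sO); exact: OM1.
    rewrite cat_bcoefr mulrnA -bproj2; apply: OM2.
    exact: (bproj_perp pos psiP sS stS Sv blk OM1).
Qed.

End MainInduction.

(** * Dimension, index and discriminant of a lattice *)

Lemma rank_le_free (U : zmodType) (S : set U) s l (g : 'I_l -> U) :
  rank_le s S -> (forall i, S (g i)) ->
  (forall z : 'I_l -> int, \sum_i g i *~ z i = 0 -> forall i, z i = 0) -> (l <= s)%N.
Proof.
move=> rk Sg fr; rewrite leqNgt; apply/negP => sl.
have [//|z [[i zi] zE]] := rk (fun i => g (widen_ord sl i)).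
pose z' (i : 'I_l) := if insub (val i) is Some j then z j else 0.
have /fr/(_ (widen_ord sl i)) : \sum_i g i *~ z' i = 0.
  rewrite -[RHS]zE (bigID (fun i : 'I_l => (i < s.+1)%N)) /=.
  rewrite [X in _ + X]big1 ?addr0; last first.
    by move=> j hj; rewrite /z' insubF ?mulr0z //; apply/negbTE.
  rewrite (big_ord_narrow sl); apply: eq_bigr => j _; rewrite /z' /=.
  case: insubP => [u _ uj|]; last by rewrite ltn_ord.
  by congr (_ *~ z _); exact: val_inj.
rewrite /z' /=; case: insubP => [u _ uj|]; last by rewrite ltn_ord.
by rewrite (_ : u = i); [move=> e; rewrite e eqxx in zi|exact: val_inj].
Qed.

Lemma dbasis_zfree (F : fieldExtType rat) (D : falgType F) (V : lmodType D) p :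
  has_dim V p -> exists g : 'I_(p * dimQ D) -> V,
    forall z : 'I_(p * dimQ D) -> int, \sum_i g i *~ z i = 0 -> forall i, z i = 0.
Proof.
move=> [v [_ ind]]; rewrite /dimQ.
pose J := ('I_p * ('I_(\dim {:F}) * 'I_(\dim {:D})))%type.
have cJ : #|{: J}| = (p * (\dim {:F} * \dim {:D}))%N by rewrite !card_prod !card_ord.
rewrite -cJ; pose g (j : J) : V := ((vbasis {:F})`_j.2.1 *: (vbasis {:D})`_j.2.2) *: v j.1.
exists (fun i => g (enum_val i)) => z zE i.
pose w (j : J) := z (enum_rank j).
rewrite -(enum_valK i) -/(w _); case: (enum_val i) => a [c d].
have e : \sum_(j : J) g j *~ w j = 0.
  rewrite -[RHS]zE (reindex_onto enum_rank enum_val) /=; last by move=> j _; exact: enum_valK.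
  by apply: eq_big => [j|j _]; rewrite ?enum_rankK ?eqxx.
have {}e : \sum_a (\sum_d (\sum_c (w (a, (c, d)))%:~R *: (vbasis {:F})`_c) *: (vbasis {:D})`_d)
      *: v a = 0.
  rewrite -[RHS]e; transitivity (\sum_a \sum_c \sum_d g (a, (c, d)) *~ w (a, (c, d))).
    apply: eq_bigr => b _; rewrite exchange_big /= scaler_suml; apply: eq_bigr => d' _.
    rewrite scaler_suml scaler_suml; apply: eq_bigr => c' _.
    by rewrite /g /= scale_intV scalerA scaler_int mulrzl !scalerMzl.
  under eq_bigr => a' _ do rewrite (pair_bigA _ (fun c d => g (a', (c, d)) *~ w (a', (c, d)))).
  by rewrite pair_bigA /=; apply: eq_bigr => -[a' [c' d']].
have := ind _ e a.
move=> /(congr1 (coord (vbasis {:D}) d)).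
rewrite (coord_sum_free _ _ (basis_free (vbasisP _))) linear0.
move=> /(congr1 (coord (vbasis {:F}) c)).
rewrite (coord_sum_free (fun c => (w (a, (c, d)))%:~R) _ (basis_free (vbasisP _))) linear0.
by move=> /eqP; rewrite intr_eq0 => /eqP.
Qed.

(** The quaternion algebra may be split, so uniqueness of the [D]-dimension is obtained by comparing
    ranks over Z rather than from division-ring linear algebra. *)
Lemma dim_unique (F : fieldExtType rat) (D : falgType F) (V : lmodType D) m p :
  has_dim V m -> has_dim V p -> m = p.
Proof.
have n0 : (0 < dimQ D)%N by rewrite /dimQ muln_gt0 (adim_gt0 {:F}%AS) (adim_gt0 {:D}%AS).
have le a b : has_dim V a -> has_dim V b -> (a <= b)%N.
  move=> /dbasis_zfree[g fg] /rank_le_module rk.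
  by have := rank_le_free rk (fun=> I) fg; rewrite leq_pmul2r.
by move=> hm hp; apply/eqP; rewrite eqn_leq !le.
Qed.

(** Every coset has a representative with coordinates between 0 and [M - 1]; one of these is
    selected in each coset. *)
Lemma index_bound (U : zmodType) (L N : set U) l (b : 'I_l -> U) (M : nat) :
  zbasis L b -> subgroup N -> N `<=` L -> (0 < M)%N ->
  (forall x, L x -> N (x *+ M)) -> exists2 k : nat, has_index L N k & (k <= M ^ l)%N.
Proof.
move=> bL sN NL M0 MN; have sL := zbasis_subgroup bL.
case: M M0 MN => // M _ MN.
pose r (g : {ffun 'I_l -> 'I_M.+1}) := \sum_i b i *~ (g i)%:Z.
have Lr g : L (r g) by apply/bL.1; exists (fun i => (g i)%:Z).
pose P g := [pred g' | `[< N (r g - r g') >]].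
pose cano g := odflt g [pick g' | P g g'].
have canoP g : N (r g - r (cano g)).
  rewrite /cano; case: pickP => [g' /asboolP//|_] /=.
  by rewrite subrr; exact: subgroup0.
have cano_eq g g' : N (r g - r g') -> cano g = cano g'.
  move=> gg'; have Pgg : P g =1 P g'.
    move=> h; apply/asboolP/asboolP => H.
      have -> : r g' - r h = (r g - r h) - (r g - r g') by zmod.
      exact: subgroupB.
    have -> : r g - r h = (r g - r g') + (r g' - r h) by zmod.
    exact: subgroupD.
  rewrite /cano (eq_pick Pgg); case: pickP => //= /(_ g').
  by rewrite /= => /asboolP; case; rewrite subrr; exact: subgroup0.
have repr x : L x -> exists g, N (x - r g).
  move=> /bL.1[c ->].
  exists [ffun i => inord `|(c i %% M.+1%:Z)%Z|].
  have -> : \sum_i b i *~ c i - r [ffun i => inord `|(c i %% M.+1%:Z)%Z|]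
     = (\sum_i b i *~ (c i %/ M.+1%:Z)%Z) *+ M.+1.
    rewrite -sumrB -sumrMnl; apply: eq_bigr => i _.
    have ge0 : 0 <= (c i %% M.+1%:Z)%Z by rewrite modz_ge0.
    have lt : (`|(c i %% M.+1%:Z)%Z| < M.+1)%N.
      by rewrite -ltz_nat gez0_abs // ltz_pmod.
    rewrite ffunE inordK // gez0_abs // -mulrzBr {1}(divz_eq (c i) M.+1%:Z) addrK.
    by rewrite mulrzA -pmulrn.
  by apply: MN; apply/bL.1; eexists.
pose K := [pred g | cano g == g].
have Kcano g : K (cano g) by rewrite /= -(cano_eq _ _ (canoP g)).
exists #|K|; last first.
  by rewrite (leq_trans (max_card K)) // card_ffun !card_ord.
split=> //; exists (fun i => r (enum_val i)); split=> // x Lx.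
have [g xg] := repr x Lx; have Kg : cano g \in K by exact: Kcano.
exists (enum_rank_in Kg (cano g)); split=> [|j xj].
  rewrite enum_rankK_in //.
  by rewrite -(subrK (r g) x) -addrA; apply: (subgroupD sN).
apply: enum_val_inj; rewrite enum_rankK_in //.
have /eqP <- : cano (enum_val j) == enum_val j := enum_valP j; apply: cano_eq.
have -> : r g - r (enum_val j) = (x - r (enum_val j)) - (x - r g) by zmod.
exact: subgroupB.
Qed.

Section Lattice.
Variables (F : fieldExtType rat) (D : falgType F) (dag : D -> D).
Hypothesis pos : positive_involution dag.
Variables (V : lmodType D) (psi : V -> V -> D).
Hypothesis psiP : skew_hermitian_form dag psi.
Hypothesis nd : nondegenerate_form psi.
Variables (L : set V) (l : nat) (b : 'I_l -> V).
Hypothesis bL : zbasis L b.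
Hypothesis LQ : forall x, inQ L x.
Local Notation E x y := (trdQ (psi x y)).

Let psiDl := psiDl psiP.
Let psiDr := psiDr psiP.

Let EDl x x' y : E (x + x') y = E x y + E x' y.
Proof. by rewrite psiDl trdQD. Qed.

Let EDr x y y' : E x (y + y') = E x y + E x y'.
Proof. by rewrite psiDr trdQD. Qed.

Lemma lattice_nondeg : nondeg psi L.
Proof.
move=> x Lx x0; have [y xy] := nd x0; have [K [K0 Ky]] := LQ y.
exists (y *+ K); split=> //; rewrite (biaddMnr psiDr); apply: contra_neq xy.
exact: (@mulrn_eq0V F D (D^o : lmodType D)).
Qed.

(** Pairing [x] with [psi x y *: y] gives [dsqr] of [psi x y], so nondegeneracy of [psi] passes to
    its trace. *)
Lemma trace_form_nondeg x : (forall y, L y -> E x y = 0) -> x = 0.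
Proof.
move=> Ex; apply/eqP/negPn/negP => /nd[y /eqP]; apply.
have Exy z : E x z = 0.
  have [K [K0 Kz]] := LQ z; have := Ex _ Kz; rewrite (biaddMnr EDr) => /eqP.
  by rewrite mulrn_eq0 eqn0Ngt K0 => /eqP.
apply/eqP/negPn/negP => /(dsqr_gt0 pos); rewrite /dsqr -(psiZr psiP) Exy.
by rewrite ltxx.
Qed.

Hypothesis Eint : forall x y, L x -> L y -> E x y \is a Num.int.

(** Cramer's rule over the integers; invertibility of the Gram matrix comes from [trace_form_nondeg]
    after clearing denominators. *)
Lemma gram_dual r (c : 'I_r -> V) : zbasis L c ->
  exists q : nat, [/\ (0 < q)%N, `|\det (\matrix_(i, j) E (c i) (c j))| = q%:R
    & dual psi L q].
Proof.
move=> cL; set G := \matrix_(i, j) _; have sL := zbasis_subgroup cL.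
have Lc i : L (c i) := zbasis_mem cL i.
have /choice[g gE] (p : 'I_r * 'I_r) : exists z : int, E (c p.1) (c p.2) = z%:~R.
  by have /intrP := Eint (Lc p.1) (Lc p.2).
pose H := \matrix_(i, j) g (i, j).
have GH : G = map_mx intr H by apply/matrixP => i j; rewrite !mxE -(gE (i, j)).
have detGH : \det G = (\det H)%:~R by rewrite GH det_map_mx.
have Ez (z : 'I_r -> int) j :
    E (\sum_i c i *~ z i) (c j) = ((\row_i z i *m H) 0 j)%:~R.
  rewrite (biadd_suml EDl) mxE rmorph_sum; apply: eq_bigr => i _.
  by rewrite (biaddMzl EDl) !mxE (gE (i, j)) rmorphM /= -[LHS]mulrzr mulrC.
have Gu : G \in unitmx.
  rewrite -row_free_unit; apply: inj_row_free => v v0.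
  have [K [z [K0 zE]]] := common_denominator (fun i => v 0 i).
  have x0 : \sum_i c i *~ z i = 0.
    have Ex j : E (\sum_i c i *~ z i) (c j) = 0.
      rewrite Ez mxE rmorph_sum; have /matrixP/(_ 0 j) := v0; rewrite !mxE => e.
      transitivity ((\sum_i v 0 i * G i j) * K%:R); last by rewrite e mul0r.
      rewrite mulr_suml; apply: eq_bigr => i _.
      by rewrite GH !mxE rmorphM /= -zE mulrAC.
    apply: trace_form_nondeg => y /cL.1[w ->]; rewrite (biadd_sumr EDr) big1 // => j _.
    by rewrite (biaddMzr EDr) Ex mul0rz.
  apply/rowP => i; rewrite [RHS]mxE; have := zE i; rewrite (cL.2 _ x0 i) => /eqP.
  by rewrite mulf_eq0 pnatr_eq0 eqn0Ngt K0 orbF => /eqP.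
have detn0 : \det H != 0 by rewrite -(@intr_eq0 rat) -detGH -unitfE -unitmxE.
exists `|\det H|%N; split; first by rewrite absz_gt0.
  by rewrite detGH -intr_norm natr_absz.
(* The sign turns [det H] into the positive number [q]. *)
move=> lam lamD; pose z := (sgz (\det H)) *: (\row_i lam (c i) *m \adj H).
have zH j : (z *m H) 0 j = `|\det H|%N%:Z * lam (c j).
  rewrite /z -scalemxAl -mulmxA mul_adj_mx mul_mx_scalar scalerA !mxE.
  by rewrite abszE normrEsg sgrEz intz.
have Ew j : E (\sum_i c i *~ z 0 i) (c j) = (`|\det H|%N%:Z * lam (c j))%:~R.
  by rewrite Ez -zH; congr ((_ *m _) _ _)%:~R; apply/rowP => i; rewrite mxE.
exists (\sum_i c i *~ z 0 i); first by apply/cL.1; eexists.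
move=> x /cL.1[w ->]; rewrite (additive_on_sum sL lamD) // (biadd_sumr EDr).
rewrite mulr_sumr rmorph_sum; apply: eq_bigr => j _.
by rewrite (biaddMzr EDr) Ew -[LHS]mulrzr -intrM /=; congr (_%:~R); ring.
Qed.

Lemma disc_lattice_spec :
  exists q : nat, [/\ (0 < q)%N, `|disc_lattice psi L| = q%:R & dual psi L q].
Proof.
rewrite /disc_lattice /gram_disc; set P := [set d | _].
have [r [c [cL ->]]] : P (xget 0 P).
  by apply: (xgetPex 0); exists (\det (\matrix_(i, j) E (b i) (b j))), l, b.
exact: gram_dual.
Qed.

End Lattice.

Lemma center_not_quaternion (F : fieldExtType rat) (D : falgType F) :
  is_center D -> ~ quaternion_algebra D.
Proof.
move=> cD qD; have := dim_quat qD; suff -> : fullv = <[1 : D]>%VS.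
  by rewrite dim_vline oner_eq0.
apply/eqP; rewrite eqEsubv subvf andbT; apply/subvP => x _.
by have [a ->] := cD x; rewrite memvZ ?memv_line.
Qed.

Lemma shape_symplectic (D : nzRingType) (V : lmodType D) (psi : V -> V -> D) m
    (v : 'I_m -> V) tau :
  (forall i j, j != tau i -> psi (v i) (v j) = 0) -> shape true tau ->
  weakly_symplectic psi v.
Proof.
move=> orth sh i j nij; apply: orth; apply/eqP => e; apply: nij.
exists i./2; rewrite e sh /pairing; have := odd_double_half i.
by case: (odd i) => /= h; [right|left]; split; lia.
Qed.

Lemma shape_unitary (D : nzRingType) (V : lmodType D) (psi : V -> V -> D) m
    (v : 'I_m -> V) tau :
  (forall i j, j != tau i -> psi (v i) (v j) = 0) -> shape false tau ->
  weakly_unitary psi v.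
Proof.
move=> orth sh i j ij; apply: orth; rewrite eq_sym; apply: contra_neq ij => e.
by apply: ord_inj; rewrite -e sh.
Qed.

(** * From the induction to the stated bounds *)

Definition basis_bound (n N x : nat) : nat := bcst n N N * x ^ bexp N N.

(** The multiplier [M] of the coefficients sends [L] into the span over the stabilizer. As [L] has
    rank [m * dimQ D], the index is at most [M] to that power, whence the outer exponent. *)
Theorem reduced_basis (R : realType) (m : nat) (F : fieldExtType rat) (D : falgType F)
    (dag : D -> D) (V : lmodType D) (psi : V -> V -> D) (L : set V) (symp : bool) :
  (0 < m)%N -> totally_real R F ->
  (if symp then is_center D else quaternion_algebra D /\ totally_indefinite R D) ->
  positive_involution dag -> has_dim V m -> skew_hermitian_form dag psi ->
  nondegenerate_form psi -> full_lattice m L ->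
  (forall x y, L x -> L y -> trdQ (psi x y) \is a Num.int) ->
  exists k q : nat,
    [/\ (0 < k)%N, `|disc_order (stab L)| = k%:R, (0 < q)%N, `|disc_lattice psi L| = q%:R
    & exists (v : 'I_m -> V) tau,
    [/\ dbasis v /\ (forall i, L (v i)),
        forall i j, j != tau i -> psi (v i) (v j) = 0,
        shape symp tau,
        forall i, dsqr dag (psi (v i) (v (tau i)))
          <= (basis_bound (dimQ D) (m * dimQ D) (k * q))%:R
      & exists2 K : nat, has_index L (span_over (stab L) v) K &
          (K <= basis_bound (dimQ D) (m * dimQ D) (k * q) ^ (m * dimQ D))%N]].
Proof.
move=> m0 realF caseS pos dV psiP nd [b bL] Eint; set N := (m * dimQ D)%N in b bL *.
have caseD : is_center D \/ quaternion_algebra D.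
  by move: caseS; case: symp => [|[]]; [left|right].
have [t [sig inj_t]] := exists_real_embeddings realF.
have LQ := rank_le_full dV bL (leqnn N).
have sL := zbasis_subgroup bL.
have sO := stab_subgroup bL.
have OQ := stab_inQ bL LQ; have Ospan := stab_zspan m0 dV bL LQ.
have Ork : rank_le N (stab L) := stab_rank m0 dV (L := L).
have [k [k0 kE Ok]] :=
  disc_order_spec inj_t caseD pos sO (@stabM _ _ _ L) OQ Ospan Ork.
have [q [q0 qE dL]] := disc_lattice_spec pos psiP nd bL LQ Eint.
have rkL : rank_le N L by apply: rank_le_sub (rank_le_module dV).
have subL : exists l (c : 'I_l -> V), L `<=` zspan c.
  by exists N, b => x /bL.1.
have [p [v [tau [y [M [[blk sh] [Lv sp] cB [M0 MB] OM]]]]]] :=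
  reduced_family inj_t pos caseS psiP sO (@stab1 _ _ _ L) (@stabM _ _ _ L) OQ Ospan Ork
    k0 Ok sL (fun a x Oa => Oa x) (lattice_nondeg psiP nd LQ) rkL rkL subL Eint q0 dL.
have bv : dbasis v.
  split=> [x|a]; last exact: (block_free pos psiP blk).
  have [K [K0 Kx]] := LQ x.
  exists (fun i => qD D K%:R^-1 * bcoef psi v tau y (x *+ K) i).
  rewrite -{1}(natV_inv x K0) {1}(sp _ Kx) scaler_sumr.
  by apply: eq_bigr => i _; rewrite scalerA.
(* The induction does not count the vectors it produces; their number is determined once they form a
   [D]-basis. *)
have e : m = p by apply: dim_unique dV _; exists v.
subst p; exists k, q; split=> //; exists v, tau; split=> //.
  by case: blk.
pose NN := span_over (stab L) v.
have sNN : subgroup NN.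
  split=> [|x x' [a [Oa ->]] [a' [Oa' ->]]].
    exists (fun=> 0); split=> [i|]; first exact: (subgroup0 sO).
    by rewrite big1 // => i _; rewrite scale0r.
  exists (fun i => a i - a' i); split=> [i|]; first exact: (subgroupB sO).
  by rewrite -sumrB; apply: eq_bigr => i _; rewrite scalerBl.
have NL : NN `<=` L.
  by move=> x [a [Oa ->]]; apply: (subgroup_sum sL) => i _; exact: Oa.
have MN x : L x -> NN (x *+ M).
  move=> Lx; exists (fun i => bcoef psi v tau y x i *+ M); split=> [i|]; first exact: OM.
  by rewrite {1}(sp _ Lx) -sumrMnl; apply: eq_bigr => i _; rewrite scalerMnl.
have [K hK KM] := index_bound bL sNN NL M0 MN.
exists K => //; apply: (leq_trans KM).
by case: (posnP N) => [->|N0]; rewrite ?expn0 // leq_exp2r.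
Qed.

(** A natural number is at least its own square root, so the bound on the square is reused as it
    stands. *)
Lemma dnorm_le (R : realType) (F : fieldExtType rat) (D : falgType F) (dag : D -> D)
    (x : D) (B : nat) :
  dsqr dag x <= B%:R -> dnorm R dag x <= B%:R.
Proof.
move=> xB; rewrite /dnorm -[leRHS]ger0_norm // -sqrtr_sqr; apply: ler_wsqrtr.
rewrite (@le_trans _ _ (ratr B%:R)) ?ler_rat // ratr_nat -natrX ler_nat.
by case: B {xB} => // B; rewrite leq_pmulr.
Qed.

(** The exponent [e.+1] instead of [e] keeps the real exponents positive even when [e] is 0; [k] and
    [q] are at least 1. *)
Lemma powR_bound (R : realType) (C k q e : nat) : (0 < k)%N -> (0 < q)%N ->
  (C * (k * q) ^ e)%:R <= C%:R * powR k%:R e.+1%:R * powR q%:R e.+1%:R :> R.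
Proof.
move=> k0 q0; rewrite !powR_mulrn // -mulrA -exprMn -natrM -natrX -natrM ler_nat.
by rewrite leq_mul2l leq_pexp2l ?orbT // muln_gt0 k0.
Qed.

Theorem theorem1p2 (R : realType) (m n : nat) (m_gt0 : (0 < m)%N) :
  exists c1 c2 c3 c4 c5 c6 : R,
    ((0 < c1) /\ (0 < c2) /\ (0 < c3) /\ (0 < c4) /\ (0 < c5) /\ (0 < c6)) /\
    forall (F : fieldExtType rat) (D : falgType F) (dag : D -> D)
           (V : lmodType D) (psi : V -> V -> D) (L : set V),
      totally_real R F ->
      is_center D \/ (quaternion_algebra D /\ totally_indefinite R D) ->
      dimQ D = n ->
      positive_involution dag ->
      has_dim V m ->
      skew_hermitian_form dag psi ->
      nondegenerate_form psi ->
      full_lattice m L ->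
      (forall x y, L x -> L y -> trdQ (psi x y) \is a Num.int) ->
      exists v : 'I_m -> V,
        dbasis v /\
        (forall i, L (v i)) /\
        (is_center D -> weakly_symplectic psi v) /\
        (quaternion_algebra D -> weakly_unitary psi v) /\
        (exists k : nat,
           has_index L (span_over (stab L) v) k /\
           k%:R <= c1 * powR (ratr `|disc_order (stab L)|) c2
                      * powR (ratr `|disc_lattice psi L|) c3) /\
        (forall i j : 'I_m,
           dnorm R dag (psi (v i) (v j))
             <= c4 * powR (ratr `|disc_order (stab L)|) c5
                   * powR (ratr `|disc_lattice psi L|) c6).
Proof.
pose N := (m * n)%N; pose C := bcst n N N; pose e := bexp N N.
have C0 : (0 < C)%N := bcst_gt0 n N N.
(* The index bound is the [N]-th power of the bound [C * (k * q) ^ e] on the multiplier, the norm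
   bound is its first power. *)
exists (C ^ N)%:R, (e * N).+1%:R, (e * N).+1%:R, C%:R, e.+1%:R, e.+1%:R.
split; first by rewrite !ltr0n expn_gt0 C0.
move=> F D dag V psi L realF caseD dimD pos dV psiP nd fL Eint.
have [symp caseS] : exists symp : bool, if symp then is_center D
    else quaternion_algebra D /\ totally_indefinite R D.
  by case: caseD => ?; [exists true|exists false].
have [k [q [k0 -> q0 -> [v [tau [[bv Lv] orth sh cB [K hK KB]]]]]]] :=
  reduced_basis m_gt0 realF caseS pos dV psiP nd fL Eint.
rewrite dimD in cB KB; exists v; split=> //; split=> //; split; [|split; [|split]].
- move=> cD; move: caseS sh; case: symp => [_|[/(center_not_quaternion cD)//]].
  exact: shape_symplectic.
- move=> qD; move: caseS sh; case: symp => [/center_not_quaternion/(_ qD)//|_].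
  exact: shape_unitary.
- exists K; split=> //; rewrite !ratr_nat.
  apply: le_trans (powR_bound R (C ^ N) (e * N) k0 q0).
  by rewrite ler_nat (leq_trans KB) // /basis_bound expnMn -expnM.
- move=> i j; rewrite !ratr_nat; apply: le_trans (powR_bound R C e k0 q0).
  have [->|ij] := eqVneq j (tau i); first exact: dnorm_le.
  rewrite orth //; apply: dnorm_le; rewrite dsqr0; exact: ler0n.
Qed.
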